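(* Let $\alpha = 1/\sqrt2$, $\nu_\natural=\pi/4$, and consider the following procedure with parameters $\sigma>0$, $\beta>0$ and integers $T_{\mathrm{rough}}, T_\nu, T_u\ge 1$: set $u_0 = \mathbf{1}_{[-1,1]}$ and $u_{\mathrm{rough}} = \mathsf{P}(T_{\mathrm{rough}}, u_0, 0)$; draw $\nu_0\sim\mathrm{Unif}[0,2\pi]$ and iterate $\nu_{k+1} = \nu_k - \beta\,\nabla_\nu\mathcal{L}^{\sigma}(\nu_k, u_{\mathrm{rough}})$ for $k=0,\dots,T_\nu-1$, setting $\hat\nu = \nu_{T_\nu}$; finally set $\hat u = \mathsf{P}(T_u, u_{\mathrm{rough}}, \hat\nu)$. There are absolute constants $c_1, C_1, C_2>0$ such that if $\sigma^2\le 10^{-4}$, $\beta\le c_1$, $0<\varepsilon\le \frac1{768}$, and $$T_{\mathrm{rough}}\ge -C_1\log(\sigma^2\varepsilon),\qquad T_\nu \ge -\frac{C_2\log(3\varepsilon)}{\beta},\qquad T_u\ge 16,$$ then with probability at least $4/7$ over the draw of $\nu_0$, $$\min\Big\{ |\hat\nu-\nu_\natural| \bmod \tfrac{\pi}{2},\ \tfrac{\pi}{2} - \big(|\hat\nu-\nu_\natural|\bmod\tfrac{\pi}{2}\big)\Big\}\le 3\varepsilon,\qquad \|\hat u - u_\natural\|_{L^2(\mathbb{R})}\le 31\sqrt{\varepsilon}.$$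
   Context: Template: $u_\natural = \mathbf{1}_{[-\alpha,\alpha]}\in L^2(\mathbb{R})$ and $X_\natural(s,t) = u_\natural(s)u_\natural(t)$, the indicator of the square $[-\alpha,\alpha]^2$. For $u\in L^2(\mathbb{R})$, $uu^*$ denotes the function $(s,t)\mapsto u(s)u(t)$ on $\mathbb{R}^2$. For $\nu\in\mathbb{R}$, $\tau_\nu:\mathbb{R}^2\to\mathbb{R}^2$ is $\tau_\nu(\mathbf{x}) = \mathbf{R}_\nu\mathbf{x}$ with $\mathbf{R}_\nu = \begin{bmatrix}\cos\nu&-\sin\nu\\ \sin\nu&\cos\nu\end{bmatrix}$ and $\mathbf{x}=(s,t)$. Let $\varphi^{(2)}_{\sigma^2}(\mathbf{x}) = (2\pi\sigma^2)^{-1}e^{-\|\mathbf{x}\|_2^2/(2\sigma^2)}$ and $\ast$ denote convolution on $\mathbb{R}^2$. The loss is $$\mathcal{L}^\sigma(\nu,u) = \tfrac12\big\|\varphi^{(2)}_{\sigma^2}\ast\big(X_\natural\circ\tau_{\nu-\nu_\natural} - uu^*\big)\big\|_{L^2(\mathbb{R}^2)}^2,$$ and $\nabla_\nu\mathcal{L}^\sigma$ is its derivative in $\nu$. For $f\in L^2(\mathbb{R}^2)$, $\mathcal{T}_f:L^2(\mathbb{R})\to L^2(\mathbb{R})$ is $\mathcal{T}_f[g](s)=\int_{\mathbb{R}} f(s,t)g(t)\,dt$, with adjoint $\mathcal{T}_f^*$. Power method: for $\nu\in\mathbb{R}$ let $A_\nu = \mathcal{T}_{X_\natural\circ\tau_{\nu-\nu_\natural}}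 + \mathcal{T}^*_{X_\natural\circ\tau_{\nu-\nu_\natural}}$; given $w_0\in L^2(\mathbb{R})$ set $w_{j+1} = A_\nu w_j/\|A_\nu w_j\|_{L^2(\mathbb{R})}$, and define $\mathsf{P}(k, w_0, \nu) = \sqrt{\tfrac12\langle w_k, A_\nu w_k\rangle}\; w_k$. *)

(* Defs.v *)
From HB Require Import structures.
From mathcomp Require Import all_boot all_order all_algebra.
From mathcomp Require Import all_classical all_reals all_analysis.
Set Implicit Arguments. Unset Strict Implicit. Unset Printing Implicit Defensive.
Import Order.TTheory GRing.Theory Num.Theory.
Import numFieldNormedType.Exports.
Local Open Scope classical_set_scope.
Local Open Scope ring_scope.

Section Defs.
Variable R : realType.

Definition leb := (@lebesgue_measure R).
Definition leb2 := (leb \x leb)%E.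

Definition ind (a : R) (s : R) : R := if (- a <= s) && (s <= a) then 1 else 0.

Definition alpha : R := (Num.sqrt 2)^-1.
Definition nu_nat : R := pi / 4.

Definition u_nat : R -> R := ind alpha.
Definition outer (u : R -> R) (x : R * R) : R := u x.1 * u x.2.
Definition X_nat : R * R -> R := outer u_nat.

Definition rot (nu : R) (x : R * R) : R * R :=
  (cos nu * x.1 - sin nu * x.2, sin nu * x.1 + cos nu * x.2).

Definition Xrot (nu : R) (x : R * R) : R := X_nat (rot (nu - nu_nat) x).

Definition gauss2 (sigma : R) (x : R * R) : R :=
  (2 * pi * sigma ^+ 2)^-1 * expR (- (x.1 ^+ 2 + x.2 ^+ 2) / (2 * sigma ^+ 2)).

Definition conv2 (f g : R * R -> R) (x : R * R) : R :=
  Rintegral leb2 setT (fun y => f (x.1 - y.1, x.2 - y.2) * g y).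

Definition L2norm2 (f : R * R -> R) : R := fine (Lnorm leb2 2%:E (EFin \o f)).

Definition loss (sigma nu : R) (u : R -> R) : R :=
  2^-1 * (L2norm2 (conv2 (gauss2 sigma) (fun x => Xrot nu x - outer u x))) ^+ 2.

Definition grad_loss (sigma nu : R) (u : R -> R) : R :=
  derive1 (fun v => loss sigma v u) nu.

Definition L2norm (f : R -> R) : R := fine (Lnorm leb 2%:E (EFin \o f)).
Definition inner (f g : R -> R) : R := Rintegral leb setT (fun s => f s * g s).

Definition Top (f : R * R -> R) (g : R -> R) (s : R) : R :=
  Rintegral leb setT (fun t => f (s, t) * g t).
Definition Top_adj (f : R * R -> R) (g : R -> R) (s : R) : R :=
  Rintegral leb setT (fun t => f (t, s) * g t).

Definition Aop (nu : R) (w : R -> R) (s : R) : R :=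
  Top (Xrot nu) w s + Top_adj (Xrot nu) w s.

Definition power_step (nu : R) (w : R -> R) : R -> R :=
  fun s => (L2norm (Aop nu w))^-1 * Aop nu w s.
Definition power_iter (nu : R) (w0 : R -> R) (k : nat) : R -> R :=
  iter k (power_step nu) w0.

Definition Pm (k : nat) (w0 : R -> R) (nu : R) : R -> R :=
  let w := power_iter nu w0 k in
  fun s => Num.sqrt (2^-1 * inner w (Aop nu w)) * w s.

Definition gd (sigma beta : R) (u : R -> R) (nu0 : R) (k : nat) : R :=
  iter k (fun nu => nu - beta * grad_loss sigma nu u) nu0.

Definition rmod (x p : R) : R := x - p * (Num.floor (x / p))%:~R.

Definition angle_err (nu : R) : R :=
  let m := rmod `|nu - nu_nat| (pi / 2) in Num.min m (pi / 2 - m).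

Definition u_rough (Tr : nat) : R -> R := Pm Tr (ind 1) 0.
Definition nu_hat (sigma beta : R) (Tr Tnu : nat) (nu0 : R) : R :=
  gd sigma beta (u_rough Tr) nu0 Tnu.
Definition u_hat (sigma beta : R) (Tr Tnu Tu : nat) (nu0 : R) : R -> R :=
  Pm Tu (u_rough Tr) (nu_hat sigma beta Tr Tnu nu0).

Definition success (sigma beta eps : R) (Tr Tnu Tu : nat) : set R :=
  [set nu0 | 0 <= nu0 <= 2 * pi /\
     angle_err (nu_hat sigma beta Tr Tnu nu0) <= 3 * eps /\
     (Lnorm leb 2%:E (EFin \o (fun s => (u_hat sigma beta Tr Tnu Tu nu0 s - u_nat s)%R))
        <= (31 * Num.sqrt eps)%:E)%E].

End Defs.

(* Main.v *)
(** The rotated square is diagonalized by elementary functions, so every stage is explicit.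

    At [nu = 0] the operator of the power method has the kernel of the diamond
    [|s| + |t| <= 1].  Its leading eigenfunction is [e1 = cos (pi s / 2)] on [[-1, 1]],
    with eigenvalue [4 / pi], and the rest contracts geometrically; hence
    [u_rough = c (e1 + rho)] with [rho] exponentially small in [T_rough].

    The Gaussian is a tensor product commuting with rotations, so up to a constant
    the loss is minus the integral over the square of [k (x1) k (x2)], where
    [(x1, x2)] is the rotated point and [k] is [u_rough] smoothed twice.  By the
    divergence theorem the derivative in the angle is a boundary integral, the flux
    of the rotation field.  On the part of the line that is reached for angles
    [|delta| <= pi / 7], [k] is [cos (pi x / 2)] times a constant, up to a Chernoff
    tail; for a cosine the flux is an explicit trigonometric integral comparable
    to [- sin delta].  Gradient descent therefore contracts the angular error on
    this interval.  The loss is [pi / 2]-periodic, so four such intervals, of total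
    length [4 / 7] of [2 pi], are good initial values.

    Near the true angle the kernel differs from the rank one kernel of the template
    on thin strips only, hence by [O (sqrt eps)] in Hilbert-Schmidt norm, and a single
    power step already brings the iterate within that distance of the template. *)

Require Import Defs.
From HB Require Import structures.
From mathcomp Require Import all_boot all_order all_algebra.
From mathcomp Require Import all_classical all_reals all_analysis.
From mathcomp Require Import measurable_realfun lebesgue_integral_under normal_distribution.
From mathcomp Require Import ring lra.
Set Implicit Arguments. Unset Strict Implicit. Unset Printing Implicit Defensive.
Import Order.TTheory GRing.Theory Num.Theory.
Import numFieldNormedType.Exports.
Local Open Scope classical_set_scope.
Local Open Scope ring_scope.

(** * Invariance of Lebesgue measure under rotations *)

(** The contraction has to persist down to errors of order [eps], so the flux needs a lower bound
    proportional to [sin d]. For fixed [sigma] the cutoff of the cosine at -1 and 1 leaves an error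
    of fixed size, which is harmless only if it carries the factor [sin d] too; hence a Lipschitz
    bound on the smoothed tail, and not only a size bound. The remainder [rho] offers no such
    factor: it shifts the limit of the descent by a multiple of its sup norm, which is why the rough
    stage must grow with [- ln eps]. The boundary integral contains no derivative of the profile, so
    closeness in sup norm suffices there. On the window [|d| <= pi / 7] the arguments of [k] stay
    below [cos (pi / 4 - pi / 7) < 945 / 1000]. The gap to the kink of [e1] at 1 is then almost four
    standard deviations of the double smoothing when [sigma = 1 / 100]. In the refinement a rank one
    operator sends every function to a multiple of the template. Only the perturbation creates
    misalignment, so one step forgets the quality of the start, provided that it is not nearly
    orthogonal to the template. *)

Lemma leb_shift (R : realType) (c : R) (A : set R) : measurable A ->
  leb ((fun x => x + c) @^-1` A) = leb A.
Proof.
move=> mA.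
have mphi : measurable_fun setT ((fun x => x + c) : measurableTypeR R -> measurableTypeR R) by exact: measurable_funD.
pose phi : {mfun measurableTypeR R >-> measurableTypeR R} := HB.pack (fun x : R => x + c) (isMeasurableFun.Build _ _ _ _ _ mphi).
apply/esym.
apply: (@lebesgue_measure_unique R (pushforward (@lebesgue_measure R) phi)) => //.
move=> X [[a b] _ <-] /=.
rewrite /pushforward/=.
rewrite [X in _ = lebesgue_measure X](_ : _ = `](a - c), (b - c)]%classic).
  rewrite !lebesgue_measure_itv/= !lte_fin ltrD2r.
  by case: ifP => // _; rewrite -!EFinB; congr (_%:E); ring.
by apply/seteqP; split=> x; rewrite /= !in_itv/= ltrBlDr lerBrDr.
Qed.
Lemma leb_opp (R : realType) (A : set R) : measurable A ->
  leb ((fun x => - x) @^-1` A) = leb A.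
Proof.
move=> mA.
have mphi : measurable_fun setT ((fun x => - x) : measurableTypeR R -> measurableTypeR R) by exact: oppr_measurable.
pose phi : {mfun measurableTypeR R >-> measurableTypeR R} := HB.pack (fun x : R => - x) (isMeasurableFun.Build _ _ _ _ _ mphi).
apply/esym.
apply: (@lebesgue_measure_unique R (pushforward (@lebesgue_measure R) phi)) => //.
move=> X [[a b] _ <-] /=.
rewrite /pushforward/=.
rewrite [X in _ = lebesgue_measure X](_ : _ = `[(- b), (- a)[%classic).
  rewrite !lebesgue_measure_itv/= !lte_fin ltrN2.
  by case: ifP => // _; rewrite -!EFinB; congr (_%:E); ring.
by apply/seteqP; split=> x; rewrite /= !in_itv/= lerNl ltrNr andbC.
Qed.

Definition shear1 (R : realType) (c : R) (x : R * R) : R * R := (x.1 + c * x.2, x.2).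
Definition shear2 (R : realType) (c : R) (x : R * R) : R * R := (x.1, x.2 + c * x.1).

Lemma mshear1 (R : realType) (c : R) : measurable_fun setT (shear1 c).
Proof.
apply/measurable_fun_pairP; split => /=.
  apply: (@measurable_funD _ _ _ _ fst (fun x => c * x.2)) => //.
  by apply: measurable_funM.
exact: measurable_snd.
Qed.
Lemma mshear2 (R : realType) (c : R) : measurable_fun setT (shear2 c).
Proof.
apply/measurable_fun_pairP; split => /=; first exact: measurable_fst.
apply: (@measurable_funD _ _ _ _ snd (fun x => c * x.1)) => //.
by apply: measurable_funM.
Qed.
Lemma leb2_shear2 (R : realType) (c : R) (A : set (R * R)) : measurable A ->
  leb2 (shear2 c @^-1` A) = leb2 A.
Proof.
move=> mA; rewrite /leb2 /product_measure1/=.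
apply: eq_integral => x _ /=.
rewrite (_ : xsection _ x = (fun y => y + c * x) @^-1` xsection A x).
  rewrite -[RHS](@leb_shift R (c * x))//.
  exact: measurable_xsection.
by apply/seteqP; split=> y; rewrite /xsection/= !inE.
Qed.
(** Here the horizontal sections are translated, so the measure is first rewritten as the product
    built in the other order; uniqueness of the product measure identifies the two. *)
Lemma leb2_shear1 (R : realType) (c : R) (A : set (R * R)) : measurable A ->
  leb2 (shear1 c @^-1` A) = leb2 A.
Proof.
move=> mA; rewrite /leb2.
have E : forall B : set (R * R), measurable B -> (@leb R \x @leb R)%E B = (@leb R \x^ @leb R)%E B.
  move=> B mB.
  by apply: product_measure_unique => // X Y mX mY; exact: (product_measure2E (@leb R) (@leb R)).
have mA' : measurable (shear1 c @^-1` A).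
  by rewrite -[X in measurable X]setTI; exact: mshear1.
rewrite !E// /product_measure2/=.
apply: eq_integral => y _ /=.
rewrite (_ : ysection _ y = (fun x => x + c * y) @^-1` ysection A y).
  rewrite -[RHS](@leb_shift R (c * y))//.
  exact: measurable_ysection.
by apply/seteqP; split=> x; rewrite /ysection/= !inE.
Qed.

(** No integrability is assumed: the positive and negative parts are transported separately through
    the pushforward measure. *)
Lemma integral_measure_preserving d (T : measurableType d) (R : realType)
    (mu : {measure set T -> \bar R}) (h : T -> T) (f : T -> \bar R) :
  measurable_fun setT h -> (forall A, measurable A -> mu (h @^-1` A) = mu A) ->
  measurable_fun setT f -> (\int[mu]_x f (h x) = \int[mu]_x f x)%E.
Proof.
move=> mh muh mf.
have ge0 g : measurable_fun setT g -> (forall x, 0 <= g x)%E ->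
    (\int[mu]_x g (h x) = \int[mu]_x g x)%E.
  move=> mg g0.
  transitivity (\int[pushforward mu h]_x g x)%E.
    by rewrite ge0_integral_pushforward.
  by apply: eq_measure_integral => A mA _; exact: muh.
rewrite [LHS]integralE [RHS]integralE.
rewrite -(ge0 (f^\+)%E)//; last exact: measurable_funepos.
rewrite -(ge0 (f^\-)%E) //; last exact: measurable_funeneg.
by congr (_ - _)%E; apply: eq_integral => x _; [exact: (congr1 (@^~ x) (funepos_comp f h))|exact: (congr1 (@^~ x) (funeneg_comp f h))].
Qed.

Lemma integrable_measure_preserving d (T : measurableType d) (R : realType)
    (mu : {measure set T -> \bar R}) (h : T -> T) (f : T -> \bar R) :
  measurable_fun setT h -> (forall A, measurable A -> mu (h @^-1` A) = mu A) ->
  mu.-integrable setT f -> mu.-integrable setT (f \o h).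
Proof.
move=> mh muh /integrableP[mf foo]; apply/integrableP; split.
  exact: measurableT_comp.
rewrite (@integral_measure_preserving _ _ _ _ _ (fun x => `|f x|%E))//.
exact: measurableT_comp.
Qed.

Lemma Rintegral_shift (R : realType) (c : R) (f : R -> R) :
  measurable_fun setT f ->
  Rintegral (@leb R) setT (fun x => f (x + c)) = Rintegral (@leb R) setT f.
Proof.
move=> mf; congr fine.
apply: (@integral_measure_preserving _ _ _ (@leb R) (fun x => x + c) (EFin \o f)).
- exact: measurable_funD.
- exact: leb_shift.
- exact/measurable_EFinP.
Qed.

Lemma Rintegral_opp (R : realType) (f : R -> R) :
  measurable_fun setT f ->
  Rintegral (@leb R) setT (fun x => f (- x)) = Rintegral (@leb R) setT f.
Proof.
move=> mf; congr fine.
apply: (@integral_measure_preserving _ _ _ (@leb R) (fun x => - x) (EFin \o f)).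
- exact: oppr_measurable.
- exact: leb_opp.
- exact/measurable_EFinP.
Qed.

(* A rotation by an angle other than pi is a product of three shears. *)
Definition rotcd (R : realType) (c d : R) (x : R * R) : R * R :=
  (c * x.1 - d * x.2, d * x.1 + c * x.2).

Lemma rotcd_shear (R : realType) (c d : R) : c ^+ 2 + d ^+ 2 = 1 -> c != -1 ->
  rotcd c d = shear1 (- (d / (1 + c))) \o (shear2 d \o shear1 (- (d / (1 + c)))).
Proof.
move=> cd c1; have c0 : 1 + c != 0 by rewrite addrC addr_eq0.
have d2 : d ^+ 2 = (1 - c) * (1 + c) by rewrite -[LHS](addKr (c ^+ 2)) cd; ring.
apply/funext => -[x y]; rewrite /rotcd /shear1 /shear2/=; congr pair.
  have -> : x + - (d / (1 + c)) * y + - (d / (1 + c)) * (y + d * (x + - (d / (1 + c)) * y))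
     = x - 2 * (d / (1 + c)) * y - (d ^+ 2 / (1 + c)) * x + d * (d ^+ 2 / (1 + c)) / (1 + c) * y by ring.
  by rewrite d2 mulfK//; field.
have -> : y + d * (x + - (d / (1 + c)) * y) = y + d * x - d ^+ 2 / (1 + c) * y by ring.
by rewrite d2 mulfK//; ring.
Qed.

Lemma mrotcd (R : realType) (c d : R) : measurable_fun setT (rotcd c d).
Proof.
apply/measurable_fun_pairP; split => /=.
  apply: (@measurable_funB _ _ _ _ (fun x => c * x.1) (fun x => d * x.2));
    by apply: measurable_funM.
by apply: (@measurable_funD _ _ _ _ (fun x => d * x.1) (fun x => c * x.2));
    apply: measurable_funM.
Qed.

Lemma leb2_rotcd (R : realType) (c d : R) (A : set (R * R)) :
  c ^+ 2 + d ^+ 2 = 1 -> measurable A ->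
  leb2 (rotcd c d @^-1` A) = leb2 A.
Proof.
have main : forall (c d : R) A, c ^+ 2 + d ^+ 2 = 1 -> c != -1 -> measurable A -> leb2 (rotcd c d @^-1` A) = leb2 A.
  move=> {}c {}d {}A cd c1 mA.
  rewrite rotcd_shear// !comp_preimage leb2_shear1 ?leb2_shear2 ?leb2_shear1//.
    by rewrite -[X in measurable X]setTI; exact: mshear1.
  rewrite -[X in measurable X]setTI; apply: mshear2 => //.
  by rewrite -[X in measurable X]setTI; exact: mshear1.
move=> cd mA; have [c1|c1] := eqVneq c (-1); last exact: main.
have d0 : d = 0.
  by apply/eqP; rewrite -sqrf_eq0 -[_ ^+ 2](addKr (c ^+ 2)) cd c1 sqrrN expr1n addNr.
(* The half turn, where the shear coefficient [d / (1 + c)] degenerates, is the square of a quarter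
   turn. *)
have -> : rotcd c d = rotcd 0 1 \o rotcd 0 1.
  by apply/funext => -[x y]; rewrite /rotcd/= c1 d0; congr pair; ring.
have h0 : 0 != -1 :> R by rewrite eq_sym oppr_eq0 oner_eq0.
rewrite comp_preimage !main//; try by ring.
by rewrite -[X in measurable X]setTI; exact: mrotcd.
Qed.

Lemma Rintegral_rotcd (R : realType) (c d : R) (f : R * R -> R) :
  c ^+ 2 + d ^+ 2 = 1 -> measurable_fun setT f ->
  Rintegral (@leb2 R) setT (fun x => f (rotcd c d x)) = Rintegral (@leb2 R) setT f.
Proof.
move=> cd mf; congr fine.
apply: (@integral_measure_preserving _ _ _ (@leb2 R) (rotcd c d) (EFin \o f)).
- exact: mrotcd.
- by move=> A; exact: leb2_rotcd.
- exact/measurable_EFinP.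
Qed.

(** * Bounded integrable functions and symmetric kernels *)

(** Bounded and integrable functions form an algebra inside L2 that all the operators below
    preserve, so products and squares are integrable without further argument. *)
Definition bint d (T : measurableType d) (R : realType) (mu : {measure set T -> \bar R}) (f : T -> R) :=
  mu.-integrable setT (EFin \o f) /\ exists M : R, forall x, `|f x| <= M.

Section Bint.
Context d (T : measurableType d) (R : realType) (mu : {measure set T -> \bar R}).
Implicit Types f g : T -> R.

Lemma bint_int f : bint mu f -> mu.-integrable setT (EFin \o f).
Proof. by case. Qed.

Lemma bint_mf f : bint mu f -> measurable_fun setT f.
Proof. by case=> /integrableP[/measurable_EFinP]. Qed.

Lemma bintD f g : bint mu f -> bint mu g -> bint mu (fun x => f x + g x).
Proof.
move=> [fi [M Mf]] [gi [N Ng]]; split.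
  exact: (integrableD measurableT fi gi).
by exists (M + N) => x; rewrite (le_trans (ler_normD _ _))// lerD.
Qed.

Lemma bintZ (a : R) f : bint mu f -> bint mu (fun x => a * f x).
Proof.
move=> [fi [M Mf]]; split.
  exact: (integrableZl measurableT a fi).
by exists (`|a| * M) => x; rewrite normrM ler_wpM2l.
Qed.

Lemma bintB f g : bint mu f -> bint mu g -> bint mu (fun x => f x - g x).
Proof.
move=> bf bg; have := bintD bf (bintZ (-1) bg).
by under eq_fun do rewrite mulN1r.
Qed.

Lemma bint_le f g : measurable_fun setT f -> bint mu g ->
  (forall x, `|f x| <= g x) -> bint mu f.
Proof.
move=> mf [gi [M Mg]] fg; split.
  apply: (le_integrable measurableT _ _ gi); first exact/measurable_EFinP.
  by move=> x _; rewrite lee_fin (le_trans (fg x))// ler_norm.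
by exists M => x; rewrite (le_trans (fg x))// (le_trans (ler_norm _)).
Qed.

Lemma bint_norm f : bint mu f -> bint mu (fun x => `|f x|).
Proof.
move=> [fi [M Mf]]; split; first exact: (integrable_norm fi).
by exists M => x; rewrite normr_id.
Qed.

Lemma bintM f g : bint mu f -> measurable_fun setT g -> (exists M : R, forall x, `|g x| <= M) ->
  bint mu (fun x => f x * g x).
Proof.
move=> bf mg [M Mg].
apply: (@bint_le _ (fun x => M * `|f x|)).
- by apply: measurable_funM => //; exact: bint_mf.
- exact/bintZ/bint_norm.
- by move=> x; rewrite normrM mulrC ler_wpM2r.
Qed.

Lemma bintMM f g : bint mu f -> bint mu g -> bint mu (fun x => f x * g x).
Proof. by move=> bf bg; apply: bintM => //; [exact: bint_mf|case: bg]. Qed.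

End Bint.

Definition kop d (T : measurableType d) (R : realType) (mu : {measure set T -> \bar R})
    (K : T * T -> R) (f : T -> R) (x : T) : R :=
  Rintegral mu setT (fun y => K (x, y) * f y).

Section Kernel.
Context d (T : measurableType d) (R : realType) (mu : {sigma_finite_measure set T -> \bar R}).
Variables (K : T * T -> R) (B : R).
Hypothesis mK : measurable_fun setT K.
Hypothesis K0 : forall x, 0 <= K x.
Hypothesis KB : forall x, K x <= B.
Hypothesis K1 : forall y, (\int[mu]_x (K (x, y))%:E = 1)%E.

(** By Tonelli, integrating the kernel first in its normalized variable bounds the double integral
    by the sup of [h] times the L1 norm of [f]. *)
Lemma kernel_joint (f h : T -> R) : bint mu f -> measurable_fun setT h -> (exists M : R, forall x, `|h x| <= M) ->
  (mu \x mu)%E.-integrable setT (fun z => (K z * f z.2 * h z.1)%:E).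
Proof.
move=> bf mh [M Mh].
have mF : measurable_fun setT (fun z => (K z * f z.2 * h z.1)%:E).
  apply/measurable_EFinP; apply: measurable_funM.
    by apply: measurable_funM => //; apply: measurableT_comp => //; exact: bint_mf bf.
  exact: measurableT_comp.
apply/(integrable21ltyP mu mu mF).
have M0 : 0 <= M by apply: le_trans (Mh point).
apply: (@le_lt_trans _ _ (\int[mu]_y (M * `|f y|)%:E)%E); last first.
  have [fi _] := bintZ M (bint_norm bf).
  case/integrableP : fi => _; apply: le_lt_trans.
  rewrite [leLHS](_ : _ = (\int[mu]_x `|(M * `|f x|)%:E|)%E)//.
  by apply: eq_integral => x _; rewrite gee0_abs// lee_fin mulr_ge0.
apply: ge0_le_integral => //.
- by move=> y _; apply: integral_ge0.
- apply: (@measurable_fun_fubini_tonelli_G _ _ _ _ _ mu (fun z => `|(K z * f z.2 * h z.1)%:E|%E)) => //.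
  exact: measurableT_comp.
- apply/measurable_EFinP; apply: measurable_funM => //.
  by apply: measurableT_comp => //; exact: bint_mf bf.
move=> y _ /=.
apply: (@le_trans _ _ (\int[mu]_x ((M * `|f y|)%:E * (K (x, y))%:E))%E).
  apply: ge0_le_integral => //.
  - apply/measurable_EFinP; apply: measurableT_comp => //; apply: measurable_funM => //.
    by apply: measurable_funM => //; exact: (measurableT_comp mK).
  - apply/measurable_EFinP; apply: measurable_funM => //.
    exact: (measurableT_comp mK).
  - move=> x _; rewrite -EFinM lee_fin !normrM (ger0_norm (K0 _)).
    by rewrite [leRHS]mulrC -mulrA ler_wpM2l// mulrC ler_wpM2r.
rewrite ge0_integralZl//.
- by rewrite K1 mule1.
- by apply/measurable_EFinP; exact: (measurableT_comp mK).
- by move=> x _; rewrite lee_fin.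
- by rewrite lee_fin mulr_ge0.
Qed.

Hypothesis Ksym : forall x y, K (x, y) = K (y, x).

Local Notation kop := (kop mu K).

Lemma mKx x : measurable_fun setT (fun y => K (x, y)).
Proof. exact: (measurableT_comp mK). Qed.

Lemma kernel_int (f : T -> R) x : bint mu f -> mu.-integrable setT (EFin \o (fun y => K (x, y) * f y)).
Proof.
move=> bf; apply: bint_int.
under eq_fun do rewrite mulrC.
apply: bintM => //; first exact: mKx.
by exists B => y; rewrite ger0_norm.
Qed.

Lemma kopE (f : T -> R) x : bint mu f -> (kop f x)%:E = (\int[mu]_y (K (x, y) * f y)%:E)%E.
Proof.
move=> bf; rewrite /kop /Rintegral fineK//.
by apply: integrable_fin_num => //; exact: kernel_int.
Qed.

Lemma kop_int (f : T -> R) : bint mu f -> mu.-integrable setT (EFin \o kop f).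
Proof.
move=> bf.
have := @kernel_joint f (fun=> 1) bf (measurable_cst _).
have h1 : exists M : R, forall x : T, `|(fun=> 1) x : R| <= M by exists 1 => x; rewrite normr1.
move=> /(_ h1) /integrable_fubini_F.
apply: eq_integrable => // x _; rewrite /fubini_F /= kopE//.
by apply: eq_integral => y _; rewrite mulr1.
Qed.

Lemma kop_le (f : T -> R) (M : R) : bint mu f -> (forall x, `|f x| <= M) -> forall x, `|kop f x| <= M.
Proof.
move=> bf Mf x.
have iK : mu.-integrable setT (EFin \o (fun y => K (x, y))).
  apply/integrableP; split; first by apply/measurable_EFinP; exact: mKx.
  rewrite (eq_integral (fun y => (K (y, x))%:E)) ?K1 ?ltry// => y _ /=.
  by rewrite ger0_norm// Ksym.
apply: (le_trans (le_normr_Rintegral measurableT (kernel_int x bf))).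
apply: (@le_trans _ _ (Rintegral mu setT (fun y => M * K (x, y)))).
  apply: le_Rintegral => //.
  - exact: (integrable_norm (kernel_int x bf)).
  - exact: (integrableZl measurableT M iK).
  - by move=> y _; rewrite normrM ger0_norm// mulrC ler_wpM2r.
rewrite RintegralZl// /Rintegral (eq_integral (fun y => (K (y, x))%:E)) => [|y _]; last by rewrite Ksym.
by rewrite K1 mulr1.
Qed.

Lemma kop_bint (f : T -> R) : bint mu f -> bint mu (kop f).
Proof.
move=> bf; split; first exact: kop_int.
by case: (bf) => _ [M Mf]; exists M; exact: kop_le.
Qed.

Lemma kopB (f g : T -> R) x : bint mu f -> bint mu g ->
  kop (fun y => f y - g y) x = kop f x - kop g x.
Proof.
move=> bf bg; rewrite /kop -RintegralB//; [|exact: kernel_int..].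
by congr Rintegral; apply/funext => y; rewrite mulrBr.
Qed.

Lemma kop_adj (f h : T -> R) : bint mu f -> bint mu h ->
  Rintegral mu setT (fun x => kop f x * h x) = Rintegral mu setT (fun y => f y * kop h y).
Proof.
move=> bf bh; congr fine.
have jint := kernel_joint bf (bint_mf bh) bh.2.
have E := Fubini jint.
transitivity (\int[mu]_x \int[mu]_y (K (x, y) * f y * h x)%:E)%E.
  apply: eq_integral => x _ /=; rewrite EFinM muleC (kopE _ bf).
  rewrite -(integralZl measurableT (kernel_int x bf)).
  by apply: eq_integral => y _; rewrite -EFinM mulrC.
rewrite E; apply: eq_integral => y _ /=.
rewrite EFinM (kopE _ bh) -(integralZl measurableT (kernel_int y bh)).
by apply: eq_integral => x _; rewrite -EFinM Ksym; congr (_%:E); ring.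
Qed.

End Kernel.

(** * Tensor products of functions on the line *)

Section Tensor.
Variable R : realType.
Implicit Types f g : R -> R.

Definition tens f g (x : R * R) : R := f x.1 * g x.2.

Lemma tens_m f g : measurable_fun setT f -> measurable_fun setT g -> measurable_fun setT (tens f g).
Proof. by move=> mf mg; apply: measurable_funM; exact: measurableT_comp. Qed.

Lemma tens_bint f g : bint (@leb R) f -> bint (@leb R) g -> bint (@leb2 R) (tens f g).
Proof.
move=> bf bg; have mt := tens_m (bint_mf bf) (bint_mf bg).
split; last first.
  case: bf bg => [_ [M Mf]] [_ [N Ng]]; exists (M * N) => x.
  by rewrite normrM ler_pM.
apply/(@integrable12ltyP _ _ _ _ _ (@leb R) (@leb R)); first exact/measurable_EFinP.
have [/integrableP[mf fi] [M Mf]] := bf; have [/integrableP[mg gi] _] := bg.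
rewrite (eq_integral (fun x : measurableTypeR R => `|f x|%:E * \int[@leb R]_y `|g y|%:E)%E); last first.
  move=> x _; rewrite -ge0_integralZl//; last first.
    by apply/measurable_EFinP; apply: measurableT_comp => //; exact: bint_mf bg.
  by apply: eq_integral => y _ /=; rewrite normrM.
rewrite ge0_integralZr//.
- by apply: lte_mul_pinfty => //; [exact: integral_ge0|rewrite ge0_fin_numE//; exact: integral_ge0].
- by apply/measurable_EFinP; apply: measurableT_comp => //; exact: bint_mf bf.
- exact: integral_ge0.
Qed.

Lemma tens_Rintegral f g : bint (@leb R) f -> bint (@leb R) g ->
  Rintegral (@leb2 R) setT (tens f g) = Rintegral (@leb R) setT f * Rintegral (@leb R) setT g.
Proof.
move=> bf bg; rewrite {1}/Rintegral.
have bt := tens_bint bf bg.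
have -> : (\int[@leb2 R]_x (tens f g x)%:E = \int[@leb R]_x \int[@leb R]_y (tens f g (x, y))%:E)%E.
  by symmetry; apply: (@integral12_prod_meas1 _ _ _ _ _ (@leb R) (@leb R) (EFin \o tens f g) (bint_int bt)).
rewrite (eq_integral (fun x : measurableTypeR R => (f x)%:E * (Rintegral (@leb R) setT g)%:E)%E); last first.
  move=> x _; rewrite /Rintegral fineK; last exact: (integrable_fin_num measurableT (bint_int bg)).
  by rewrite -integralZl//; exact: bint_int bg.
rewrite integralZr//; last exact: bint_int bf.
by rewrite fineM//; exact: (integrable_fin_num measurableT (bint_int bf)).
Qed.

End Tensor.

(** * The smoothed loss *)

Lemma leb2_sigma_finite (R : realType) : sigma_finite setT (@leb2 R).
Proof.
have [F [TF ndF Foo]] := (sigma_finiteP _ _).1 (sigma_finiteT (@leb R)).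
exists (fun n => F n `*` F n).
  rewrite -setXTT TF predeqE => -[x y]; split.
    move=> [/= [n _ Fnx] [k _ Fky]]; exists (maxn n k) => //; split.
    - by move: x Fnx; exact/subsetPset/ndF/leq_maxl.
    - by move: y Fky; exact/subsetPset/ndF/leq_maxr.
  by move=> [n _ []/= ? ?]; split; exists n.
move=> k; have [? ?] := Foo k.
split; first exact: measurableX.
by rewrite /leb2 product_measure1E// lte_mul_pinfty// ge0_fin_numE.
Qed.
(** The planar measure is repackaged together with its sigma-finiteness, so that the lemmas on
    symmetric kernels also apply with the plane as base space. *)
Definition mleb2 (R : realType) : set (measurableTypeR R * measurableTypeR R)%type -> \bar R := @leb2 R.
HB.instance Definition _ (R : realType) := Measure.copy (@mleb2 R) (@leb R \x @leb R)%E.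
HB.instance Definition _ (R : realType) := Measure_isSigmaFinite.Build _ _ _ (@mleb2 R) (@leb2_sigma_finite R).
Definition sfleb2 (R : realType) : {sigma_finite_measure set _ -> \bar R} := @mleb2 R.

(** * Gaussian kernels on the line and in the plane *)

Section Gauss.
Variables (R : realType) (s : R).
Hypothesis s0 : 0 < s.
Let phi := normal_pdf 0 s.

Lemma gauss2E x : gauss2 s x = phi x.1 * phi x.2.
Proof.
rewrite /phi !normal_pdfE ?gt_eqF// /gauss2 /normal_fun !subr0.
rewrite [RHS]mulrACA -expRD; congr (_ * expR _).
  rewrite /normal_peak -invfM -sqrtrM; last by rewrite mulrn_wge0// mulr_ge0// ?sqr_ge0// pi_ge0.
  congr (_^-1); rewrite -expr2 sqrtr_sqr ger0_norm ?mulrn_wge0// ?mulr_ge0// ?sqr_ge0// ?pi_ge0//.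
  by rewrite -mulr_natr; ring.
  exact: ltW.
  exact: ltW.
by rewrite -(mulr_natr (_ ^+ 2)); field; rewrite gt_eqF.
Qed.

Lemma phi_ge0 x : 0 <= phi x. Proof. exact: normal_pdf_ge0. Qed.

Lemma phi_even x : phi (- x) = phi x.
Proof. by rewrite /phi !normal_pdfE ?gt_eqF// /normal_fun !subr0 sqrrN. Qed.

Lemma phi_le x : phi x <= normal_peak s.
Proof. by apply: normal_pdf_ub; rewrite gt_eqF. Qed.

Lemma mphi : measurable_fun setT phi.
Proof. exact: measurable_normal_pdf. Qed.

Lemma phi_bint : bint (@leb R) phi.
Proof.
split; first exact: integrable_normal_pdf.
by exists (normal_peak s) => x; rewrite ger0_norm ?phi_ge0// phi_le.
Qed.

Lemma phi_int : (\int[@leb R]_x (phi x)%:E = 1)%E.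
Proof. exact: integral_normal_pdf. Qed.

Definition K1 (z : R * R) : R := phi (z.1 - z.2).
Definition K2 (z : (R * R) * (R * R)) : R := gauss2 s (z.1.1 - z.2.1, z.1.2 - z.2.2).

Lemma K2E z : K2 z = K1 (z.1.1, z.2.1) * K1 (z.1.2, z.2.2).
Proof. by rewrite /K2 gauss2E. Qed.

Lemma mK1 : measurable_fun setT K1.
Proof.
apply: (measurableT_comp mphi).
by apply: (@measurable_funB _ _ _ _ fst snd).
Qed.

Lemma K1_ge0 z : 0 <= K1 z. Proof. exact: phi_ge0. Qed.
Lemma K1_le z : K1 z <= normal_peak s. Proof. exact: phi_le. Qed.
Lemma K1_sym x y : K1 (x, y) = K1 (y, x).
Proof. by rewrite /K1/= -opprB phi_even. Qed.

Lemma K1_int y : (\int[@leb R]_x (K1 (x, y))%:E = 1)%E.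
Proof.
rewrite -[RHS]phi_int /K1/=.
apply: (@integral_measure_preserving _ _ _ (@leb R) (fun x => x - y) (EFin \o phi)).
- exact: measurable_funB.
- exact: leb_shift.
- by apply/measurable_EFinP; exact: mphi.
Qed.

Lemma mK2 : measurable_fun setT K2.
Proof.
have -> : K2 = (fun z => K1 (z.1.1, z.2.1) * K1 (z.1.2, z.2.2)) by apply/funext => z; exact: K2E.
apply: measurable_funM; apply: (measurableT_comp mK1); apply/measurable_fun_pairP; split => /=.
- by apply: (@measurableT_comp _ _ _ _ _ _ fst _ fst) => //; exact: measurable_fst.
- by apply: (@measurableT_comp _ _ _ _ _ _ fst _ snd) => //; exact: measurable_fst.
- by apply: (@measurableT_comp _ _ _ _ _ _ snd _ fst) => //; exact: measurable_snd.
- by apply: (@measurableT_comp _ _ _ _ _ _ snd _ snd) => //; exact: measurable_snd.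
Qed.

Lemma K2_ge0 z : 0 <= K2 z. Proof. by rewrite K2E mulr_ge0// K1_ge0. Qed.
Lemma K2_le z : K2 z <= normal_peak s * normal_peak s.
Proof. by rewrite K2E ler_pM// ?K1_ge0// K1_le. Qed.
Lemma K2_sym x y : K2 (x, y) = K2 (y, x).
Proof. by rewrite !K2E/=; congr (_ * _); exact: K1_sym. Qed.

Lemma K1_bint y : bint (@leb R) (fun x => K1 (x, y)).
Proof.
split; last by exists (normal_peak s) => x; rewrite ger0_norm ?K1_ge0 ?K1_le.
apply/integrableP; split.
  by apply/measurable_EFinP; exact: (measurableT_comp mK1).
rewrite (eq_integral (fun x : measurableTypeR R => (K1 (x, y))%:E)) ?K1_int ?ltry//.
by move=> x _ /=; rewrite ger0_norm ?K1_ge0.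
Qed.

Lemma K2_int y : (\int[@leb2 R]_x (K2 (x, y))%:E = 1)%E.
Proof.
have -> : (fun x => (K2 (x, y))%:E) = EFin \o tens (fun x => K1 (x, y.1)) (fun x => K1 (x, y.2)).
  by apply/funext => x; rewrite K2E.
have b := tens_bint (K1_bint y.1) (K1_bint y.2).
rewrite -[LHS]fineK; last exact: (integrable_fin_num measurableT (bint_int b)).
have := tens_Rintegral (K1_bint y.1) (K1_bint y.2).
by rewrite /Rintegral !K1_int mulr1 => ->.
Qed.

Definition sm1 (f : R -> R) : R -> R := kop (@leb R) K1 f.
Definition sm2 (f : R * R -> R) : R * R -> R := kop (@leb2 R) K2 f.

Lemma conv2E f : conv2 (gauss2 s) f = sm2 f.
Proof. by []. Qed.

Lemma sm1_bint f : bint (@leb R) f -> bint (@leb R) (sm1 f).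
Proof. by apply: (@kop_bint _ (measurableTypeR R) R (@leb R) K1 _ mK1 K1_ge0 K1_le K1_int K1_sym). Qed.

Lemma sm2_bint f : bint (@leb2 R) f -> bint (@leb2 R) (sm2 f).
Proof.
move=> bf.
have H := @kop_bint _ _ R (sfleb2 R) K2 _ mK2 K2_ge0 K2_le K2_int K2_sym f.
exact: H. Qed.

Lemma sm2_tens f g x : bint (@leb R) f -> bint (@leb R) g ->
  sm2 (tens f g) x = tens (sm1 f) (sm1 g) x.
Proof.
move=> bf bg; rewrite /sm2 /kop.
have b1 f' (t : R) : bint (@leb R) f' -> bint (@leb R) (fun y => K1 (t, y) * f' y).
  move=> bf'; split; first exact: (@kernel_int _ (measurableTypeR R) R (@leb R) K1 _ mK1 K1_ge0 K1_le).
  case: bf' => _ [M Mf]; exists (normal_peak s * M) => y.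
  by rewrite normrM ler_pM// ger0_norm ?K1_ge0 ?K1_le.
rewrite (_ : (fun y => _) = tens (fun y => K1 (x.1, y) * f y) (fun y => K1 (x.2, y) * g y)).
  by rewrite tens_Rintegral//; exact: b1.
by apply/funext => y; rewrite K2E /tens/=; ring.
Qed.

End Gauss.

Lemma Lnorm2E d (T : measurableType d) (R : realType) (mu : {measure set T -> \bar R}) (f : T -> R) :
  bint mu f -> Lnorm mu 2%:E (EFin \o f) = (Num.sqrt (Rintegral mu setT (fun x => f x ^+ 2)))%:E.
Proof.
move=> bf; rewrite unlock /Lnorm/=.
rewrite (eq_integral (fun x => (f x ^+ 2)%:E)); last first.
  by move=> x _; rewrite /= -[2]/(2%:R) powR_mulrn// real_normK ?num_real.
have bf2 : bint mu (fun x => f x ^+ 2).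
  by under eq_fun do rewrite expr2; exact: bintMM.
rewrite poweR12_sqrt; last by apply: integral_ge0 => x _; rewrite lee_fin sqr_ge0.
rewrite -[X in sqrte X]fineK//.
exact: (integrable_fin_num measurableT (bint_int bf2)).
Qed.

(** * Isolating the angle-dependent part of the loss *)

Section Loss.
Variable R : realType.
Implicit Types (u : R -> R).

Lemma indE (a : R) : ind a = \1_(`[- a, a]%classic) :> (R -> R).
Proof.
apply/funext => x; rewrite /ind indicE; case: ifPn => h.
  by rewrite mem_set//= in_itv.
by rewrite memNset//= in_itv/=; apply/negP.
Qed.

Lemma ind_bint (a : R) : bint (@leb R) (ind a).
Proof.
rewrite indE; split.
  apply/integrableP; split; first by apply/measurable_EFinP; exact: measurable_indic.
  rewrite (eq_integral (fun x : measurableTypeR R => (\1_(`[- a, a]%classic) x)%:E)); last first.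
    by move=> x _; rewrite /= ger0_norm// indicE.
  rewrite integral_indic// setIT /leb/= lebesgue_measure_itv/=.
  by case: ifP => _; rewrite ?ltry// -EFinD ltry.
by exists 1 => x; rewrite indicE; case: (_ \in _); rewrite ?normr1 ?normr0.
Qed.

Lemma X_nat_bint : bint (@leb2 R) (@X_nat R).
Proof. by have := tens_bint (ind_bint (@alpha R)) (ind_bint (@alpha R)). Qed.

Lemma bint_rot (c d : R) (f : R * R -> R) : c ^+ 2 + d ^+ 2 = 1 -> bint (@leb2 R) f ->
  bint (@leb2 R) (fun x => f (rotcd c d x)).
Proof.
move=> cd [fi [M Mf]]; split; last by exists M.
apply: (@integrable_measure_preserving _ _ _ (@leb2 R) (rotcd c d) (EFin \o f)) => //.
- exact: mrotcd.
- by move=> A; exact: leb2_rotcd.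
Qed.

Lemma Xrot_bint (nu : R) : bint (@leb2 R) (Xrot nu).
Proof. by apply: (bint_rot (cos2Dsin2 _) X_nat_bint). Qed.

Lemma K2_rot (s c d : R) x y : 0 < s -> c ^+ 2 + d ^+ 2 = 1 ->
  K2 s (rotcd c d x, rotcd c d y) = K2 s (x, y).
Proof.
move=> s0 cd; rewrite /K2 /gauss2 /rotcd/=.
have -> : (c * x.1 - d * x.2 - (c * y.1 - d * y.2)) ^+ 2 + (d * x.1 + c * x.2 - (d * y.1 + c * y.2)) ^+ 2
   = (c ^+ 2 + d ^+ 2) * ((x.1 - y.1) ^+ 2 + (x.2 - y.2) ^+ 2) by ring.
by rewrite cd mul1r.
Qed.

Lemma sm2_rot (s c d : R) (f : R * R -> R) x : 0 < s -> c ^+ 2 + d ^+ 2 = 1 -> bint (@leb2 R) f ->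
  sm2 s (fun y => f (rotcd c d y)) x = sm2 s f (rotcd c d x).
Proof.
move=> s0 cd bf; rewrite /sm2 /kop.
rewrite -[RHS](@Rintegral_rotcd R c d (fun y => K2 s (rotcd c d x, y) * f y) cd).
  by congr Rintegral; apply/funext => y; rewrite K2_rot.
apply: measurable_funM; last exact: bint_mf bf.
exact: (measurableT_comp (mK2 s0)).
Qed.

Definition kk s u := sm1 s (sm1 s u).

Definition Gnu (s : R) u (nu : R) : R :=
  Rintegral (@leb2 R) setT (fun x => Xrot nu x * tens (kk s u) (kk s u) x).

Definition Closs (s : R) u : R :=
  2^-1 * (Rintegral (@leb2 R) setT (fun x => sm2 s (@X_nat R) x ^+ 2)
        + Rintegral (@leb2 R) setT (fun x => tens (sm1 s u) (sm1 s u) x ^+ 2)).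

Lemma lossE (s nu : R) u : 0 < s -> bint (@leb R) u ->
  loss s nu u = Closs s u - Gnu s u nu.
Proof.
move=> s0 bu; rewrite /loss conv2E//.
have bU := tens_bint bu bu.
have bv := sm1_bint s0 bu.
have bV := tens_bint bv bv.
have bX := Xrot_bint nu.
have bP := sm2_bint s0 bX.
have cd := cos2Dsin2 (nu - nu_nat R).
have E1 : sm2 s (fun x => Xrot nu x - outer u x) = fun x => sm2 s (Xrot nu) x - tens (sm1 s u) (sm1 s u) x.
  apply/funext => x; rewrite -sm2_tens// /sm2.
  exact: (@kopB _ _ R (sfleb2 R) _ _ (mK2 s0) (K2_ge0 s0) (K2_le s0)).
rewrite E1 /L2norm2 Lnorm2E; last exact: bintB.
rewrite [fine _]/= sqr_sqrtr; last by apply: Rintegral_ge0 => x _; exact: sqr_ge0.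
set P := sm2 s (Xrot nu) in bP *; set V := tens _ _ in bV *.
have E2 : Rintegral (@leb2 R) setT (fun x => (P x - V x) ^+ 2) =
   Rintegral (@leb2 R) setT (fun x => P x ^+ 2) - 2 * Rintegral (@leb2 R) setT (fun x => P x * V x)
   + Rintegral (@leb2 R) setT (fun x => V x ^+ 2).
  have b1 : bint (@leb2 R) (fun x => P x ^+ 2) by under eq_fun do rewrite expr2; exact: bintMM.
  have b2 : bint (@leb2 R) (fun x => V x ^+ 2) by under eq_fun do rewrite expr2; exact: bintMM.
  have b3 : bint (@leb2 R) (fun x => P x * V x) by exact: bintMM.
  rewrite -RintegralZl//; last exact: bint_int b3.
  rewrite -RintegralB//; [|exact: bint_int b1|exact: bint_int (bintZ 2 b3)].
  rewrite -RintegralD//; [|exact: bint_int (bintB b1 (bintZ 2 b3))|exact: bint_int b2].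
  by congr Rintegral; apply/funext => x; ring.
rewrite E2.
have -> : Rintegral (@leb2 R) setT (fun x => P x ^+ 2) =
    Rintegral (@leb2 R) setT (fun x => sm2 s (@X_nat R) x ^+ 2).
  have bPn := sm2_bint s0 X_nat_bint.
  have m2 : measurable_fun setT (fun x => sm2 s (@X_nat R) x ^+ 2) := measurable_funX 2 (bint_mf bPn).
  rewrite -(Rintegral_rotcd cd m2).
  congr Rintegral; apply/funext => x; rewrite /P; congr (_ ^+ 2).
  exact: (sm2_rot x s0 cd X_nat_bint).
(* Self-adjointness moves the smoothing of the rotated square onto the other factor. The square
   keeps its sharp edges, which the divergence theorem needs, and [u] ends up smoothed twice. *)
have -> : Rintegral (@leb2 R) setT (fun x => P x * V x) = Gnu s u nu.
  rewrite /Gnu.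
  have := @kop_adj _ _ R (sfleb2 R) _ _ (mK2 s0) (K2_ge0 s0) (K2_le s0) (K2_int s0) (K2_sym s0) _ _ bX bV.
  move=> H; transitivity (Rintegral (@leb2 R) setT (fun y => Xrot nu y * sm2 s V y)); first exact: H.
  by congr Rintegral; apply/funext => x; rewrite /V sm2_tens.
rewrite /Closs; move: (Gnu _ _ _) (Rintegral _ _ _) (Rintegral _ _ _) => A B C; lra.
Qed.

(** Rotating the integration variable fixes the square and puts the angle into the arguments of [k].
    For a smooth profile the integral can then be differentiated under the sign. *)
Lemma Rintegral_Xrot (nu c d : R) (k : R -> R) : bint (@leb R) k ->
  c = cos (nu - nu_nat R) -> d = sin (nu - nu_nat R) ->
  Rintegral (@leb2 R) setT (fun x => Xrot nu x * tens k k x) = Rintegral (@leb2 R) setT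
    (fun x => tens (@u_nat R) (@u_nat R) x * (k (c * x.1 + d * x.2) * k (c * x.2 - d * x.1))).
Proof.
move=> bk cE dE.
have cd : c ^+ 2 + d ^+ 2 = 1 by rewrite cE dE; exact: cos2Dsin2.
have cd' : c ^+ 2 + (- d) ^+ 2 = 1 by rewrite sqrrN.
have Xr x : Xrot nu x = tens (@u_nat R) (@u_nat R) (rotcd c d x) by rewrite cE dE.
have : measurable_fun setT (tens (@u_nat R) (@u_nat R)) by exact: (bint_mf X_nat_bint).
move: (tens (@u_nat R) (@u_nat R)) Xr => X Xr mX.
pose f (x : R * R) := X x * (k (c * x.1 + d * x.2) * k (c * x.2 - d * x.1)).
have mf : measurable_fun setT f.
  apply: measurable_funM => //.
  have := bint_mf (bint_rot cd' (tens_bint bk bk)).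
  apply: eq_measurable_fun => x _.
  by rewrite /tens /rotcd/= mulNr opprK mulNr addrC (addrC (- _)) .
rewrite -[RHS]/(Rintegral (@leb2 R) setT f) -(Rintegral_rotcd cd mf).
congr Rintegral; apply/funext => x; rewrite Xr /f; case: x => x y; rewrite /tens /rotcd.
rewrite [fst _]/= [snd _]/= [fst _]/= [snd _]/=.
have -> : c * (c * x - d * y) + d * (d * x + c * y) = (c ^+ 2 + d ^+ 2) * x by ring.
have -> : c * (d * x + c * y) - d * (c * x - d * y) = (c ^+ 2 + d ^+ 2) * y by ring.
by rewrite cd !mul1r.
Qed.

End Loss.

(** * The derivative of the loss *)

Lemma dom_integrable d (T : measurableType d) (R : realType) (mu : {measure set T -> \bar R}) (f g : T -> R) :
  measurable_fun setT f -> mu.-integrable setT (EFin \o g) -> (forall x, `|f x| <= `|g x|) ->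
  mu.-integrable setT (EFin \o f).
Proof.
move=> mf gi fg; apply: (le_integrable measurableT _ _ gi); first exact/measurable_EFinP.
by move=> x _; rewrite lee_fin.
Qed.

Section Conv.
Variable R : realType.
Implicit Types (f g psi v k : R -> R) (x y : R).

Lemma is_derive_continuous f f' : (forall x, is_derive x 1 f (f' x)) -> continuous f.
Proof.
by move=> df x; apply/differentiable_continuous/derivable1_diffP; case: (df x).
Qed.

Lemma is_derive_comp_affine psi psi' (a b x : R) : (forall x, is_derive x 1 psi (psi' x)) ->
  is_derive x 1 (fun x => psi (a * x + b)) (psi' (a * x + b) * a).
Proof.
move=> dpsi.
apply: (@is_derive1_comp _ psi (fun x => a * x + b)).
have -> : (fun x => a * x + b) = (a *: id + cst b : R -> R) by apply/funext.
rewrite -[X in is_derive _ _ _ X](_ : a *: 1 + 0 = a); last by rewrite addr0 /GRing.scale/= mulr1.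
exact: is_deriveD.
Qed.

Lemma conv_is_derive psi psi' v (C C0 : R) :
  measurable_fun setT psi ->
  (forall x, is_derive x 1 psi (psi' x)) ->
  (forall x, `|psi x| <= C0) -> (forall x, `|psi' x| <= C) ->
  (@leb R).-integrable setT (EFin \o v) ->
  forall x, is_derive x 1 (fun x => Rintegral (@leb R) setT (fun y => psi (x - y) * v y))
     (Rintegral (@leb R) setT (fun y => psi' (x - y) * v y)).
Proof.
move=> mpsi dpsi Cpsi Cpsi' iv x0.
have mv : measurable_fun setT v by case/integrableP : iv => /measurable_EFinP.
have der (x y : R) : is_derive x 1 (fun x => psi (x - y) * v y) (psi' (x - y) * v y).
  have := @is_derive_comp_affine psi psi' 1 (- y) x dpsi.
  rewrite mul1r mulr1 => h.
  have -> : (fun x => psi (x - y) * v y) = v y *: (fun x => psi (1 * x + - y)).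
    by apply/funext => z; rewrite -[RHS]/(v y * psi (1 * z - y)) mul1r mulrC.
  have -> : psi' (x - y) * v y = v y *: psi' (x - y) by rewrite mulrC.
  exact: is_deriveZ.
pose f (x y : R) := psi (x - y) * v y.
have intf x : (@leb R).-integrable setT (EFin \o f x).
  apply: (@dom_integrable _ _ _ (@leb R) _ (fun y => C0 * v y)).
  - apply: measurable_funM => //.
    by apply: (measurableT_comp mpsi); exact: measurable_funB.
  - exact: (integrableZl measurableT C0 iv).
  - move=> y; rewrite /f !normrM ler_wpM2r//.
    by rewrite (le_trans (Cpsi _))// ler_norm.
have x01 : x0 \in `]x0 - 1, x0 + 1[ by rewrite in_itv/= ltrBlDr !ltrDl ltr01.
have d1 x y : partial1of2 f x y = psi' (x - y) * v y.
  by rewrite /partial1of2 derive1E; exact: derive_val.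
have H1 : forall x y, `]x0 - 1, x0 + 1[%classic x -> setT y -> derivable (f ^~ y) x 1.
  by move=> x y _ _; case: (der x y).
pose G y := C * `|v y|.
have C_ge0 : 0 <= C by apply: le_trans (Cpsi' 0).
have G0 y : 0 <= G y by rewrite mulr_ge0.
have iG : (@leb R).-integrable setT (EFin \o G).
  exact: (integrableZl measurableT C (integrable_norm iv)).
have Gub : forall x y, `]x0 - 1, x0 + 1[%classic x -> setT y -> `|partial1of2 f x y| <= G y.
  by move=> x y _ _; rewrite d1 normrM ler_wpM2r.
have D := @derivable_under_integral R _ _ (@leb R) f setT measurableT x0 (x0 - 1) (x0 + 1) x01
   (fun x _ => intf x) H1 G G0 iG Gub.
have E := @differentiation_under_integral R _ _ (@leb R) f setT measurableT x0 (x0 - 1) (x0 + 1) x01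
   (fun x _ => intf x) H1 G G0 iG Gub.
apply: DeriveDef; first exact: D.
rewrite -derive1E E.
by congr Rintegral; apply/funext => y; exact: d1.
Qed.

Lemma FTC_ind (a : R) f f' : 0 < a -> (forall x, is_derive x 1 f (f' x)) -> continuous f' ->
  (\int[@leb R]_x (ind a x * f' x)%:E = (f a - f (- a))%:E)%E.
Proof.
move=> a0 df cf'.
transitivity (\int[@leb R]_(x in `[(- a)%R, a]) (f' x)%:E)%E.
  rewrite [RHS]integral_mkcond; apply: eq_integral => x _.
  by rewrite indE patchE indicE; case: (_ \in _); rewrite ?mul1r ?mul0r.
rewrite (@continuous_FTC2 R f' f)//.
- by rewrite (lt_trans _ a0)// oppr_lt0.
- by apply: continuous_subspaceT => x; exact: cf'.
- split.
  + by move=> x _; case: (df x).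
  + by apply: cvg_at_right_filter; exact: (is_derive_continuous df).
  + by apply: cvg_at_left_filter; exact: (is_derive_continuous df).
- by move=> x _; rewrite derive1E; exact: derive_val.
Qed.

End Conv.

(** * Smoothness of Gaussian convolutions *)

Section GaussDer.
Variables (R : realType) (s : R).
Hypothesis s0 : 0 < s.
Implicit Types x y : R.
Let phi := normal_pdf 0 s.
Let phi1 x := - (x / s ^+ 2) * phi x.
Let phi2 x := (x ^+ 2 / s ^+ 4 - (s ^+ 2)^-1) * phi x.

Lemma phi_is_derive x : is_derive x 1 phi (phi1 x).
Proof.
rewrite /phi1 /phi normal_pdfE ?gt_eqF// /normal_fun.
pose q (y : R) := - (y - 0) ^+ 2 / (s ^+ 2 *+ 2).
have dq : is_derive x 1 q (- (x / s ^+ 2)).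
  have -> : q = (- (s ^+ 2 *+ 2)^-1) *: (id * id).
    apply/funext => y; rewrite -[RHS]/(- (s ^+ 2 *+ 2)^-1 * (y * y)) /q subr0.
    by rewrite !mulNr mulrC expr2.
  have -> : - (x / s ^+ 2) = (- (s ^+ 2 *+ 2)^-1) *: (x *: 1 + x *: 1).
    by rewrite /GRing.scale/= -mulr_natr; field; rewrite gt_eqF.
  by apply: is_deriveZ; exact: is_deriveM.
have -> : (fun x => normal_peak s * expR (- (x - 0) ^+ 2 / (s ^+ 2 *+ 2))) = normal_peak s *: (expR \o q) by [].
have -> : - (x / s ^+ 2) * (normal_peak s * expR (q x)) = normal_peak s *: (expR (q x) * - (x / s ^+ 2)).
  by rewrite /GRing.scale/=; ring.
by apply: is_deriveZ.
Qed.

Lemma phi1_is_derive x : is_derive x 1 phi1 (phi2 x).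
Proof.
have dphi := phi_is_derive x.
have -> : phi1 = (- (s ^+ 2)^-1) *: (id * phi).
  by apply/funext => y; rewrite -[RHS]/(- (s ^+ 2)^-1 * (y * phi y)) /phi1; ring.
apply: is_derive_eq.
by rewrite /phi2 /phi1 /GRing.scale/= !mulr1; field; rewrite gt_eqF.
Qed.

(** With [y = x^2 / (2 s^2)] this is the inequality [y exp (- y) <= 1]. *)
Lemma x2phi_le x : x ^+ 2 * phi x <= 2 * s ^+ 2 * normal_peak s.
Proof.
rewrite /phi normal_pdfE ?gt_eqF// /normal_fun subr0 mulNr.
set y := x ^+ 2 / _.
have s2 : 0 < s ^+ 2 by rewrite exprn_gt0.
have y0 : 0 <= y by rewrite /y divr_ge0 ?sqr_ge0// mulrn_wge0// ltW.
have -> : x ^+ 2 = 2 * s ^+ 2 * y by rewrite /y -mulr_natr; field; rewrite gt_eqF.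
have -> : 2 * s ^+ 2 * y * (normal_peak s * expR (- y)) = 2 * s ^+ 2 * normal_peak s * (y * expR (- y)) by ring.
rewrite ler_piMr//; first by rewrite !mulr_ge0// ?normal_peak_ge0// ltW.
rewrite expRN ler_pdivrMr ?expR_gt0// mul1r.
by rewrite (le_trans _ (expR_ge1Dx _))// lerDr.
Qed.

Lemma phi1_bounded : exists C : R, forall x, `|phi1 x| <= C.
Proof.
exists ((s ^+ 2)^-1 * (normal_peak s + 2 * s ^+ 2 * normal_peak s)) => x.
have s2 : 0 <= (s ^+ 2)^-1 by rewrite invr_ge0 sqr_ge0.
have -> : phi1 x = (s ^+ 2)^-1 * (- x * phi x) by rewrite /phi1; ring.
rewrite normrM (ger0_norm s2); apply: ler_wpM2l => //.
rewrite normrM normrN (ger0_norm (phi_ge0 s x)).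
have pp : 0 <= 2 * s ^+ 2 * normal_peak s by rewrite mulr_ge0 ?normal_peak_ge0// mulr_ge0 ?sqr_ge0.
have [x1|x1] := lerP `|x| 1.
  rewrite (@le_trans _ _ (1 * normal_peak s))//; last by rewrite mul1r lerDl.
  by rewrite ler_pM ?phi_ge0 ?phi_le.
rewrite (@le_trans _ _ (2 * s ^+ 2 * normal_peak s))//; last by rewrite lerDr normal_peak_ge0.
rewrite (le_trans _ (x2phi_le x))// ler_wpM2r ?phi_ge0//.
by rewrite -real_normK ?num_real// expr2 ler_peMl// ltW.
Qed.

Lemma phi2_bounded : exists C : R, forall x, `|phi2 x| <= C.
Proof.
exists ((s ^+ 4)^-1 * (2 * s ^+ 2 * normal_peak s) + (s ^+ 2)^-1 * normal_peak s) => x.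
have s2 : 0 <= (s ^+ 2)^-1 by rewrite invr_ge0 sqr_ge0.
have s4 : 0 <= (s ^+ 4)^-1 by rewrite invr_ge0 exprn_ge0// ltW.
have -> : phi2 x = (s ^+ 4)^-1 * (x ^+ 2 * phi x) - (s ^+ 2)^-1 * phi x by rewrite /phi2; ring.
rewrite (le_trans (ler_normB _ _))// lerD//.
  rewrite normrM (ger0_norm s4) ler_wpM2l// ger0_norm; first exact: x2phi_le.
  by rewrite mulr_ge0 ?sqr_ge0 ?phi_ge0.
by rewrite normrM (ger0_norm s2) ler_wpM2l// ger0_norm ?phi_ge0 ?phi_le.
Qed.

(** The first derivative of the Gaussian gives [k'] and its bound; the second one makes [k']
    differentiable, hence continuous, as the fundamental theorem of calculus requires. *)
Lemma sm1_C1 (v : R -> R) : bint (@leb R) v ->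
  exists k' : R -> R, [/\ forall x, is_derive x 1 (sm1 s v) (k' x), continuous k' &
    exists C : R, forall x, `|k' x| <= C].
Proof.
move=> [iv _].
have [C1 hC1] := phi1_bounded; have [C2 hC2] := phi2_bounded.
have cphi1 := is_derive_continuous phi1_is_derive.
have mphi1 : measurable_fun setT phi1 by exact: continuous_measurable_fun.
have dk := conv_is_derive (mphi s) phi_is_derive (C0 := normal_peak s) _ hC1 iv.
have dk' := conv_is_derive mphi1 phi1_is_derive hC1 hC2 iv.
exists (fun x => Rintegral (@leb R) setT (fun y => phi1 (x - y) * v y)); split.
- by move=> x; apply: dk => y; rewrite ger0_norm ?phi_ge0 ?phi_le.
- exact: (is_derive_continuous dk').
exists (C1 * Rintegral (@leb R) setT (fun y => `|v y|)) => x.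
have mv : measurable_fun setT v by case/integrableP : iv => /measurable_EFinP.
have iN := integrable_norm iv.
have ip : (@leb R).-integrable setT (EFin \o (fun y => phi1 (x - y) * v y)).
  apply: (@dom_integrable _ _ _ (@leb R) _ (fun y => C1 * v y)).
  - apply: measurable_funM => //.
    by apply: (measurableT_comp mphi1); exact: measurable_funB.
  - exact: (integrableZl measurableT C1 iv).
  - move=> y; rewrite (normrM _ (v y)) (normrM C1) ler_wpM2r//.
    by rewrite (le_trans (hC1 _))// ler_norm.
rewrite (le_trans (le_normr_Rintegral _ ip))// -RintegralZl//.
apply: le_Rintegral => //.
- exact: (integrable_norm ip).
- exact: (integrableZl measurableT C1 iN).
- by move=> y _; rewrite normrM ler_wpM2r.
Qed.

End GaussDer.

(** * Divergence theorem on the square *)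

Definition Mrot (R : realType) (k : R -> R) (dl x y : R) : R :=
  k (cos dl * x + sin dl * y) * k (cos dl * y - sin dl * x).

(* The boundary integral obtained by the divergence theorem: the rotation field
   [(y, - x)] is divergence free, and its flux through the side [x = a] is [y]. *)
Definition flux (R : realType) (k : R -> R) (a dl : R) : R :=
  Rintegral (@leb R) setT (fun t => ind a t *
    (t * (Mrot k dl a t - Mrot k dl (- a) t - (Mrot k dl t a - Mrot k dl t (- a))))).

Section Flux.
Variables (R : realType) (k k' : R -> R) (a C C' : R).
Implicit Types x y t dl : R.
Hypothesis a0 : 0 < a.
Hypothesis dk : forall x, is_derive x 1 k (k' x).
Hypothesis ck' : continuous k'.
Hypothesis kC : forall x, `|k x| <= C.
Hypothesis kC' : forall x, `|k' x| <= C'.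

Let ck : continuous k := is_derive_continuous dk.
Let mk : measurable_fun setT k. Proof. exact: continuous_measurable_fun. Qed.
Let mk' : measurable_fun setT k'. Proof. exact: continuous_measurable_fun. Qed.
Let C_ge0 : 0 <= C. Proof. exact: le_trans (kC 0). Qed.
Let C'_ge0 : 0 <= C'. Proof. exact: le_trans (kC' 0). Qed.

Let A dl (x : R * R) : R := cos dl * x.1 + sin dl * x.2.
Let B dl (x : R * R) : R := cos dl * x.2 - sin dl * x.1.
Let W (x : R * R) : R := tens (ind a) (ind a) x.
Let M1 dl (x : R * R) := cos dl * (k' (A dl x) * k (B dl x)) - sin dl * (k (A dl x) * k' (B dl x)).
Let M2 dl (x : R * R) := sin dl * (k' (A dl x) * k (B dl x)) + cos dl * (k (A dl x) * k' (B dl x)).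

Let mA dl : measurable_fun setT (A dl).
Proof.
rewrite /A; apply: (@measurable_funD _ _ _ _ (fun x : R * R => cos dl * x.1) (fun x : R * R => sin dl * x.2));
  by apply: measurable_funM.
Qed.
Let mB dl : measurable_fun setT (B dl).
Proof.
rewrite /B; apply: (@measurable_funB _ _ _ _ (fun x : R * R => cos dl * x.2) (fun x : R * R => sin dl * x.1));
  by apply: measurable_funM.
Qed.

Lemma ind_ge0 x : 0 <= ind a x. Proof. by rewrite /ind; case: ifP. Qed.
Lemma ind_le1 x : ind a x <= 1. Proof. by rewrite /ind; case: ifP. Qed.
Lemma ind_norm x : ind a x * `|x| <= ind a x * a.
Proof.
rewrite /ind; case: ifP => h; last by rewrite !mul0r.
by rewrite !mul1r ler_norml.
Qed.

Let W0 (x : R * R) : 0 <= W x. Proof. by rewrite mulr_ge0// ind_ge0. Qed.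
Let bW : bint (@leb2 R) W. Proof. exact: (tens_bint (ind_bint a) (ind_bint a)). Qed.

Let W_le (f : R * R -> R) (D : R) (x : R * R) : (`|x.1| <= a -> `|x.2| <= a -> `|f x| <= D) ->
  `|W x * f x| <= `|D * W x|.
Proof.
move=> fD; rewrite /W /tens /ind; do 2 case: ifP => /=.
- move=> h1 h2; rewrite !mulr1 mul1r (le_trans (fD _ _)) ?ler_norml//.
  exact: ler_norm.
- by rewrite !(mul0r, mulr0) normr0.
- by rewrite !(mul0r, mulr0) normr0.
- by rewrite !(mul0r, mulr0) normr0.
Qed.

Let W_int (f : R * R -> R) (D : R) : measurable_fun setT f ->
  (forall x : R * R, `|x.1| <= a -> `|x.2| <= a -> `|f x| <= D) ->
  (@leb2 R).-integrable setT (EFin \o (fun x : R * R => W x * f x)).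
Proof.
move=> mf fD.
have m1 : measurable_fun setT (fun x : R * R => W x * f x).
  by apply: measurable_funM => //; exact: (bint_mf bW).
apply: (@dom_integrable _ _ _ (@leb2 R) _ (fun x : R * R => D * W x)).
- exact: m1.
- exact: (bint_int (bintZ D bW)).
- by move=> x; apply: W_le; exact: fD.
Qed.

Let mM1 dl : measurable_fun setT (M1 dl).
Proof.
apply: measurable_funB; apply: measurable_funM => //; apply: measurable_funM;
  by [exact: (measurableT_comp mk)|exact: (measurableT_comp mk')].
Qed.
Let mM2 dl : measurable_fun setT (M2 dl).
Proof.
apply: measurable_funD; apply: measurable_funM => //; apply: measurable_funM;
  by [exact: (measurableT_comp mk)|exact: (measurableT_comp mk')].
Qed.

Let cos_le dl : `|cos dl| <= 1. Proof. by rewrite ler_norml cos_geN1 cos_le1. Qed.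
Let sin_le dl : `|sin dl| <= 1. Proof. by rewrite ler_norml sin_geN1 sin_le1. Qed.

Let M1_le dl (x : R * R) : `|M1 dl x| <= 2 * (C * C').
Proof.
rewrite (le_trans (ler_normB _ _))// mulr_natl mulr2n lerD// normrM -[leRHS]mul1r ler_pM// normrM.
  by rewrite [leRHS]mulrC ler_pM.
by rewrite ler_pM.
Qed.
Let M2_le dl (x : R * R) : `|M2 dl x| <= 2 * (C * C').
Proof.
rewrite (le_trans (ler_normD _ _))// mulr_natl mulr2n lerD// normrM -[leRHS]mul1r ler_pM// normrM.
  by rewrite [leRHS]mulrC ler_pM.
by rewrite ler_pM.
Qed.

Let dM1 dl x y : is_derive x 1 (fun x => Mrot k dl x y) (M1 dl (x, y)).
Proof.
have d1 := @is_derive_comp_affine _ k k' (cos dl) (sin dl * y) x dk.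
have d2 := @is_derive_comp_affine _ k k' (- sin dl) (cos dl * y) x dk.
have := is_deriveM d1 d2.
congr is_derive.
  by apply/funext => z; rewrite /Mrot mulrfctE; congr (k _ * k _); ring.
rewrite /M1 /A /B /GRing.scale/=.
have -> : - sin dl * x + cos dl * y = cos dl * y - sin dl * x by ring.
by ring.
Qed.

Let dM2 dl x y : is_derive y 1 (fun y => Mrot k dl x y) (M2 dl (x, y)).
Proof.
have d1 := @is_derive_comp_affine _ k k' (sin dl) (cos dl * x) y dk.
have d2 := @is_derive_comp_affine _ k k' (cos dl) (- (sin dl * x)) y dk.
have := is_deriveM d1 d2.
congr is_derive.
  by apply/funext => z; rewrite /Mrot mulrfctE; congr (k _ * k _); ring.
rewrite /M2 /A /B /GRing.scale/=.
have -> : sin dl * y + cos dl * x = cos dl * x + sin dl * y by ring.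
by ring.
Qed.

(** The rotated coordinates satisfy [A' = B] and [B' = - A] in the angle. Turning the angle
    therefore amounts to moving the point along the field [(y, - x)]: an angular derivative becomes
    a spatial one. *)
Let rot_der dl x y : is_derive dl 1 (fun dl => Mrot k dl x y)
  (y * M1 dl (x, y) - x * M2 dl (x, y)).
Proof.
have dA : is_derive dl 1 (A ^~ (x, y)) (B dl (x, y)).
  have := is_deriveD (is_deriveZ x (is_derive_cos dl)) (is_deriveZ y (is_derive_sin dl)).
  congr is_derive; last by rewrite /B /GRing.scale/=; ring.
  by apply/funext => z; rewrite -[LHS]/(x * cos z + y * sin z) /A/=; ring.
have dB : is_derive dl 1 (B ^~ (x, y)) (- A dl (x, y)).
  have := is_deriveB (is_deriveZ y (is_derive_cos dl)) (is_deriveZ x (is_derive_sin dl)).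
  congr is_derive; last by rewrite /A /GRing.scale/=; ring.
  by apply/funext => z; rewrite -[LHS]/(y * cos z - x * sin z) /B/=; ring.
have := is_deriveM (@is_derive1_comp _ k (A ^~ (x, y)) dl _ _ (dk (A dl (x, y))) dA)
                   (@is_derive1_comp _ k (B ^~ (x, y)) dl _ _ (dk (B dl (x, y))) dB).
congr is_derive.
rewrite /M1 /M2 /GRing.scale/=.
move: (k (A dl (x, y))) (k (B dl (x, y))) (k' (A dl (x, y))) (k' (B dl (x, y))) => p q p' q'.
rewrite /A /B/=; ring.
Qed.

Let mMrot dl : measurable_fun setT (fun x : R * R => Mrot k dl x.1 x.2).
Proof.
by apply: measurable_funM; [exact: (measurableT_comp mk (mA dl))|exact: (measurableT_comp mk (mB dl))].
Qed.

Lemma Mrot_le dl x y : `|Mrot k dl x y| <= C * C.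
Proof. by rewrite normrM ler_pM. Qed.

Let c_aff (p q : R) : continuous (fun x : R => p * x + q).
Proof.
move=> x; apply: cvgD; last exact: cvg_cst.
by apply: cvgM; [exact: cvg_cst|exact: cvg_id].
Qed.

Let ck_aff (p q : R) : continuous (fun x : R => k (p * x + q)).
Proof. by move=> x; apply: (@continuous_comp _ _ _ (fun x : R => p * x + q) k); [exact: c_aff|exact: ck]. Qed.

Let ck'_aff (p q : R) : continuous (fun x : R => k' (p * x + q)).
Proof. by move=> x; apply: (@continuous_comp _ _ _ (fun x : R => p * x + q) k'); [exact: c_aff|exact: ck']. Qed.

Let cM1 dl y : continuous (fun x : R => M1 dl (x, y)).
Proof.
have -> : (fun x : R => M1 dl (x, y)) =
  (fun x => cos dl * (k' (cos dl * x + sin dl * y) * k (- sin dl * x + cos dl * y)) -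
            sin dl * (k (cos dl * x + sin dl * y) * k' (- sin dl * x + cos dl * y))).
  by apply/funext => x; rewrite /M1 /A /B/= mulNr [- _ + _]addrC.
move=> x; apply: cvgB; (apply: cvgM; first exact: cvg_cst); apply: cvgM;
  by [exact: ck_aff|exact: ck'_aff].
Qed.

Let cM2 dl x : continuous (fun y : R => M2 dl (x, y)).
Proof.
have -> : (fun y : R => M2 dl (x, y)) =
  (fun y => sin dl * (k' (sin dl * y + cos dl * x) * k (cos dl * y + - (sin dl * x))) +
            cos dl * (k (sin dl * y + cos dl * x) * k' (cos dl * y + - (sin dl * x)))).
  by apply/funext => y; rewrite /M2 /A /B/= [cos dl * x + _]addrC.
move=> y; apply: cvgD; (apply: cvgM; first exact: cvg_cst); apply: cvgM;
  by [exact: ck_aff|exact: ck'_aff].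
Qed.

Let CC_ge0 : 0 <= 2 * (C * C'). Proof. by rewrite !mulr_ge0. Qed.

Let i1 dl : (@leb2 R).-integrable setT (EFin \o (fun x : R * R => W x * (x.2 * M1 dl x))).
Proof.
apply: (W_int (D := a * (2 * (C * C')))).
  by apply: measurable_funM => //; exact: mM1.
by move=> x _ h; rewrite normrM ler_pM.
Qed.

Let i2 dl : (@leb2 R).-integrable setT (EFin \o (fun x : R * R => W x * (x.1 * M2 dl x))).
Proof.
apply: (W_int (D := a * (2 * (C * C')))).
  by apply: measurable_funM => //; exact: mM2.
by move=> x h _; rewrite normrM ler_pM.
Qed.

(** The inner integral is taken in the first coordinate, along which [M1] is an exact derivative and
    the weight [x.2] is constant; [I2] uses the other order of integration. *)
Let I1 dl : Rintegral (@leb2 R) setT (fun x : R * R => W x * (x.2 * M1 dl x)) =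
  Rintegral (@leb R) setT (fun t => ind a t * (t * (Mrot k dl a t - Mrot k dl (- a) t))).
Proof.
congr fine.
have := @integral21_prod_meas1 _ _ _ _ _ (@leb R) (@leb R) _ (i1 dl).
move=> H; transitivity (\int[@leb R]_y fubini_G (@leb R) (EFin \o (fun x : R * R => (W x * (x.2 * M1 dl x))%R)) y)%E.
  by symmetry; exact: H.
apply: eq_integral => y _; rewrite /fubini_G.
have dF x : is_derive x 1 ((ind a y * y) *: (fun x => Mrot k dl x y)) ((ind a y * y) * M1 dl (x, y)).
  exact: is_deriveZ.
have cF : continuous (fun x => (ind a y * y) * M1 dl (x, y)).
  by move=> x; apply: cvgM; [exact: cvg_cst|exact: cM1].
have := FTC_ind a0 dF cF.
rewrite -[((ind a y * y) *: _) a]/(ind a y * y * Mrot k dl a y).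
rewrite -[((ind a y * y) *: _) (- a)]/(ind a y * y * Mrot k dl (- a) y).
rewrite -mulrBr mulrA => <-; apply: eq_integral => x _.
by rewrite /W /tens/=; congr (_%:E); ring.
Qed.

Let I2 dl : Rintegral (@leb2 R) setT (fun x : R * R => W x * (x.1 * M2 dl x)) =
  Rintegral (@leb R) setT (fun t => ind a t * (t * (Mrot k dl t a - Mrot k dl t (- a)))).
Proof.
congr fine.
have := @integral12_prod_meas1 _ _ _ _ _ (@leb R) (@leb R) _ (i2 dl).
move=> H; transitivity (\int[@leb R]_x fubini_F (@leb R) (EFin \o (fun x : R * R => (W x * (x.1 * M2 dl x))%R)) x)%E.
  by symmetry; exact: H.
apply: eq_integral => x _; rewrite /fubini_F.
have dF y : is_derive y 1 ((ind a x * x) *: (fun y => Mrot k dl x y)) ((ind a x * x) * M2 dl (x, y)).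
  exact: is_deriveZ.
have cF : continuous (fun y => (ind a x * x) * M2 dl (x, y)).
  by move=> y; apply: cvgM; [exact: cvg_cst|exact: cM2].
have := FTC_ind a0 dF cF.
rewrite -[((ind a x * x) *: _) a]/(ind a x * x * Mrot k dl x a).
rewrite -[((ind a x * x) *: _) (- a)]/(ind a x * x * Mrot k dl x (- a)).
rewrite -mulrBr mulrA => <-; apply: eq_integral => y _.
by rewrite /W /tens/=; congr (_%:E); ring.
Qed.

Let ind_int (f : R -> R) (D : R) : measurable_fun setT f ->
  (forall x, `|f x| <= D) ->
  (@leb R).-integrable setT (EFin \o (fun t => ind a t * (t * f t))).
Proof.
move=> mf fD.
have D0 : 0 <= D := le_trans (normr_ge0 _) (fD 0).
have m1 : measurable_fun setT (fun t => ind a t * (t * f t)).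
  by apply: measurable_funM => //; [exact: (bint_mf (ind_bint a))|apply: measurable_funM].
apply: (@dom_integrable _ _ _ (@leb R) _ (fun t => a * D * ind a t)).
- exact: m1.
- exact: (bint_int (bintZ (a * D) (ind_bint a))).
move=> t; rewrite !normrM (ger0_norm (ind_ge0 t)) (ger0_norm (ltW a0)) (ger0_norm D0).
rewrite mulrA [leRHS]mulrC [_ * (a * D)]mulrA ler_pM//; last exact: ind_norm.
by rewrite mulr_ge0// ind_ge0.
Qed.

Let mM_y dl x : measurable_fun setT (fun t : R => Mrot k dl x t).
Proof. by apply: (measurableT_comp (mMrot dl) (pair1_measurable x)). Qed.
Let mM_x dl y : measurable_fun setT (fun t : R => Mrot k dl t y).
Proof. by apply: (measurableT_comp (mMrot dl) (pair2_measurable y)). Qed.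

Lemma flux_is_derive dl :
  is_derive dl 1 (fun dl => Rintegral (@leb2 R) setT (fun x : R * R => tens (ind a) (ind a) x * Mrot k dl x.1 x.2))
    (flux k a dl).
Proof.
pose f dl (x : R * R) := W x * Mrot k dl x.1 x.2.
have intf dl' : (@leb2 R).-integrable setT (EFin \o f dl').
  by apply: (W_int (D := C * C)); [exact: mMrot|move=> x _ _; exact: Mrot_le].
have der dl' (x : R * R) : is_derive dl' 1 (f ^~ x) (W x * (x.2 * M1 dl' x - x.1 * M2 dl' x)).
  have := is_deriveZ (W x) (rot_der dl' x.1 x.2).
  by rewrite -surjective_pairing.
have d1 dl' (x : R * R) : partial1of2 f dl' x = W x * (x.2 * M1 dl' x - x.1 * M2 dl' x).
  by rewrite /partial1of2 derive1E; have := der dl' x => ?; exact: derive_val.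
pose G (x : R * R) := `|2 * (a * (2 * (C * C'))) * W x|.
have iG : (@leb2 R).-integrable setT (EFin \o G).
  exact: (integrable_norm (bint_int (bintZ (2 * (a * (2 * (C * C')))) bW))).
have x01 : dl \in `]dl - 1, dl + 1[ by rewrite in_itv/= ltrBlDr !ltrDl ltr01.
have H1 : forall x (y : R * R), `]dl - 1, dl + 1[%classic x -> setT y -> derivable (f ^~ y) x 1.
  by move=> x y _ _; case: (der x y).
have Gub : forall x (y : R * R), `]dl - 1, dl + 1[%classic x -> setT y -> `|partial1of2 f x y| <= G y.
  move=> x y _ _; rewrite d1; apply: (@W_le (fun y : R * R => y.2 * M1 x y - y.1 * M2 x y)) => h1 h2.
  rewrite (le_trans (ler_normB _ _))// !normrM mulr_natl mulr2n lerD// ler_pM//.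
have D := @derivable_under_integral R _ _ (@leb2 R) f setT measurableT dl (dl - 1) (dl + 1) x01
   (fun x _ => intf x) H1 G (fun x : R * R => normr_ge0 _) iG Gub.
have E := @differentiation_under_integral R _ _ (@leb2 R) f setT measurableT dl (dl - 1) (dl + 1) x01
   (fun x _ => intf x) H1 G (fun x : R * R => normr_ge0 _) iG Gub.
apply: DeriveDef; first exact: D.
rewrite -derive1E; transitivity (Rintegral (@leb2 R) setT (partial1of2 f dl)); first exact: E.
transitivity (Rintegral (@leb2 R) setT (fun x : R * R => W x * (x.2 * M1 dl x) - W x * (x.1 * M2 dl x))).
  by congr Rintegral; apply/funext => x; rewrite d1 mulrBr.
rewrite (RintegralB measurableT (i1 dl) (i2 dl)) I1 I2.
rewrite /flux -RintegralB//.
- by congr Rintegral; apply/funext => t; ring.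
- apply: (ind_int (D := C * C + C * C)); first by apply: measurable_funB; exact: mM_y.
  by move=> t; rewrite (le_trans (ler_normB _ _))// lerD// Mrot_le.
- apply: (ind_int (D := C * C + C * C)); first by apply: measurable_funB; exact: mM_x.
  by move=> t; rewrite (le_trans (ler_normB _ _))// lerD// Mrot_le.
Qed.

Lemma flux_integrable dl : (@leb R).-integrable setT (EFin \o (fun t => ind a t *
    (t * (Mrot k dl a t - Mrot k dl (- a) t - (Mrot k dl t a - Mrot k dl t (- a)))))).
Proof.
apply: (ind_int (D := C * C + C * C + (C * C + C * C))).
  by apply: measurable_funB; apply: measurable_funB; first [exact: mM_y|exact: mM_x].
move=> t; rewrite (le_trans (ler_normB _ _))// lerD// (le_trans (ler_normB _ _))// lerD//;
  exact: Mrot_le.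
Qed.

Lemma flux_continuous : continuous (flux k a).
Proof.
have cM (x y : R) : continuous (fun dl => Mrot k dl x y).
  by apply: is_derive_continuous => dl; exact: rot_der.
move=> dl.
have x01 : dl \in (`]dl - 1, dl + 1[%classic : set R).
  by rewrite inE/= in_itv/= ltrBlDr !ltrDl ltr01.
apply: (@continuity_under_integral R _ _ (@leb R) (fun dl t => ind a t *
    (t * (Mrot k dl a t - Mrot k dl (- a) t - (Mrot k dl t a - Mrot k dl t (- a)))))
  setT measurableT (dl - 1) (dl + 1) (fun dl _ => flux_integrable dl) _
  (fun t => a * (C * C + C * C + (C * C + C * C)) * ind a t)) => //.
- apply: aeW => t _ dl' _.
  apply: cvgM; first exact: cvg_cst.
  apply: cvgM; first exact: cvg_cst.
  by apply: cvgB; apply: cvgB; exact: cM.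
- exact: (bint_int (bintZ _ (ind_bint a))).
- move=> x _; apply: aeW => t _.
  rewrite !normrM (ger0_norm (ind_ge0 t)).
  rewrite mulrA [leRHS]mulrC [_ * (a * _)]mulrA ler_pM//.
  + by rewrite mulr_ge0// ind_ge0.
  + exact: ind_norm.
  rewrite (le_trans (ler_normB _ _))// lerD// (le_trans (ler_normB _ _))// lerD//;
    exact: Mrot_le.
Qed.

End Flux.

Definition sqint (R : realType) (k : R -> R) (a dl : R) : R :=
  Rintegral (@leb2 R) setT (fun x : R * R => tens (ind a) (ind a) x * Mrot k dl x.1 x.2).

Section Grad.
Variables (R : realType) (s : R) (u : R -> R).
Hypothesis s0 : 0 < s.
Hypothesis bu : bint (@leb R) u.

Lemma alpha_gt0 : 0 < @alpha R. Proof. by rewrite invr_gt0 sqrtr_gt0. Qed.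

Lemma loss_sqint (nu : R) : loss s nu u = Closs s u - sqint (kk s u) (@alpha R) (nu - nu_nat R).
Proof.
rewrite (lossE nu s0 bu).
have bk : bint (@leb R) (kk s u) := sm1_bint s0 (sm1_bint s0 bu).
suff -> : Gnu s u nu = sqint (kk s u) (@alpha R) (nu - nu_nat R) by [].
exact: (Rintegral_Xrot bk (erefl _) (erefl _)).
Qed.

Lemma grad_lossE (nu : R) : grad_loss s nu u = - flux (kk s u) (@alpha R) (nu - nu_nat R).
Proof.
have bk : bint (@leb R) (kk s u) := sm1_bint s0 (sm1_bint s0 bu).
have [k' [dk ck' [C' kC']]] : exists k' : R -> R, [/\ forall x : R, is_derive x 1 (kk s u) (k' x), continuous k' &
    exists C : R, forall x, `|k' x| <= C] := sm1_C1 s0 (sm1_bint s0 bu).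
have [_ [C kC]] := bk.
rewrite /grad_loss derive1E.
have -> : (fun v => loss s v u) = (fun v => Closs s u - sqint (kk s u) (@alpha R) (1 * v + - nu_nat R)).
  by apply/funext => v; rewrite mul1r; exact: loss_sqint.
move: (kk s u) dk kC {bk} => k dk kC; move: (Closs s u) => c.
have dF (v : R) : is_derive v 1 (sqint k (@alpha R)) (flux k (@alpha R) v).
  exact: (flux_is_derive alpha_gt0 dk ck' kC kC' v).
have dG := is_derive_comp_affine 1 (- nu_nat R) nu dF.
have dH := is_deriveB (is_derive_cst c nu 1) dG.
rewrite -[LHS]/('D_1 (cst c - (fun x => sqint k (@alpha R) (1 * x - nu_nat R))) nu).
by rewrite derive_val mul1r mulr1 sub0r.
Qed.

(** Makes the iterates of gradient descent continuous in the initial angle, from which measurability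
    of the success event follows. *)
Lemma grad_loss_continuous : continuous (fun nu : R => grad_loss s nu u).
Proof.
have bk := sm1_bint s0 (sm1_bint s0 bu).
have [k' [dk ck' [C' kC']]] := sm1_C1 s0 (sm1_bint s0 bu).
have [_ [C kC]] := bk.
have cf := flux_continuous alpha_gt0 dk kC.
have -> : (fun nu : R => grad_loss s nu u) = (fun nu => - flux (kk s u) (@alpha R) (nu - nu_nat R)).
  by apply/funext => nu; exact: grad_lossE.
move=> nu; apply: cvgN.
apply: (@continuous_comp _ _ _ (fun nu => nu - nu_nat R) (flux (kk s u) (@alpha R))); last exact: cf.
by apply: cvgB; [exact: cvg_id|exact: cvg_cst].
Qed.

End Grad.

(** * Taylor bounds *)

Section Taylor.
Variable R : realType.
Implicit Types x y : R.

(** Generates the Taylor bounds below: each difference vanishes at 0, and its derivative is the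
    difference treated just before. *)
Lemma ge0_of_derive (f f' : R -> R) : (forall x, is_derive x 1 f (f' x)) ->
  (forall x, 0 <= x -> 0 <= f' x) -> 0 <= f 0 -> forall x, 0 <= x -> 0 <= f x.
Proof.
move=> df f'0 f0 x; rewrite le_eqVlt => /predU1P[<-//|x0].
have cf : {within `[0, x], continuous f}.
  apply: derivable_within_continuous => z _.
  by case: (df z).
have [c cx] := MVT x0 (fun z _ => df z) cf.
rewrite subr0 => E; rewrite -(subrK (f 0) (f x)) addr_ge0// E mulr_ge0 ?f'0 ?(ltW x0)//.
by move: cx; rewrite in_itv/= => /andP[/ltW].
Qed.

Lemma is_derive_mono (c : R) n y :
  is_derive y 1 (c *: id ^+ n.+1 : R -> R) (c * (n.+1%:R * y ^+ n)).
Proof.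
apply: is_deriveZ.
have := @is_deriveX _ _ id n.+1 y 1 1 (is_derive_id _ _).
by rewrite /GRing.scale/= mulr1.
Qed.

Lemma sin_le_id x : 0 <= x -> sin x <= x.
Proof.
move=> x0; rewrite -subr_ge0 -[X in 0 <= X]/((id - sin) x).
have df y : is_derive y 1 (id - sin) (1 - cos y) by apply: is_deriveB.
apply: (ge0_of_derive df) x0 => [y _|]; first by rewrite subr_ge0 cos_le1.
by rewrite -[X in 0 <= X]/(0 - sin 0) sin0 subr0.
Qed.

Lemma cos_ge2p x : 0 <= x -> 1 - x ^+ 2 / 2 <= cos x.
Proof.
move=> x0; rewrite -subr_ge0.
have df y : is_derive y 1 (cos - cst 1 + 2^-1 *: (id ^+ 2)) (- sin y + y).
  have := is_deriveD (is_deriveB (is_derive_cos y) (is_derive_cst (1 : R) y 1)) (is_derive_mono 2^-1 1 y).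
  by congr is_derive; rewrite ?expr1; lra.
have E y : (cos - cst 1 + 2^-1 *: (id ^+ 2)) y = cos y - (1 - y ^+ 2 / 2).
  by rewrite -[LHS]/(cos y - 1 + 2^-1 * (id ^+ 2) y) ?exprfctE; field.
rewrite -E; apply: (ge0_of_derive df) x0 => [y y0|].
  by have := sin_le_id y0; lra.
by rewrite E ?sin0 ?cos0 ?expr0n/= ?mul0r ?(subr0, addr0, subrr).
Qed.

Lemma sin_ge3 x : 0 <= x -> x - x ^+ 3 / 6 <= sin x.
Proof.
move=> x0; rewrite -subr_ge0.
have df y : is_derive y 1 (sin - id + 6^-1 *: (id ^+ 3)) (cos y - 1 + y ^+ 2 / 2).
  have := is_deriveD (is_deriveB (is_derive_sin y) (is_derive_id y 1)) (is_derive_mono 6^-1 2 y).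
  by congr is_derive; rewrite ?expr1; lra.
have E y : (sin - id + 6^-1 *: (id ^+ 3)) y = sin y - (y - y ^+ 3 / 6).
  by rewrite -[LHS]/(sin y - y + 6^-1 * (id ^+ 3) y) ?exprfctE; field.
rewrite -E; apply: (ge0_of_derive df) x0 => [y y0|].
  by have := cos_ge2p y0; lra.
by rewrite E ?sin0 ?cos0 ?expr0n/= ?mul0r ?(subr0, addr0, subrr).
Qed.

Lemma cos_le4p x : 0 <= x -> cos x <= 1 - x ^+ 2 / 2 + x ^+ 4 / 24.
Proof.
move=> x0; rewrite -subr_ge0.
have df y : is_derive y 1 (cst 1 - cos - 2^-1 *: (id ^+ 2) + 24^-1 *: (id ^+ 4)) (sin y - y + y ^+ 3 / 6).
  have := is_deriveD (is_deriveB (is_deriveB (is_derive_cst (1 : R) y 1) (is_derive_cos y)) (is_derive_mono 2^-1 1 y)) (is_derive_mono 24^-1 3 y).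
  by congr is_derive; rewrite ?expr1; lra.
have E y : (cst 1 - cos - 2^-1 *: (id ^+ 2) + 24^-1 *: (id ^+ 4)) y = 1 - y ^+ 2 / 2 + y ^+ 4 / 24 - (cos y).
  by rewrite -[LHS]/(1 - cos y - 2^-1 * (id ^+ 2) y + 24^-1 * (id ^+ 4) y) ?exprfctE; field.
rewrite -E; apply: (ge0_of_derive df) x0 => [y y0|].
  by have := sin_ge3 y0; lra.
by rewrite E ?sin0 ?cos0 ?expr0n/= ?mul0r ?(subr0, addr0, subrr).
Qed.

Lemma sin_le5 x : 0 <= x -> sin x <= x - x ^+ 3 / 6 + x ^+ 5 / 120.
Proof.
move=> x0; rewrite -subr_ge0.
have df y : is_derive y 1 (id - sin - 6^-1 *: (id ^+ 3) + 120^-1 *: (id ^+ 5)) (1 - cos y - y ^+ 2 / 2 + y ^+ 4 / 24).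
  have := is_deriveD (is_deriveB (is_deriveB (is_derive_id y 1) (is_derive_sin y)) (is_derive_mono 6^-1 2 y)) (is_derive_mono 120^-1 4 y).
  by congr is_derive; rewrite ?expr1; lra.
have E y : (id - sin - 6^-1 *: (id ^+ 3) + 120^-1 *: (id ^+ 5)) y = y - y ^+ 3 / 6 + y ^+ 5 / 120 - (sin y).
  by rewrite -[LHS]/(y - sin y - 6^-1 * (id ^+ 3) y + 120^-1 * (id ^+ 5) y) ?exprfctE; field.
rewrite -E; apply: (ge0_of_derive df) x0 => [y y0|].
  by have := cos_le4p y0; lra.
by rewrite E ?sin0 ?cos0 ?expr0n/= ?mul0r ?(subr0, addr0, subrr).
Qed.

Lemma cos_ge6p x : 0 <= x -> 1 - x ^+ 2 / 2 + x ^+ 4 / 24 - x ^+ 6 / 720 <= cos x.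
Proof.
move=> x0; rewrite -subr_ge0.
have df y : is_derive y 1 (cos - cst 1 + 2^-1 *: (id ^+ 2) - 24^-1 *: (id ^+ 4) + 720^-1 *: (id ^+ 6)) (- sin y + y - y ^+ 3 / 6 + y ^+ 5 / 120).
  have := is_deriveD (is_deriveB (is_deriveD (is_deriveB (is_derive_cos y) (is_derive_cst (1 : R) y 1)) (is_derive_mono 2^-1 1 y)) (is_derive_mono 24^-1 3 y)) (is_derive_mono 720^-1 5 y).
  by congr is_derive; rewrite ?expr1; lra.
have E y : (cos - cst 1 + 2^-1 *: (id ^+ 2) - 24^-1 *: (id ^+ 4) + 720^-1 *: (id ^+ 6)) y = cos y - (1 - y ^+ 2 / 2 + y ^+ 4 / 24 - y ^+ 6 / 720).
  by rewrite -[LHS]/(cos y - 1 + 2^-1 * (id ^+ 2) y - 24^-1 * (id ^+ 4) y + 720^-1 * (id ^+ 6) y) ?exprfctE; field.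
rewrite -E; apply: (ge0_of_derive df) x0 => [y y0|].
  by have := sin_le5 y0; lra.
by rewrite E ?sin0 ?cos0 ?expr0n/= ?mul0r ?(subr0, addr0, subrr).
Qed.

Lemma cos_ge2 x : 1 - x ^+ 2 / 2 <= cos x.
Proof.
have [/cos_ge2p//|/ltW x0] := leP 0 x.
by rewrite -[x ^+ 2]sqrrN -cosN cos_ge2p// oppr_ge0.
Qed.

(** If [pi >= 16 / 5], then [8 / 5] lies in the first quadrant and has a nonnegative cosine, but the
    quartic Taylor bound is negative there. *)
Lemma pi_lt : pi < 16 / 5 :> R.
Proof.
rewrite ltNge; apply/negP => h.
have p0 : pi < 4 :> R by have := pihalf_lt2 R; lra.
have : 0 <= cos (8 / 5 : R) by apply: cos_ge0_pihalf; apply/andP; split; lra.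
have x0 : 0 <= 8 / 5 :> R by lra.
have := cos_le4p x0; lra.
Qed.

(** The sextic lower bound of the cosine is still positive up to [39 / 25], so its zero [pi / 2]
    lies beyond. *)
Lemma pi_gt : 78 / 25 < pi :> R.
Proof.
rewrite ltNge; apply/negP => h.
have p0 := pi_ge2 R.
have h0 : 0 <= pi / 2 :> R by lra.
have h1 : pi / 2 <= 39 / 25 :> R by lra.
have := cos_ge6p h0; rewrite cos_pihalf.
move: (pi / 2 : R) h0 h1 => y y0 y1.
have y2 : y ^+ 2 <= (39 / 25) ^+ 2 by rewrite lerXn2r// nnegrE; lra.
have -> : 1 - y ^+ 2 / 2 + y ^+ 4 / 24 - y ^+ 6 / 720 = 1 - y ^+ 2 / 2 + (y ^+ 2) ^+ 2 / 24 - (y ^+ 2) ^+ 3 / 720 by ring.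
move: (y ^+ 2) y2 (sqr_ge0 y) => z; rewrite expr2 => z1 z0 H.
have : 0 < 1 - z / 2 + z ^+ 2 / 24 - z ^+ 3 / 720.
  rewrite !exprS expr0; nra.
lra.
Qed.

(** The flux density of a pure cosine after the product-to-sum formulas, see [Wf_profile]. There [M]
    and [N] are [pi / 2 * a] times the cosine and the sine of the angle, and [t] is the boundary
    coordinate rescaled to [-1, 1]. *)
Definition Wf (M N t : R) : R :=
  sin (M * (1 - t)) * sin (N * (1 + t)) - sin (M * (1 + t)) * sin (N * (1 - t)).

(** The linear factors of the four sines combine to [N M (1 - t^2)] in both products. The cubic
    terms then contribute [(M^2 - N^2) ((1 + t)^2 - (1 - t)^2) / 6], which is the main term, and the
    quintic terms of the subtracted product give the two errors. *)
Lemma Wf_poly (M N t : R) : 0 <= t -> t <= 1 -> 0 <= N -> 0 <= M -> M ^+ 2 <= 128 / 100 -> N ^+ 2 <= 27 / 100 ->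
  N * M * (1 - t ^+ 2) * (2 / 3 * (M ^+ 2 - N ^+ 2) * t
    - (M ^+ 2) ^+ 2 * (1 + t) ^+ 4 / 120 - (N ^+ 2) ^+ 2 * (1 - t) ^+ 4 / 120) <= Wf M N t.
Proof.
move=> t0 t1 N0 M0 Mx Nx.
have x0 := sqr_ge0 M; have n0 := sqr_ge0 N.
have a0 : 0 <= 1 - t by lra.
have b0 : 0 <= 1 + t by lra.
have a2 : (1 - t) ^+ 2 <= 1 by rewrite expr_le1//; lra.
have b2 : (1 + t) ^+ 2 <= 4.
  have t2 : t ^+ 2 <= 1 by rewrite expr_le1.
  have -> : (1 + t) ^+ 2 = 1 + 2 * t + t ^+ 2 by ring.
  lra.
set x := M ^+ 2 in Mx x0 *; set n := N ^+ 2 in Nx n0 *.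
have xa : x * (1 - t) ^+ 2 <= 128 / 100 by rewrite -[leRHS]mulr1 ler_pM// sqr_ge0.
have nb : n * (1 + t) ^+ 2 <= 108 / 100.
  by apply: le_trans (ler_pM n0 (sqr_ge0 _) Nx b2) _; lra.
have na : n * (1 - t) ^+ 2 <= 27 / 100 by rewrite -[leRHS]mulr1 ler_pM// sqr_ge0.
have xb : x * (1 + t) ^+ 2 <= 512 / 100.
  by apply: le_trans (ler_pM x0 (sqr_ge0 _) Mx b2) _; lra.
have Ma := mulr_ge0 M0 a0; have Mb := mulr_ge0 M0 b0.
have Na := mulr_ge0 N0 a0; have Nb := mulr_ge0 N0 b0.
have pMa := sin_ge3 Ma; have pNb := sin_ge3 Nb.
have qMb := sin_le5 Mb; have qNa := sin_le5 Na.
have e1 : M * (1 - t) - (M * (1 - t)) ^+ 3 / 6 = M * (1 - t) * (1 - x * (1 - t) ^+ 2 / 6).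
  by rewrite /x; field.
have e2 : N * (1 + t) - (N * (1 + t)) ^+ 3 / 6 = N * (1 + t) * (1 - n * (1 + t) ^+ 2 / 6).
  by rewrite /n; field.
have e3 : M * (1 + t) - (M * (1 + t)) ^+ 3 / 6 + (M * (1 + t)) ^+ 5 / 120
   = M * (1 + t) * (1 - x * (1 + t) ^+ 2 / 6 + (x * (1 + t) ^+ 2) ^+ 2 / 120).
  by rewrite /x; field.
have e4 : N * (1 - t) - (N * (1 - t)) ^+ 3 / 6 + (N * (1 - t)) ^+ 5 / 120
   = N * (1 - t) * (1 - n * (1 - t) ^+ 2 / 6 + (n * (1 - t) ^+ 2) ^+ 2 / 120).
  by rewrite /n; field.
rewrite e1 in pMa; rewrite e2 in pNb; rewrite e3 in qMb; rewrite e4 in qNa.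
have sNa : 0 <= sin (N * (1 - t)).
  apply: le_trans (sin_ge3 Na).
  have -> : N * (1 - t) - (N * (1 - t)) ^+ 3 / 6 = N * (1 - t) * (1 - n * (1 - t) ^+ 2 / 6).
    by rewrite /n; field.
  by rewrite mulr_ge0//; lra.
have L1 : M * (1 - t) * (1 - x * (1 - t) ^+ 2 / 6) * (N * (1 + t) * (1 - n * (1 + t) ^+ 2 / 6))
   <= sin (M * (1 - t)) * sin (N * (1 + t)).
  apply: ler_pM (pMa) (pNb); apply: mulr_ge0 => //.
    by move: xa; clear; move: (x * _) => q; lra.
  by move: nb; clear; move: (n * _) => q; lra.
have L2 : sin (M * (1 + t)) * sin (N * (1 - t)) <=
   M * (1 + t) * (1 - x * (1 + t) ^+ 2 / 6 + (x * (1 + t) ^+ 2) ^+ 2 / 120) *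
   (N * (1 - t) * (1 - n * (1 - t) ^+ 2 / 6 + (n * (1 - t) ^+ 2) ^+ 2 / 120)).
  apply: le_trans (ler_wpM2r sNa qMb) _.
  apply: ler_wpM2l qNa; apply: mulr_ge0 => //.
  by have := sqr_ge0 (x * (1 + t) ^+ 2); lra.
rewrite /Wf; apply: le_trans (lerB L1 L2).
set A := (1 - t) ^+ 2 in a2 xa na *; set B := (1 + t) ^+ 2 in b2 nb xb *.
have A0 : 0 <= A := sqr_ge0 _; have B0 : 0 <= B := sqr_ge0 _.
have BA : B - A = 4 * t by rewrite /A /B; ring.
have -> : (1 + t) ^+ 4 = B ^+ 2 by rewrite /B; ring.
have -> : (1 - t) ^+ 4 = A ^+ 2 by rewrite /A; ring.
have T : 2 / 3 * (x - n) * t = (x - n) * (B - A) / 6 by rewrite BA; field.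
rewrite T -subr_ge0.
have -> : forall u v w z : R, M * (1 - t) * u * (N * (1 + t) * v) - M * (1 + t) * w * (N * (1 - t) * z)
   = N * M * (1 - t ^+ 2) * (u * v - w * z) by move=> *; ring.
rewrite -mulrBr; apply: mulr_ge0.
  by rewrite !mulr_ge0// subr_ge0 expr_le1.
(* All that remains beyond the claimed bound are mixed terms of higher order, visibly nonnegative
   because [n A <= 27 / 100]. *)
have -> : (1 - x * A / 6) * (1 - n * B / 6) - (1 - x * B / 6 + (x * B) ^+ 2 / 120) * (1 - n * A / 6 + (n * A) ^+ 2 / 120)
   - ((x - n) * (B - A) / 6 - x ^+ 2 * B ^+ 2 / 120 - n ^+ 2 * A ^+ 2 / 120) =
   (x * B) * (n * A) ^+ 2 / 720 + (x * B) ^+ 2 * (n * A) / 720 * (1 - n * A / 20) by field.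
have nA := mulr_ge0 n0 A0; have xB := mulr_ge0 x0 B0.
apply: addr_ge0.
  by apply: divr_ge0; [apply: mulr_ge0; [exact: xB|exact: sqr_ge0]|exact: ler0n].
apply: mulr_ge0; last by move: na; clear; move: (n * A) => q; lra.
by apply: divr_ge0; [apply: mulr_ge0; [exact: sqr_ge0|exact: nA]|exact: ler0n].
Qed.

Lemma pow4_le (t : R) : 0 <= t -> t <= 1 -> (1 + t) ^+ 4 <= 1 + 15 * t.
Proof.
move=> t0 t1.
have t2 : t ^+ 2 <= t by rewrite expr2 ler_piMr.
have t3 : t ^+ 3 <= t by rewrite exprS ler_piMr// (le_trans t2).
have t4 : t ^+ 4 <= t by rewrite exprS ler_piMr// (le_trans t3).
have -> : (1 + t) ^+ 4 = 1 + 4 * t + 6 * t ^+ 2 + 4 * t ^+ 3 + t ^+ 4 by ring.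
move: (t ^+ 2) (t ^+ 3) (t ^+ 4) t2 t3 t4 => a b c; lra.
Qed.

Lemma Wf_lower (M N t : R) : 0 <= t -> t <= 1 -> 0 <= N -> 0 <= M -> M ^+ 2 <= 128 / 100 -> N ^+ 2 <= 27 / 100 ->
  74 / 100 <= M ^+ 2 - N ^+ 2 ->
  N * M * ((1 - t ^+ 2) * (259 / 1000 * t ^+ 2 - 2 / 1000)) <= t * Wf M N t.
Proof.
move=> t0 t1 N0 M0 Mx Nx MN.
have := ler_wpM2l t0 (Wf_poly t0 t1 N0 M0 Mx Nx).
apply: le_trans.
have x0 := sqr_ge0 M; have n0 := sqr_ge0 N.
move: (M ^+ 2) (N ^+ 2) Mx Nx MN x0 n0 => x n xx nn xn x0 n0.
have x2 : x ^+ 2 <= 164 / 100 by apply: le_trans (ler_pM _ _ xx xx) _ => //; lra.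
have n2 : n ^+ 2 <= 73 / 1000 by apply: le_trans (ler_pM _ _ nn nn) _ => //; lra.
have b4 := pow4_le t0 t1.
have b40 : 0 <= (1 + t) ^+ 4 by rewrite exprn_ge0//; lra.
have a4 : (1 - t) ^+ 4 <= 1 by rewrite expr_le1//; lra.
have a40 : 0 <= (1 - t) ^+ 4 by rewrite exprn_ge0//; lra.
have p1 : x ^+ 2 * (1 + t) ^+ 4 <= 164 / 100 * (1 + 15 * t) by rewrite ler_pM// sqr_ge0.
have p2 : n ^+ 2 * (1 - t) ^+ 4 <= 73 / 1000 by rewrite -[leRHS]mulr1 ler_pM// sqr_ge0.
have p3 : 2 / 3 * (74 / 100) * t <= 2 / 3 * (x - n) * t by rewrite ler_wpM2r//; lra.
have -> : t * (N * M * (1 - t ^+ 2) * (2 / 3 * (x - n) * t - x ^+ 2 * (1 + t) ^+ 4 / 120 - n ^+ 2 * (1 - t) ^+ 4 / 120))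
  = N * M * ((1 - t ^+ 2) * (t * (2 / 3 * (x - n) * t - x ^+ 2 * (1 + t) ^+ 4 / 120 - n ^+ 2 * (1 - t) ^+ 4 / 120))) by ring.
apply: ler_wpM2l; first exact: mulr_ge0.
apply: ler_wpM2l; first by rewrite subr_ge0 expr_le1.
(* [288 / 1000] is [2/3 * 74/100 - 164/100 * 15/120] rounded down, and [1 / 70] exceeds
   [(164/100 + 73/1000) / 120]. The term linear in [t] is absorbed by means of
   [(t - 1/4)^2 >= 0]. *)
apply: (@le_trans _ _ (t * (288 / 1000 * t - 70^-1))).
  have -> : t * (288 / 1000 * t - 70^-1) = 288 / 1000 * t ^+ 2 - 70^-1 * t by ring.
  have : 0 <= (t - 1 / 4) ^+ 2 := sqr_ge0 _.
  have -> : (t - 1 / 4) ^+ 2 = t ^+ 2 - t / 2 + 1 / 16 by field.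
  by move: (sqr_ge0 t); move: (t ^+ 2) => q; clear; lra.
apply: ler_wpM2l => //.
move: t0 p1 p2 p3; clear; move: (_ * _ ^+ 4) (_ * _ ^+ 4) (_ * (x - n) * t) => p q r; lra.
Qed.

End Taylor.

(** * Gaussian smoothing on the line *)

Section Smooth.
Variables (R : realType) (s : R).
Hypothesis s0 : 0 < s.
Let phi := normal_pdf 0 s.
Implicit Types (f g : R -> R) (x y z : R).

(** The smoothing [sm1] with the translation placed on [f]. The Gaussian weight is then fixed, so
    pointwise bounds and moduli of continuity pass through the integral, and cosines and
    exponentials, which are not integrable, can be treated. *)
Definition G1 f x := Rintegral (@leb R) setT (fun z => phi z * f (x - z)).

Lemma m_sub f x : measurable_fun setT f -> measurable_fun setT (fun z => f (x - z)).
Proof. by move=> mf; apply: (measurableT_comp mf); exact: measurable_funB. Qed.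

Lemma sm1_G1 f x : measurable_fun setT f -> sm1 s f x = G1 f x.
Proof.
move=> mf; rewrite /sm1 /kop /G1.
pose F z := phi z * f (x - z).
have mF : measurable_fun setT F by apply: measurable_funM; [exact: mphi|exact: m_sub].
rewrite -[RHS](Rintegral_shift x mF).
have mF' : measurable_fun setT (fun z => F (z + x)).
  by apply: (measurableT_comp mF); exact: measurable_funD.
rewrite -[RHS](Rintegral_opp mF').
congr Rintegral; apply/funext => y; rewrite /F /K1/= addrC.
by congr (_ * f _); ring.
Qed.

Lemma G1_int f (B : R) x : measurable_fun setT f -> (forall x, `|f x| <= B) ->
  (@leb R).-integrable setT (EFin \o (fun z => phi z * f (x - z))).
Proof.
move=> mf fB; apply: bint_int; apply: bintM; first exact: (phi_bint s0).
  exact: m_sub.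
by exists B => z.
Qed.

Lemma phi_Rint : Rintegral (@leb R) setT phi = 1.
Proof. by rewrite /Rintegral phi_int. Qed.

Lemma G1_dom f g x : measurable_fun setT f -> (forall z, `|f z| <= g z) ->
  (@leb R).-integrable setT (EFin \o (fun z => phi z * g (x - z))) ->
  `|G1 f x| <= G1 g x.
Proof.
move=> mf fg ig.
have if_ : (@leb R).-integrable setT (EFin \o (fun z => phi z * f (x - z))).
  apply: (@dom_integrable _ _ _ (@leb R) _ (fun z => phi z * g (x - z))).
  - by apply: measurable_funM; [exact: mphi|exact: m_sub].
  - exact: ig.
  - by move=> z; rewrite !normrM ler_wpM2l// (le_trans (fg _))// ler_norm.
rewrite /G1 (le_trans (le_normr_Rintegral _ if_))//.
apply: le_Rintegral => //; first exact: (integrable_norm if_).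
by move=> z _; rewrite normrM (ger0_norm (phi_ge0 s z)) ler_wpM2l ?phi_ge0.
Qed.

Lemma G1_cst (B : R) x : G1 (fun=> B) x = B.
Proof.
rewrite /G1 (_ : (fun z => phi z * B) = (fun z => B * phi z)); last by apply/funext => z; rewrite mulrC.
by rewrite RintegralZl ?phi_Rint ?mulr1//; exact: (bint_int (phi_bint s0)).
Qed.

Lemma G1_le f (B : R) x : measurable_fun setT f -> (forall x, `|f x| <= B) -> `|G1 f x| <= B.
Proof.
move=> mf fB; rewrite -[leRHS](G1_cst B x); apply: G1_dom => //.
by apply: (@G1_int (fun=> B) `|B|).
Qed.

Lemma G1D f g (B C : R) x : measurable_fun setT f -> measurable_fun setT g ->
  (forall x, `|f x| <= B) -> (forall x, `|g x| <= C) -> G1 (fun z => f z + g z) x = G1 f x + G1 g x.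
Proof.
move=> mf mg fB gC; rewrite /G1 -RintegralD//; [|exact: (G1_int _ mf fB)|exact: (G1_int _ mg gC)].
by congr Rintegral; apply/funext => z; rewrite mulrDr.
Qed.

Lemma G1Z f (a B : R) x : measurable_fun setT f ->
  (forall x, `|f x| <= B) -> G1 (fun z => a * f z) x = a * G1 f x.
Proof.
move=> mf fB; rewrite /G1 -RintegralZl//; last exact: (G1_int _ mf fB).
by congr Rintegral; apply/funext => z; rewrite mulrCA.
Qed.

Lemma G1_even f x : measurable_fun setT f -> (forall x, f (- x) = f x) -> G1 f (- x) = G1 f x.
Proof.
move=> mf fe; rewrite /G1.
have mF : measurable_fun setT (fun z => phi z * f (x - z)).
  by apply: measurable_funM; [exact: mphi|exact: m_sub].
rewrite -[RHS](Rintegral_opp mF); congr Rintegral; apply/funext => z.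
rewrite /phi phi_even//; congr (_ * _).
by rewrite -fe; congr f; ring.
Qed.

(* The comparison function [W] lets a modulus of continuity be localized. *)
Lemma G1_lip f (K B : R) (W : R -> R) x y : measurable_fun setT f -> (forall x, `|f x| <= B) ->
  (forall x y, `|f x - f y| <= K * `|x - y| * (W x + W y)) ->
  (forall x, (@leb R).-integrable setT (EFin \o (fun z => phi z * W (x - z)))) ->
  `|G1 f x - G1 f y| <= K * `|x - y| * (G1 W x + G1 W y).
Proof.
move=> mf fB fK iW.
have iD : (@leb R).-integrable setT (EFin \o (fun z => phi z * W (x - z) + phi z * W (y - z))).
  exact: (integrableD measurableT (iW x) (iW y)).
have -> : K * `|x - y| * (G1 W x + G1 W y) =
    Rintegral (@leb R) setT (fun z => K * `|x - y| * (phi z * W (x - z) + phi z * W (y - z))).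
  rewrite (RintegralZl _ measurableT iD) (RintegralD measurableT (iW x) (iW y)).
  by [].
have ix := G1_int x mf fB; have iy := G1_int y mf fB.
have iB : (@leb R).-integrable setT (EFin \o (fun z => phi z * f (x - z) - phi z * f (y - z))).
  exact: (integrableB measurableT ix iy).
rewrite /G1 -(RintegralB measurableT ix iy).
rewrite (le_trans (le_normr_Rintegral _ iB))//.
apply: le_Rintegral => //.
- exact: (integrable_norm iB).
- exact: (integrableZl measurableT (K * `|x - y|) iD).
move=> z _; rewrite -mulrBr normrM (ger0_norm (phi_ge0 s z)) -mulrDr [leRHS]mulrCA.
apply: ler_wpM2l; first exact: phi_ge0.
rewrite (le_trans (fK _ _))//.
by have -> : x - z - (y - z) = x - y by ring.
Qed.

(** Completing the square: an exponential tilt of the centered Gaussian is a multiple of a shifted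
    Gaussian density, whose integral is known. *)
Lemma phi_exp (l z : R) : phi z * expR (l * z) = expR (l ^+ 2 * s ^+ 2 / 2) * normal_pdf (l * s ^+ 2) s z.
Proof.
rewrite /phi !normal_pdfE ?gt_eqF// /normal_fun -[LHS]mulrA -expRD [RHS]mulrCA -expRD.
congr (_ * expR _).
by rewrite -(mulr_natr (_ ^+ 2)); field; rewrite gt_eqF.
Qed.

Lemma phi_exp_int (l : R) : (@leb R).-integrable setT (EFin \o (fun z => phi z * expR (l * z))).
Proof.
have -> : (fun z => phi z * expR (l * z)) = (fun z => expR (l ^+ 2 * s ^+ 2 / 2) * normal_pdf (l * s ^+ 2) s z).
  by apply/funext => z; exact: phi_exp.
exact: (integrableZl measurableT _ (integrable_normal_pdf (l * s ^+ 2) s)).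
Qed.

Lemma phi_exp_Rint (l : R) : Rintegral (@leb R) setT (fun z => phi z * expR (l * z)) = expR (l ^+ 2 * s ^+ 2 / 2).
Proof.
have -> : (fun z => phi z * expR (l * z)) = (fun z => expR (l ^+ 2 * s ^+ 2 / 2) * normal_pdf (l * s ^+ 2) s z).
  by apply/funext => z; exact: phi_exp.
rewrite RintegralZl//; last exact: integrable_normal_pdf.
by rewrite /Rintegral integral_normal_pdf mulr1.
Qed.

(* Exponentials are eigenfunctions of Gaussian smoothing, so a bound by [omega]
   survives smoothing up to the factor of [G1_omega]: a Chernoff bound. *)
Definition omega (l x : R) := expR (l * (x - 1)) + expR (l * (- x - 1)).

Lemma omega_shift (l x z : R) : phi z * omega l (x - z) =
  expR (l * (x - 1)) * (phi z * expR (- l * z)) + expR (l * (- x - 1)) * (phi z * expR (l * z)).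
Proof.
rewrite /omega mulrDr; congr (_ + _); rewrite mulrCA -expRD; congr (_ * expR _); ring.
Qed.

Lemma omega_int (l x : R) : (@leb R).-integrable setT (EFin \o (fun z => phi z * omega l (x - z))).
Proof.
have -> : (fun z => phi z * omega l (x - z)) = (fun z =>
  expR (l * (x - 1)) * (phi z * expR (- l * z)) + expR (l * (- x - 1)) * (phi z * expR (l * z))).
  by apply/funext => z; exact: omega_shift.
exact: (integrableD measurableT (integrableZl measurableT _ (phi_exp_int (- l)))
  (integrableZl measurableT _ (phi_exp_int l))).
Qed.

Lemma G1_omega (l x : R) : G1 (omega l) x = expR (l ^+ 2 * s ^+ 2 / 2) * omega l x.
Proof.
rewrite /G1.
have -> : (fun z => phi z * omega l (x - z)) = (fun z =>
  expR (l * (x - 1)) * (phi z * expR (- l * z)) + expR (l * (- x - 1)) * (phi z * expR (l * z))).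
  by apply/funext => z; exact: omega_shift.
rewrite (RintegralD measurableT (integrableZl measurableT _ (phi_exp_int (- l)))
  (integrableZl measurableT _ (phi_exp_int l))).
rewrite (RintegralZl _ measurableT (phi_exp_int (- l))) (RintegralZl _ measurableT (phi_exp_int l)).
by rewrite !phi_exp_Rint sqrrN /omega; ring.
Qed.

Lemma lip_measurable f (L : R) : (forall x y, `|f x - f y| <= L * `|x - y|) -> measurable_fun setT f.
Proof.
move=> fL; apply: continuous_measurable_fun => x.
apply/cvgrPdist_le => e e0.
have [L0|L0] := leP L 0.
  by near=> y; rewrite (le_trans (fL _ _))// (@le_trans _ _ 0) ?(ltW e0)// mulr_le0_ge0.
have Le : 0 < L^-1 * e by rewrite mulr_gt0// invr_gt0.
have /cvgrPdist_le/(_ _ Le) H := @cvg_id _ (nbhs x).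
near=> y; rewrite (le_trans (fL _ _))// -ler_pdivlMl//; near: y; exact: H.
Unshelve. all: by end_near. Qed.

Lemma G1_lip1 f (L B : R) x y : (forall x, `|f x| <= B) ->
  (forall x y, `|f x - f y| <= L * `|x - y|) -> `|G1 f x - G1 f y| <= L * `|x - y|.
Proof.
move=> fB fL; have mf := lip_measurable fL.
have := @G1_lip f L B (fun=> 2^-1) x y mf fB.
have h2 : 2^-1 + 2^-1 = 1 :> R by lra.
rewrite !G1_cst h2 mulr1; apply.
  by move=> a b; rewrite mulr1.
by move=> a; apply: (@G1_int (fun=> 2^-1) `|2^-1|).
Qed.

End Smooth.

(** * The truncated cosine under smoothing *)

Section Profile.
Variables (R : realType) (s : R).
Hypothesis s0 : 0 < s.
Let phi := normal_pdf 0 s.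
Implicit Types (f g : R -> R) (x y z l : R).

Lemma sin_norm_le x : `|sin x| <= `|x|.
Proof.
have H (y : R) : 0 <= y -> `|sin y| <= y.
  move=> y0; rewrite ler_norml sin_le_id// andbT.
  have [y1|y1] := leP y 1; last by rewrite (@le_trans _ _ (-1)) ?sin_geN1// lerN2 ltW.
  have := sin_ge3 y0.
  have : y ^+ 3 <= y.
    by rewrite exprS ler_piMr// exprn_ile1.
  move: (y ^+ 3) (sin y) => a b h1 h2; lra.
have [x0|x0] := leP 0 x; first by rewrite (ger0_norm x0) H.
by have := H (- x); rewrite sinN normrN (ltr0_norm x0) oppr_ge0; apply; exact: ltW.
Qed.

Lemma cos_lip x y : `|cos x - cos y| <= `|x - y|.
Proof.
suff H (a b : R) : `|cos (a + b) - cos (a - b)| <= `|a + b - (a - b)|.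
  have := H ((x + y) / 2) ((x - y) / 2).
  have -> : (x + y) / 2 + (x - y) / 2 = x by field.
  by have -> : (x + y) / 2 - (x - y) / 2 = y by field.
rewrite cosD cosB.
have -> : cos a * cos b - sin a * sin b - (cos a * cos b + sin a * sin b) = - (2 * (sin a * sin b)) by ring.
have -> : a + b - (a - b) = 2 * b by ring.
rewrite normrN !normrM ler_wpM2l//.
by rewrite -[leRHS]mul1r ler_pM ?sin_norm_le// ler_norml sin_geN1 sin_le1.
Qed.

Definition ch x : R := cos (pi / 2 * x).
Definition e1 x : R := ind 1 x * ch x.
Definition clamp x : R := Num.max (-1) (Num.min x 1).

Lemma pi2_gt0 : (0 : R) < pi / 2. Proof. by rewrite divr_gt0// pi_gt0. Qed.

Lemma ch_le1 x : `|ch x| <= 1.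
Proof. by rewrite ler_norml cos_geN1 cos_le1. Qed.

Lemma chN x : ch (- x) = ch x. Proof. by rewrite /ch mulrN cosN. Qed.

Lemma ch1 : ch 1 = 0. Proof. by rewrite /ch mulr1 cos_pihalf. Qed.

Lemma ch_lip x y : `|ch x - ch y| <= pi / 2 * `|x - y|.
Proof. by rewrite (le_trans (cos_lip _ _))// -mulrBr normrM gtr0_norm ?pi2_gt0. Qed.

Lemma e1N x : e1 (- x) = e1 x.
Proof. by rewrite /e1 chN /ind lerNl opprK lerNl andbC. Qed.

Lemma clamp_lip x y : `|clamp x - clamp y| <= `|x - y|.
Proof.
wlog xy : x y / x <= y => [H|].
  have [xy|/ltW yx] := leP x y; first exact: H.
  by rewrite distrC (distrC x) H.
rewrite (distrC x) (@ger0_norm _ (y - x)) ?subr_ge0// distrC ler_norml.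
rewrite /clamp /Num.max /Num.min.
case: (ltP x 1) => A; case: (ltP y 1) => B; case: ltP => C; case: ltP => D; apply/andP; split; lra.
Qed.

(** As [ch] vanishes at -1 and 1, cutting it off there is the same as clamping its argument; [e1]
    thus inherits the Lipschitz constant of [ch]. *)
Lemma e1_clamp x : e1 x = ch (clamp x).
Proof.
rewrite /e1 /ind /clamp /Num.max /Num.min.
have [A|A] := ltP x 1.
  have [B|B] := ltP (-1) x; first by rewrite (ltW A) (ltW B) mul1r.
  rewrite chN ch1; have [C|C] := leP (-1) x; rewrite ?mul0r//=.
  by rewrite (_ : x = -1) ?chN ?ch1 ?mulr0//; apply/le_anti; rewrite B C.
have h : -1 < 1 :> R by lra.
rewrite h ch1.
have [B|B] := leP x 1; rewrite ?andbF ?mul0r//.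
by rewrite (_ : x = 1) ?ch1 ?mulr0//; apply/le_anti; rewrite A B.
Qed.

Lemma e1_lip x y : `|e1 x - e1 y| <= pi / 2 * `|x - y|.
Proof.
rewrite !e1_clamp (le_trans (ch_lip _ _))// ler_wpM2l ?clamp_lip//.
exact: ltW pi2_gt0.
Qed.

Lemma e1_le1 x : `|e1 x| <= 1.
Proof. by rewrite e1_clamp ch_le1. Qed.

Definition tail x : R := e1 x - ch x.

Lemma tail_in x : `|x| <= 1 -> tail x = 0.
Proof. by rewrite ler_norml /tail /e1 /ind => ->; rewrite mul1r subrr. Qed.

Lemma tail_le1 x : `|tail x| <= 1.
Proof.
rewrite /tail /e1 /ind; case: ifP => _; rewrite ?mul1r ?subrr ?normr0//.
by rewrite mul0r sub0r normrN ch_le1.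
Qed.

Lemma omega_ge0 l x : 0 <= omega l x.
Proof. by rewrite addr_ge0// expR_ge0. Qed.

Lemma omega_ge1 l x : 0 <= l -> 1 < `|x| -> 1 <= omega l x.
Proof.
move=> l0; have [x0|x0] := leP 0 x.
  rewrite (ger0_norm x0) => x1.
  rewrite /omega (@le_trans _ _ (expR (l * (x - 1))))// ?lerDl ?expR_ge0//.
  by rewrite -[leLHS]expR0 ler_expR mulr_ge0// subr_ge0 ltW.
rewrite (ltr0_norm x0) => x1.
rewrite /omega (@le_trans _ _ (expR (l * (- x - 1))))// ?lerDr ?expR_ge0//.
by rewrite -[leLHS]expR0 ler_expR mulr_ge0// subr_ge0 ltW.
Qed.

Lemma tail_omega l x : 0 <= l -> `|tail x| <= omega l x.
Proof.
move=> l0; have [x1|x1] := leP `|x| 1; first by rewrite tail_in// normr0 omega_ge0.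
exact: le_trans (tail_le1 _) (omega_ge1 l0 x1).
Qed.

Lemma tail_lip1 x y : `|tail x - tail y| <= pi * `|x - y|.
Proof.
have -> : tail x - tail y = (e1 x - e1 y) - (ch x - ch y) by rewrite /tail; ring.
rewrite (le_trans (ler_normB _ _))//.
have -> : pi * `|x - y| = pi / 2 * `|x - y| + pi / 2 * `|x - y| by field.
by rewrite lerD ?e1_lip ?ch_lip.
Qed.

(** The tail vanishes on [-1, 1]. If its two values differ, one of the points lies outside, where
    the weight [omega] is at least 1. *)
Lemma tail_lip l x y : 0 <= l -> `|tail x - tail y| <= pi * `|x - y| * (omega l x + omega l y).
Proof.
move=> l0; have pi0 : (0 : R) <= pi by exact: ltW (pi_gt0 _).
have [x1|x1] := leP `|x| 1; last first.
  rewrite (le_trans (tail_lip1 _ _))// ler_peMr// ?mulr_ge0//.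
  by rewrite (le_trans (omega_ge1 l0 x1))// lerDl omega_ge0.
have [y1|y1] := leP `|y| 1; last first.
  rewrite (le_trans (tail_lip1 _ _))// ler_peMr// ?mulr_ge0//.
  by rewrite (le_trans (omega_ge1 l0 y1))// lerDr omega_ge0.
by rewrite !tail_in// subrr normr0 !mulr_ge0// addr_ge0// omega_ge0.
Qed.

Lemma ch_meas : measurable_fun setT ch. Proof. exact: lip_measurable ch_lip. Qed.
Lemma e1_meas : measurable_fun setT e1. Proof. exact: lip_measurable e1_lip. Qed.
Lemma tail_meas : measurable_fun setT tail. Proof. exact: lip_measurable tail_lip1. Qed.

Lemma G1_meas f (L B : R) : (forall x, `|f x| <= B) ->
  (forall x y, `|f x - f y| <= L * `|x - y|) -> measurable_fun setT (G1 s f).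
Proof. by move=> fB fL; apply: (@lip_measurable _ _ L) => x y; exact: (G1_lip1 s0 _ _ fB). Qed.

(** The eigenvalue of Gaussian smoothing on the cosine, [exp (- pi^2 s^2 / 8)]. It is left as an
    integral, since the bounds [mch_ge] and [mch_le1] are all that is used. *)
Definition mch := Rintegral (@leb R) setT (fun z => phi z * ch z).
Let m := mch.

Lemma G1_ch x : G1 s ch x = m * ch x.
Proof.
pose sh z : R := sin (pi / 2 * z).
have shL (y z : R) : `|sh y - sh z| <= pi / 2 * `|y - z|.
  rewrite /sh; have := cos_lip (pi / 2 * y - pi / 2) (pi / 2 * z - pi / 2).
  rewrite !cosB cos_pihalf sin_pihalf !mulr0 !mulr1 !add0r => /le_trans; apply.
  have -> : pi / 2 * y - pi / 2 - (pi / 2 * z - pi / 2) = pi / 2 * (y - z) by ring.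
  by rewrite normrM gtr0_norm ?pi2_gt0.
have msh := lip_measurable shL.
have mch := ch_meas.
have sh1 z : `|sh z| <= 1 by rewrite ler_norml sin_geN1 sin_le1.
have ic : bint (@leb R) (fun z => phi z * ch z).
  by apply: bintM => //; [exact: phi_bint|exists 1 => z; exact: ch_le1].
have is_ : bint (@leb R) (fun z => phi z * sh z).
  by apply: bintM => //; [exact: phi_bint|exists 1].
have J0 : Rintegral (@leb R) setT (fun z => phi z * sh z) = 0.
  have := Rintegral_opp (bint_mf is_).
  rewrite (_ : (fun x => phi (- x) * sh (- x)) = (fun z => -1 * (phi z * sh z))); last first.
    by apply/funext => z; rewrite /phi phi_even// /sh mulrN sinN; ring.
  rewrite RintegralZl//; last exact: bint_int.
  by move: (Rintegral _ _ _) => J; lra.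
rewrite /G1 (_ : (fun z => _) = (fun z => ch x * (phi z * ch z) + sh x * (phi z * sh z))); last first.
  by apply/funext => z; rewrite /ch /sh mulrBr cosB /phi; ring.
rewrite (RintegralD measurableT (integrableZl measurableT _ (bint_int ic)) (integrableZl measurableT _ (bint_int is_))).
rewrite (RintegralZl _ measurableT (bint_int ic)) (RintegralZl _ measurableT (bint_int is_)).
by rewrite J0 mulr0 addr0 mulrC.
Qed.

Definition vt := G1 s (G1 s tail).

(** The full cosine is an exact eigenfunction, so the deviation of the smoothed profile from a
    cosine consists of the smoothed tail alone. *)
Lemma kk_e1 x : kk s e1 x = m ^+ 2 * ch x + vt x.
Proof.
have G1e : G1 s e1 = (fun x => m * ch x + G1 s tail x).
  apply/funext => y.
  have -> : e1 = (fun x => ch x + tail x) by apply/funext => z; rewrite /tail; ring.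
  by rewrite (G1D s0 _ ch_meas tail_meas ch_le1 tail_le1) G1_ch.
rewrite /kk (_ : sm1 s e1 = G1 s e1); last by apply/funext => y; rewrite sm1_G1//; exact: e1_meas.
rewrite sm1_G1; last exact: (G1_meas e1_le1 e1_lip).
have m1 z : `|m * ch z| <= `|m| by rewrite normrM ler_piMr// ch_le1.
have mm : measurable_fun setT (fun x => m * ch x) by apply: measurable_funM => //; exact: ch_meas.
have gt1 z : `|G1 s tail z| <= 1 by apply: (G1_le s0) => //; [exact: tail_meas|exact: tail_le1].
rewrite G1e (@G1D _ _ s0 (fun x => m * ch x) (G1 s tail) _ _ x mm (G1_meas tail_le1 tail_lip1) m1 gt1).
rewrite (@G1Z _ _ s0 ch m 1 x ch_meas ch_le1) G1_ch expr2.
by rewrite mulrA.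
Qed.

Let E l := expR (l ^+ 2 * s ^+ 2 / 2).

Lemma vt_le l x : 0 <= l -> `|vt x| <= E l ^+ 2 * omega l x.
Proof.
move=> l0; have G1t z : `|G1 s tail z| <= E l * omega l z.
  rewrite /E -(G1_omega s0); apply: G1_dom; first exact: tail_meas.
    by move=> y; apply: tail_omega.
  exact: omega_int.
rewrite /vt expr2 -mulrA {2}/E -(G1_omega s0).
have iE y : (@leb R).-integrable setT (EFin \o (fun z => phi z * (E l * omega l (y - z)))).
  rewrite (_ : (fun z => _) = (fun z => E l * (phi z * omega l (y - z)))).
    exact: (integrableZl measurableT _ (omega_int s0 l y)).
  by apply/funext => z; rewrite mulrCA.
have -> : E l * G1 s (omega l) x = G1 s (fun z => E l * omega l z) x.
  rewrite {2}/G1 (_ : (fun z => _) = (fun z => E l * (phi z * omega l (x - z)))).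
    by rewrite (RintegralZl _ measurableT (omega_int s0 l x)).
  by apply/funext => z; rewrite mulrCA.
exact: G1_dom (G1_meas tail_le1 tail_lip1) G1t (iE x).
Qed.

Lemma vt_lip l x y : 0 <= l -> `|vt x - vt y| <= pi * E l ^+ 2 * `|x - y| * (omega l x + omega l y).
Proof.
move=> l0.
have H1 (a b : R) : `|G1 s tail a - G1 s tail b| <= pi * E l * `|a - b| * (omega l a + omega l b).
  have := G1_lip s0 a b tail_meas tail_le1 (fun a b => tail_lip a b l0) (omega_int s0 l).
  rewrite !(G1_omega s0) -/(E l) => /le_trans; apply; rewrite le_eqVlt; apply/orP; left; apply/eqP.
  ring.
have gt1 z : `|G1 s tail z| <= 1 by apply: (G1_le s0) => //; [exact: tail_meas|exact: tail_le1].
have := G1_lip s0 x y (G1_meas tail_le1 tail_lip1) gt1 H1 (omega_int s0 l).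
rewrite !(G1_omega s0) -/(E l) => /le_trans; apply; rewrite le_eqVlt; apply/orP; left; apply/eqP.
ring.
Qed.

End Profile.

(** * Bounds on the flux *)

Section FluxBounds.
Variable R : realType.
Implicit Types (f g h k : R -> R) (x y z t a d : R).

Lemma continuous_ind_int f a : continuous f ->
  (@leb R).-integrable setT (EFin \o (fun t => ind a t * f t)).
Proof.
move=> cf; have : (@leb R).-integrable `[- a, a] (EFin \o f).
  apply: continuous_compact_integrable; first exact: segment_compact.
  by apply: continuous_subspaceT => x; exact: cf.
rewrite integrable_mkcond//; congr (integrable _ _ _); apply/funext => t /=.
by rewrite patchE indE indicE; case: (_ \in _); rewrite ?mul1r ?mul0r.
Qed.

(** The flux integral is never evaluated: its density is compared with a minorant whose
    antiderivative [f] is explicit. *)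
Lemma ind_int_ge f f' h a : 0 < a -> (forall x : R, is_derive x 1 f (f' x)) -> continuous f' ->
  (forall t, `|t| <= a -> f' t <= h t) ->
  (@leb R).-integrable setT (EFin \o (fun t => ind a t * h t)) ->
  f a - f (- a) <= Rintegral (@leb R) setT (fun t => ind a t * h t).
Proof.
move=> a0 df cf fh ih; have H := FTC_ind a0 df cf.
have -> : f a - f (- a) = Rintegral (@leb R) setT (fun t => ind a t * f' t) by rewrite /Rintegral H.
apply: le_Rintegral => //; first exact: continuous_ind_int.
move=> t _; rewrite /ind; case: ifP => ta; rewrite ?mul0r// !mul1r fh//.
by rewrite ler_norml.
Qed.

Lemma ind_int_norm h a (B : R) : 0 < a -> (forall t, `|t| <= a -> `|h t| <= B) ->
  (@leb R).-integrable setT (EFin \o (fun t => ind a t * h t)) ->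
  `|Rintegral (@leb R) setT (fun t => ind a t * h t)| <= 2 * a * B.
Proof.
move=> a0 hB ih.
have cc (c : R) : continuous (fun _ : R => c) by exact: cst_continuous.
have dd (c x : R) : is_derive x 1 (fun y : R => c * y) c.
  have := is_deriveZ c (is_derive_id x 1); rewrite /GRing.scale/= mulr1.
  by [].
have H1 := ind_int_ge a0 (dd (- B)) (cc (- B)) _ ih.
have ih' : (@leb R).-integrable setT (EFin \o (fun t => ind a t * - h t)).
  rewrite (_ : (fun t => _) = (fun t => -1 * (ind a t * h t))).
    exact: (integrableZl measurableT _ ih).
  by apply/funext => t; ring.
have H2 := ind_int_ge a0 (dd (- B)) (cc (- B)) _ ih'.
have e : Rintegral (@leb R) setT (fun t => ind a t * - h t) = - Rintegral (@leb R) setT (fun t => ind a t * h t).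
  rewrite (_ : (fun t => ind a t * - h t) = (fun t => -1 * (ind a t * h t))); last by apply/funext => t; ring.
  by rewrite RintegralZl// mulN1r.
rewrite e in H2.
have {}H1 := H1 (fun t ht => let: conj a _ := andP (etrans (esym (ler_norml _ _)) (hB t ht)) in a).
have {}H2 : - B * a - - B * - a <= - Rintegral (@leb R) setT (fun t => ind a t * h t).
  apply: H2 => t /hB; rewrite ler_norml lerN2 => /andP[_]; exact.
rewrite ler_norml; move: H1 H2; clear; move: (Rintegral _ _ _) => I H1 H2.
by apply/andP; split; nra.
Qed.

Definition fdens k a d t := t * (Mrot k d a t - Mrot k d (- a) t - (Mrot k d t a - Mrot k d t (- a))).

Lemma fdens_even k a d t : (forall x, k (- x) = k x) ->
  fdens k a d t = 2 * t * (k (cos d * a + sin d * t) * k (cos d * t - sin d * a)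
                         - k (cos d * a - sin d * t) * k (cos d * t + sin d * a)).
Proof.
move=> ke; rewrite /fdens /Mrot.
have -> : cos d * - a + sin d * t = - (cos d * a - sin d * t) by ring.
have -> : cos d * t - sin d * - a = cos d * t + sin d * a by ring.
have -> : cos d * a - sin d * t = - (sin d * t - cos d * a) by ring.
have -> : cos d * t + sin d * - a = cos d * t - sin d * a by ring.
have -> : cos d * - a - sin d * t = - (cos d * a + sin d * t) by ring.
rewrite !ke; ring.
Qed.

Lemma flux_odd k dk a d (C : R) : 0 < a -> (forall x : R, is_derive x 1 k (dk x)) ->
  (forall x, `|k x| <= C) -> (forall x, k (- x) = k x) -> flux k a (- d) = - flux k a d.
Proof.
move=> a0 dk1 k1 ke; have i1 := flux_integrable a0 dk1 k1 d; rewrite /flux.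
have F e : (fun t => ind a t * (t * (Mrot k e a t - Mrot k e (- a) t - (Mrot k e t a - Mrot k e t (- a)))))
  = (fun t => ind a t * fdens k a e t) by [].
rewrite !F; have -> : (fun t => ind a t * fdens k a (- d) t) = (fun t => -1 * (ind a t * fdens k a d t)).
  apply/funext => t; rewrite !fdens_even// cosN sinN.
  have -> : cos d * a + - sin d * t = cos d * a - sin d * t by ring.
  have -> : cos d * t - - sin d * a = cos d * t + sin d * a by ring.
  have -> : cos d * a - - sin d * t = cos d * a + sin d * t by ring.
  have -> : cos d * t + - sin d * a = cos d * t - sin d * a by ring.
  ring.
by rewrite (RintegralZl _ measurableT i1) mulN1r.
Qed.

(** The density contains four products of two profile values, each of which changes by at most
    [3 * tol]. This gives the factor 12, with no derivative of the profile involved. *)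
Lemma flux_near k k' dk dk' a d (C' tol : R) : 0 < a ->
  (forall x : R, is_derive x 1 k (dk x)) -> (forall x : R, is_derive x 1 k' (dk' x)) ->
  (forall x, `|k x| <= 1) -> (forall x, `|k' x| <= C') -> (forall x, `|k' x - k x| <= tol) -> tol <= 1 ->
  `|flux k' a d - flux k a d| <= 2 * a * (a * (12 * tol)).
Proof.
move=> a0 dk1 dk2 k1 k2 kt t1.
have i1 := flux_integrable a0 dk1 k1 d; have i2 := flux_integrable a0 dk2 k2 d.
rewrite /flux -RintegralB//.
have -> : (fun t => ind a t * fdens k' a d t - ind a t * fdens k a d t) =
  (fun t => ind a t * (fdens k' a d t - fdens k a d t)) by apply/funext => t; ring.
have t0 : 0 <= tol by rewrite (le_trans _ (kt 0)).
have M3 x y : `|Mrot k' d x y - Mrot k d x y| <= 3 * tol.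
  rewrite /Mrot; move: (cos d * x + sin d * y) (cos d * y - sin d * x) => u v.
  have -> : k' u * k' v - k u * k v = (k' u - k u) * (k' v - k v) + (k' u - k u) * k v + k u * (k' v - k v) by ring.
  rewrite (le_trans (ler_normD _ _))// (le_trans (lerD (ler_normD _ _) (lexx _)))// !normrM.
  have : `|k' u - k u| * `|k' v - k v| <= 1 * tol.
    by rewrite ler_pM// (le_trans (kt _)).
  have : `|k' u - k u| * `|k v| <= tol * 1 by rewrite ler_pM.
  have : `|k u| * `|k' v - k v| <= 1 * tol by rewrite ler_pM.
  clear; move: (`|_| * _) (`|_| * _) (`|_| * _) => A B D; lra.
apply: ind_int_norm => //.
  move=> t ta; rewrite /fdens -mulrBr normrM ler_pM//.
  rewrite (_ : _ - _ = (Mrot k' d a t - Mrot k d a t) - (Mrot k' d (- a) t - Mrot k d (- a) t)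
     - ((Mrot k' d t a - Mrot k d t a) - (Mrot k' d t (- a) - Mrot k d t (- a)))); last by ring.
  have := M3 a t; have := M3 (- a) t; have := M3 t a; have := M3 t (- a); clear.
  rewrite !ler_norml; move: (_ - _) (_ - _) (_ - _) (_ - _) => A B D F.
  by move=> /andP[? ?] /andP[? ?] /andP[? ?] /andP[? ?]; apply/andP; split; lra.
rewrite (_ : (fun t => _) = (fun t => ind a t * fdens k' a d t - ind a t * fdens k a d t)).
  exact: (integrableB measurableT i2 i1).
by apply/funext => t; ring.
Qed.

End FluxBounds.

(** * Chernoff bounds for the smoothed tail *)

Section Tail.
Variables (R : realType) (s : R).
Hypothesis s0 : 0 < s.
Hypothesis s2 : s ^+ 2 <= (10 ^+ 4)^-1.
Let phi := normal_pdf 0 s.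
Implicit Types (x y z l : R).

Lemma expR_le_inv (x : R) : x < 1 -> expR x <= (1 - x)^-1.
Proof.
move=> x1; rewrite -[leLHS]invrK lef_pV2 ?posrE ?invr_gt0 ?expR_gt0 ?subr_gt0//.
by rewrite -expRN expR_ge1Dx.
Qed.

(** Dominates a square by exponentials, whose Gaussian integrals are given by [phi_exp_Rint]; no
    second moment has to be computed for [mch_ge]. *)
Lemma sq_le_exp z : z ^+ 2 / 4 <= expR z + expR (- z) - 2.
Proof.
wlog z0 : z / 0 <= z => [H|].
  have [|/ltW z0] := leP 0 z; first exact: H.
  by have := H (- z); rewrite sqrrN opprK oppr_ge0 => /(_ z0); rewrite (addrC (expR _)).
have sq (y : R) : 0 <= 1 + y / 2 -> (1 + y / 2) ^+ 2 <= expR y.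
  move=> y0; have -> : y = y / 2 + y / 2 by field.
  rewrite expRD -expr2 [in leLHS](_ : (y / 2 + y / 2) / 2 = y / 2); last by field.
  by rewrite lerXn2r ?nnegrE ?expR_ge0// expR_ge1Dx.
have h1 := sq z; have h2 := sq (- z); have h3 := expR_gt0 (- z).
have {}h1 : 1 + z + z ^+ 2 / 4 <= expR z.
  have -> : 1 + z + z ^+ 2 / 4 = (1 + z / 2) ^+ 2 by field.
  by apply: h1; lra.
have [z2|z2] := leP z 2; last by move: (expR z) (expR (- z)) (z ^+ 2) h1 h3 => A B D; lra.
have {}h2 : 1 - z + z ^+ 2 / 4 <= expR (- z).
  have -> : 1 - z + z ^+ 2 / 4 = (1 + - z / 2) ^+ 2 by field.
  by apply: h2; lra.
have z20 : 0 <= z ^+ 2 by exact: sqr_ge0.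
move: (expR z) (expR (- z)) (z ^+ 2) h1 h2 h3 z20 => A B D; lra.
Qed.

Lemma pi2_le : (pi : R) ^+ 2 <= 1024 / 100.
Proof.
have := pi_lt R; have := pi_gt0 R; move: (pi : R) => p p0 p1.
have : p * p <= 16 / 5 * (16 / 5) by rewrite ler_pM// ltW.
rewrite expr2; lra.
Qed.

Lemma pi2_ge : 973 / 100 <= (pi : R) ^+ 2.
Proof.
have := pi_gt R; move: (pi : R) => p p1.
have : 78 / 25 * (78 / 25) <= p * p by rewrite ler_pM// ?ltW//; lra.
rewrite expr2; lra.
Qed.

Lemma ch_ge z : 1 - 128 / 25 * (expR z + expR (- z) - 2) <= ch z.
Proof.
have := cos_ge2 (pi / 2 * z); rewrite -/(ch z); apply: le_trans.
rewrite exprMn.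
have := sq_le_exp z; have := pi2_le; have : 0 <= z ^+ 2 by exact: sqr_ge0.
have -> : (pi / 2 : R) ^+ 2 = pi ^+ 2 / 4 by field.
move: (z ^+ 2) (pi ^+ 2 : R) (expR z + _) => Z P E Z0 P1 h.
have : P * Z <= 1024 / 100 * Z by rewrite ler_wpM2r.
lra.
Qed.

Lemma mch_le1 : `|mch s| <= 1.
Proof.
have := G1_le s0 0 (@ch_meas R) (@ch_le1 R).
by rewrite G1_ch// /ch mulr0 cos0 mulr1.
Qed.

Lemma mch_ge : 998 / 1000 <= mch s.
Proof.
have ip : (@leb R).-integrable setT (EFin \o phi) by exact: bint_int (phi_bint s0).
have i1 := phi_exp_int s0 1; have i2 := phi_exp_int s0 (- 1).
pose F z := (1 + 256 / 25) * phi z + - (128 / 25) * (phi z * expR (1 * z) + phi z * expR (-1 * z)).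
have i3 := integrableD measurableT i1 i2.
have j1 := integrableZl measurableT (1 + 256 / 25) ip.
have j2 := integrableZl measurableT (- (128 / 25)) i3.
have iF : (@leb R).-integrable setT (EFin \o F) by exact: (integrableD measurableT j1 j2).
have IF : Rintegral (@leb R) setT F = (1 + 256 / 25) - 128 / 25 * (2 * expR (s ^+ 2 / 2)).
  rewrite /F (RintegralD measurableT j1 j2) (RintegralZl _ measurableT ip) (RintegralZl _ measurableT i3).
  rewrite (RintegralD measurableT i1 i2) !phi_exp_Rint// phi_Rint// sqrrN expr1n mul1r.
  by move: (expR _) => e; ring.
have : Rintegral (@leb R) setT F <= mch s.
  apply: le_Rintegral => //.
    by apply: bint_int; apply: bintM; [exact: phi_bint|exact: ch_meas|exists 1 => z; exact: ch_le1].
  move=> z _; rewrite -/(F z) (_ : F z = phi z * (1 - 128 / 25 * (expR z + expR (- z) - 2))); last first.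
    by rewrite /F mul1r mulN1r; ring.
  by rewrite ler_wpM2l ?phi_ge0// ch_ge.
rewrite IF; apply: le_trans.
have s20 : 0 <= s ^+ 2 by exact: sqr_ge0.
have t4 : (10 ^+ 4 : R)^-1 = 1 / 100 * (1 / 100) by rewrite !exprS expr0; field.
have s21 : s ^+ 2 / 2 <= 1 / 100 * (1 / 200) by move: (s ^+ 2) s2 s20 => S; rewrite t4; lra.
have : expR (s ^+ 2 / 2) <= 1 + 1 / 100 * (1 / 100).
  apply: le_trans (expR_le_inv _) _; first by move: (s ^+ 2 / 2) s21 => S; lra.
  have : 1 - 1 / 100 * (1 / 200) <= 1 - s ^+ 2 / 2 by move: (s ^+ 2 / 2) s21 => S; lra.
  move: (s ^+ 2 / 2) => T h; rewrite -[leLHS]mul1r ler_pdivrMr; last by lra.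
  lra.
move: (expR _) => E h; lra.
Qed.

(* The optimal Chernoff exponent for twice smoothed mass crossing the gap of
   length 55 / 1000 between [-945 / 1000, 945 / 1000] and the complement of [-1, 1]. *)
Let l := 55 / 1000 / (2 * s ^+ 2).

Lemma expR_chain (x a b : R) : 0 <= a -> a <= expR x -> b <= a * a -> b <= expR (x + x).
Proof. by move=> a0 ax ba; rewrite expRD (le_trans ba)// ler_pM. Qed.

(** Seven squarings of [1 + 59/1000 <= exp (59/1000)], with rounding; the exponent reached is
    [128 * 59/1000 = 7.552]. *)
Lemma expR_121 (w : R) : 756 / 100 <= w -> 1200 <= expR w.
Proof.
move=> w1; pose x0 : R := 59 / 1000.
have h0 : 1059 / 1000 <= expR x0 by rewrite (le_trans _ (expR_ge1Dx _))// /x0; lra.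
have h1 : 112 / 100 <= expR (x0 + x0) by apply: expR_chain h0 _; lra.
pose x1 := x0 + x0; rewrite -/x1 in h1.
have h2 : 125 / 100 <= expR (x1 + x1) by apply: expR_chain h1 _; lra.
pose x2 := x1 + x1; rewrite -/x2 in h2.
have h3 : 156 / 100 <= expR (x2 + x2) by apply: expR_chain h2 _; lra.
pose x3 := x2 + x2; rewrite -/x3 in h3.
have h4 : 243 / 100 <= expR (x3 + x3) by apply: expR_chain h3 _; lra.
pose x4 := x3 + x3; rewrite -/x4 in h4.
have h5 : 59 / 10 <= expR (x4 + x4) by apply: expR_chain h4 _; lra.
pose x5 := x4 + x4; rewrite -/x5 in h5.
have h6 : 348 / 10 <= expR (x5 + x5) by apply: expR_chain h5 _; lra.
pose x6 := x5 + x5; rewrite -/x6 in h6.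
have h7 : 1200 <= expR (x6 + x6) by apply: expR_chain h6 _; lra.
apply: le_trans h7 _; rewrite ler_expR (le_trans _ w1)// /x6 /x5 /x4 /x3 /x2 /x1 /x0; lra.
Qed.

Lemma l_ge0 : 0 <= l.
Proof. by rewrite /l; apply: divr_ge0; [lra|apply: mulr_ge0; [lra|exact: sqr_ge0]]. Qed.

Lemma tail_small x : `|x| <= 945 / 1000 -> expR (l ^+ 2 * s ^+ 2 / 2) ^+ 2 * omega l x <= 1 / 600.
Proof.
(* With this exponent the two smoothings cost a factor [exp w], and the decay across the gap is
   [exp (- 2 w)]. What remains is [2 exp (- w)], where [w] is at least [7.5625], its value at
   [s = 1/100]. *)
move=> x1; pose w : R := (55 / 1000) ^+ 2 / (4 * s ^+ 2).
have s20 : 0 < s ^+ 2 by rewrite exprn_gt0.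
have l0 := l_ge0.
have w1 : 756 / 100 <= w.
  rewrite /w ler_pdivlMr; last by apply: mulr_gt0 => //; lra.
  have t4 : (10 ^+ 4 : R)^-1 = 1 / 100 * (1 / 100) by rewrite !exprS expr0; field.
  move: (s ^+ 2) s2 => S; rewrite t4 expr2; lra.
have e2 : expR (l ^+ 2 * s ^+ 2 / 2) ^+ 2 = expR w.
  rewrite expr2 -expRD; congr expR; rewrite /w /l; field; rewrite gt_eqF//.
have lg : l * (55 / 1000) = w + w by rewrite /w /l; field; rewrite gt_eqF.
have om : omega l x <= 2 * expR (- (w + w)).
  have O y : y <= 945 / 1000 -> expR (l * (y - 1)) <= expR (- (w + w)).
    move=> y1; rewrite ler_expR -lg -mulrN ler_wpM2l//; lra.
  move: x1; rewrite ler_norml => /andP[xa xb].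
  have h1 := O x xb; have h2 : expR (l * (- x - 1)) <= expR (- (w + w)) by apply: O; lra.
  rewrite /omega; move: (expR _) (expR _) (expR _) h1 h2 => A B D; lra.
rewrite e2; apply: le_trans (ler_wpM2l (expR_ge0 _) om) _.
have -> : expR w * (2 * expR (- (w + w))) = 2 * expR (- w).
  by rewrite mulrCA -expRD; congr (_ * expR _); ring.
rewrite expRN; have := expR_121 w1; move: (expR w) => E E1.
have : E^-1 <= 1200^-1 by rewrite lef_pV2// posrE; lra.
lra.
Qed.

Lemma vt_small x : `|x| <= 945 / 1000 -> `|vt s x| <= 1 / 600.
Proof. by move=> x1; apply: le_trans (vt_le s0 x l_ge0) (tail_small x1). Qed.

Lemma vt_small_lip x y : `|x| <= 945 / 1000 -> `|y| <= 945 / 1000 ->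
  `|vt s x - vt s y| <= 4 / 375 * `|x - y|.
Proof.
move=> x1 y1; apply: le_trans (vt_lip s0 x y l_ge0) _.
have -> : pi * expR (l ^+ 2 * s ^+ 2 / 2) ^+ 2 * `|x - y| * (omega l x + omega l y) =
  pi * (expR (l ^+ 2 * s ^+ 2 / 2) ^+ 2 * omega l x + expR (l ^+ 2 * s ^+ 2 / 2) ^+ 2 * omega l y) * `|x - y| by ring.
apply: ler_wpM2r => //.
have := tail_small x1; have := tail_small y1.
have := pi_lt R; have := pi_gt0 R; move: (pi : R) (_ * omega l x) (_ * omega l y) => p A B p0 p1 hA hB.
(* Two tails of [1/600], multiplied by [pi <= 16/5], give [4/375]. *)
apply: le_trans (_ : p * (1 / 300) <= _).
  by rewrite ler_pM2l//; lra.
lra.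
Qed.

End Tail.

(** * Trigonometric bounds on the window of angles *)

Section Trig.
Variable R : realType.
Implicit Types (x y z t d : R).
Let a := (alpha R).

Lemma alpha2 : a ^+ 2 = 1 / 2.
Proof. by rewrite /a /alpha exprVn sqr_sqrtr// mul1r. Qed.

Lemma alpha_le : a <= 708 / 1000.
Proof.
have := alpha2; have := alpha_gt0 R; rewrite -/a; move: a => b b0; rewrite expr2 => b2.
have [//|h] := leP b (708 / 1000).
have : 708 / 1000 * (708 / 1000) <= b * b by apply: ler_pM; lra.
lra.
Qed.

Variable d : R.
Hypothesis d0 : 0 <= d.
Hypothesis d1 : d <= pi / 7.

Let d_le : d <= 16 / 35.
Proof. by have := pi_lt R; move: (pi : R) d1 => p h1 h2; lra. Qed.

Lemma cosd_ge : 895 / 1000 <= cos d.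
Proof.
have := cos_ge2 d; have : d ^+ 2 <= 16 / 35 * (16 / 35) by rewrite expr2; apply: ler_pM; (exact: d0 || exact: d_le).
move: (d ^+ 2) (cos d) => D C; lra.
Qed.

Lemma sind_le : sin d <= 442 / 1000.
Proof.
apply: le_trans (sin_le5 d0) _.
have h2 : d ^+ 2 <= 16 / 35 * (16 / 35) by rewrite expr2; apply: ler_pM; (exact: d0 || exact: d_le).
have -> : d - d ^+ 3 / 6 + d ^+ 5 / 120 = d * (1 - d ^+ 2 / 6 + (d ^+ 2) ^+ 2 / 120) by field.
have h3 : 0 <= d ^+ 2 by exact: sqr_ge0.
have h4 : (d ^+ 2) ^+ 2 <= 16 / 35 * (16 / 35) * d ^+ 2 by rewrite expr2 ler_wpM2r.
have h5 : d * (1 - d ^+ 2 / 6 + (d ^+ 2) ^+ 2 / 120) <= d * (1 - 164 / 1000 * d ^+ 2).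
  apply: ler_wpM2l; first exact: d0.
  move: (d ^+ 2) ((d ^+ 2) ^+ 2) h2 h3 h4 => D E; lra.
apply: le_trans h5 _.
have h6 : 0 <= 16 / 35 - d by rewrite subr_ge0; exact: d_le.
(* The cubic increases up to [16 / 35]: its difference from the value at that endpoint factors
   through [16 / 35 - d] with a positive cofactor. *)
have -> : 442 / 1000 = d * (1 - 164 / 1000 * d ^+ 2) + (16 / 35 - d) * (1 - 164 / 1000 * (d ^+ 2 + 16 / 35 * d + 16 / 35 * (16 / 35)))
  + (442 / 1000 - 16 / 35 * (1 - 164 / 1000 * (16 / 35 * (16 / 35)))) by field.
have : 0 <= (16 / 35 - d) * (1 - 164 / 1000 * (d ^+ 2 + 16 / 35 * d + 16 / 35 * (16 / 35))).
  apply: mulr_ge0; first exact: h6.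
  by move: (d ^+ 2) h2 => D; lra.
move: (_ * (1 - 164 / 1000 * d ^+ 2)) ((16 / 35 - d) * _) => A B; lra.
Qed.

Lemma sind_ge0 : 0 <= sin d.
Proof. apply: sin_ge0_pi; apply/andP; split; first exact: d0.
by have := pi_gt0 R; move: (pi : R) d1 => p h1 h2; lra. Qed.

Lemma cos_pi4 : cos (pi / 4 : R) = a.
Proof.
have c0 : 0 < cos (pi / 4 : R).
  by apply: cos_gt0_pihalf; have := pi_gt0 R; move: (pi : R) => p p0; apply/andP; split; lra.
have := cosD (pi / 4 : R) (pi / 4).
have -> : pi / 4 + pi / 4 = pi / 2 :> R by field.
have := cos2Dsin2 (pi / 4 : R); rewrite cos_pihalf -!expr2 => h1 h2.
have h3 : cos (pi / 4) ^+ 2 = a ^+ 2 by rewrite alpha2; move: (cos _ ^+ 2) (sin _ ^+ 2) h1 h2 => A B; lra.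
apply/eqP; rewrite -(@eqrXn2 _ 2)// ?ltW//; [exact/eqP|exact: (alpha_gt0 R)].
Qed.

Lemma sin_pi4 : sin (pi / 4 : R) = a.
Proof.
have := cosB (pi / 2 : R) (pi / 4); rewrite cos_pihalf sin_pihalf mul0r add0r mul1r => <-.
by rewrite (_ : pi / 2 - pi / 4 = pi / 4 :> R) ?cos_pi4//; field.
Qed.

(** The corner of the square is the worst case, and its image has coordinate [cos (pi / 4 - d)]. As
    [pi / 4 - pi / 7 = 3 pi / 28] is at least [334 / 1000], the quartic bound of the cosine applies;
    the gap [55 / 1000] of the Chernoff bound is what is left up to 1. *)
Lemma reach_le : a * (cos d + sin d) <= 945 / 1000.
Proof.
have -> : a * (cos d + sin d) = cos (pi / 4 - d) by rewrite cosB cos_pi4 sin_pi4; ring.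
have y0 : 334 / 1000 <= pi / 4 - d by have := pi_gt R; move: (pi : R) d1 => p h1 h2; lra.
have y1 : pi / 4 - d <= 8 / 10 by have := pi_lt R; move: (pi : R) d0 => p h1 h2; lra.
move: (pi / 4 - d) y0 y1 => y y0 y1.
have yp : 0 <= y by lra.
apply: le_trans (cos_le4p yp) _.
have h1 : 334 / 1000 * (334 / 1000) <= y ^+ 2 by rewrite expr2; apply: ler_pM; lra.
have h2 : y ^+ 2 <= 8 / 10 * (8 / 10) by rewrite expr2; apply: ler_pM; lra.
have -> : y ^+ 4 = y ^+ 2 * y ^+ 2 by rewrite -exprD.
move: (y ^+ 2) h1 h2 => Y h1 h2.
pose Y0 : R := 334 / 1000 * (334 / 1000).
have : 0 <= (Y - Y0) * (1 / 2 - (Y + Y0) / 24) by rewrite /Y0; apply: mulr_ge0; lra.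
rewrite /Y0; nra.
Qed.

End Trig.

Lemma pihalf_le (R : realType) : pi / 2 <= 16 / 10 :> R.
Proof. by have := pi_lt R; move: (pi : R) => p; lra. Qed.

Section Quintic.
Variables (R : realType) (q1 q3 q5 : R).

(** An odd antiderivative of an even quartic; it serves both the flux minorant and the majorant
    [quartic_tri] of the power method. *)
Definition quintic : R -> R := q1 *: id ^+ 1 + q3 *: id ^+ 3 + q5 *: id ^+ 5.
Definition quintic' (t : R) : R := q1 * (1%:R * t ^+ 0) + q3 * (3%:R * t ^+ 2) + q5 * (5%:R * t ^+ 4).

Lemma quinticE (x : R) : quintic x = q1 * x + q3 * x ^+ 3 + q5 * x ^+ 5.
Proof. by rewrite -[LHS]/(q1 * (id ^+ 1) x + q3 * (id ^+ 3) x + q5 * (id ^+ 5) x) !exprfctE. Qed.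

Lemma quintic_derive (x : R) : is_derive x 1 quintic (quintic' x).
Proof. exact: (is_deriveD (is_deriveD (is_derive_mono q1 0 x) (is_derive_mono q3 2 x)) (is_derive_mono q5 4 x)). Qed.

Lemma quintic_cont : continuous quintic'.
Proof.
have M (c m : R) n : continuous (fun t : R => c * (m * t ^+ n)).
  by move=> t; apply: cvgM; [exact: cvg_cst|apply: cvgM; [exact: cvg_cst|exact: exprn_continuous]].
by move=> x; apply: cvgD; [apply: cvgD|]; exact: M.
Qed.

End Quintic.

Lemma err_sum4 (R : realType) (A B D E F G : R) :
  A <= 16 / 10 * (2 * F) * (1 / 600) -> B <= 1 * (4 / 375 * (2 * G)) -> D <= 4 / 375 * (2 * F) * 1 ->
  E <= 1 / 600 * (16 / 10 * (2 * G)) -> A + B + D + E <= (16 / 6000 + 4 / 375) * 2 * (F + G).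
Proof. by move=> *; lra. Qed.

Lemma err_sum (R : realType) (A B D E F G : R) :
  A <= 1 * ((16 / 6000 + 4 / 375) * 2 * (F + G)) -> B <= D + E ->
  D <= 4 / 375 * (2 * F) * (1 / 600) -> E <= 1 / 600 * (4 / 375 * (2 * G)) ->
  0 <= F -> 0 <= G -> A + B <= 27 / 1000 * (F + G).
Proof. by move=> *; lra. Qed.

Lemma amgm_arith (R : realType) (X Y Z : R) : 0 <= X + Y - 2 * Z -> X + Z <= 3 / 2 * X + Y / 2.
Proof. by move=> ?; lra. Qed.

Lemma density_arith (R : realType) (X Y Z U V : R) : X <= Y -> Z <= 27 / 1000 * U -> U <= V ->
  2 * X - 54 / 1000 * V <= 2 * Y - 2 * Z.
Proof. by move=> *; lra. Qed.

(** The cosine contributes at least [0.0707 S] and the tail takes away at most [0.0383 S]; the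
    difference exceeds [S / 40]. *)
Lemma flux_arith (R : realType) (h p C S a : R) : 992 / 1000 <= h -> 973 / 800 <= p ->
  895 / 1000 <= C -> 0 <= S -> a <= 708 / 1000 ->
  S / 40 <= h * (p * (C * S)) * (664 / 10000) - a * (54 / 1000 * S).
Proof.
move=> h1 p1 C1 S1 a1.
have pC : 121 / 100 * (89 / 100) <= p * C by apply: ler_pM; lra.
have hpC : 99 / 100 * (121 / 100 * (89 / 100)) <= h * (p * C) by apply: ler_pM; [lra|lra|lra|exact: pC].
have -> : h * (p * (C * S)) * (664 / 10000) - a * (54 / 1000 * S) =
  S * (h * (p * C) * (664 / 10000) - a * (54 / 1000)) by ring.
have -> : S / 40 = S * (1 / 40) by rewrite mul1r.
apply: ler_wpM2l; first exact: S1.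
move: (h * _) hpC => X hX; lra.
Qed.

(** * Two-sided bounds on the flux of an even profile *)

Section FluxEven.
Variables (R : realType) (k dk : R -> R) (a : R).
Hypothesis a0 : 0 < a.
Hypothesis al : a <= 708 / 1000.
Hypothesis k_even : forall x, k (- x) = k x.
Hypothesis hdk : forall x : R, is_derive x 1 k (dk x).
Hypothesis k_le1 : forall x, `|k x| <= 1.
Implicit Types (x y z t d : R).

Definition qf d t := k (cos d * a + sin d * t) * k (cos d * t - sin d * a)
            - k (cos d * a - sin d * t) * k (cos d * t + sin d * a).

Lemma fluxE d : flux k a d = Rintegral (@leb R) setT (fun t => ind a t * (2 * t * qf d t)).
Proof.
congr Rintegral; apply/funext => t.
by have := fdens_even a d t k_even; rewrite /fdens => ->.
Qed.

Lemma qf_int d : (@leb R).-integrable setT (EFin \o (fun t => ind a t * (2 * t * qf d t))).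
Proof.
have := flux_integrable a0 hdk k_le1 d.
congr (integrable _ _ (EFin \o _)); apply/funext => t.
by have := fdens_even a d t k_even; rewrite /fdens => ->.
Qed.

Hypothesis k_lip : forall x y, `|k x - k y| <= pi / 2 * `|x - y|.

(** The arguments compared in [qf] are at distance at most [2 a sin d], so the Lipschitz bound
    yields a factor [sin d]. The estimate keeps a gradient step from overshooting. *)
Lemma flux_upper d : 0 <= sin d -> `|flux k a d| <= 10 * sin d.
Proof.
move=> sd; rewrite fluxE.
apply: le_trans (ind_int_norm (B := 2 * (708 / 1000) * (64 / 10 * (708 / 1000) * sin d)) a0 _ (qf_int d)) _.
  move=> t ta; have t7 : `|t| <= 708 / 1000 by exact: le_trans al.
  rewrite normrM; apply: ler_pM; [exact: normr_ge0|exact: normr_ge0| |].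
    by rewrite normrM (@ger0_norm _ 2); [apply: ler_wpM2l; [lra|exact: t7]|lra].
  rewrite /qf.
  set x1 := _ + _ * t; set x2 := _ - _ * a; set y1 := _ - _ * t; set y2 := _ + _ * a.
  have -> : k x1 * k x2 - k y1 * k y2 = k x1 * (k x2 - k y2) + (k x1 - k y1) * k y2 by ring.
  have L x y (B : R) : `|x - y| <= B -> `|k x - k y| <= 16 / 10 * B.
    move=> xy; apply: le_trans (k_lip x y) _; apply: ler_pM; [by apply: ltW; exact: pi2_gt0|exact: normr_ge0| |exact: xy].
    by have := pi_lt R; move: (pi : R) => p; lra.
  have h1 : `|k x2 - k y2| <= 16 / 10 * (2 * (sin d * (708 / 1000))).
    apply: L; have -> : x2 - y2 = - (2 * (sin d * a)) by rewrite /x2 /y2; ring.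
    rewrite normrN ger0_norm; last by apply: mulr_ge0; [lra|exact: mulr_ge0 sd (ltW a0)].
    by apply: ler_wpM2l; [lra|apply: ler_wpM2l; [exact: sd|exact: al]].
  have h2 : `|k x1 - k y1| <= 16 / 10 * (2 * (sin d * (708 / 1000))).
    apply: L; have -> : x1 - y1 = 2 * (sin d * t) by rewrite /x1 /y1; ring.
    rewrite !normrM (@ger0_norm _ 2); last by lra.
    by rewrite (ger0_norm sd); apply: ler_wpM2l; [lra|apply: ler_wpM2l; [exact: sd|exact: t7]].
  apply: le_trans (ler_normD _ _) _; rewrite !normrM.
  have h3 : `|k x1| * `|k x2 - k y2| <= 1 * (16 / 10 * (2 * (sin d * (708 / 1000)))).
    by apply: ler_pM; [exact: normr_ge0|exact: normr_ge0|exact: k_le1|exact: h1].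
  have h4 : `|k x1 - k y1| * `|k y2| <= 16 / 10 * (2 * (sin d * (708 / 1000))) * 1.
    by apply: ler_pM; [exact: normr_ge0|exact: normr_ge0|exact: h2|exact: k_le1].
  move: (`|k x1| * _) (_ * `|k y2|) h3 h4 sd => A B h3 h4 sd; lra.
have : 2 * a * (2 * (708 / 1000) * (64 / 10 * (708 / 1000) * sin d)) <=
  2 * (708 / 1000) * (2 * (708 / 1000) * (64 / 10 * (708 / 1000) * sin d)).
  apply: ler_wpM2r; last by apply: ler_wpM2l; [lra|exact: al].
  by apply: mulr_ge0; [lra|apply: mulr_ge0; [lra|exact: sd]].
move/le_trans; apply; move: (sin d) sd => S S0; lra.
Qed.

Variables (v : R -> R) (H d : R).
Hypothesis a2 : a ^+ 2 = 1 / 2.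
Hypothesis kE : forall x, k x = H * ch x + v x.
Hypothesis H0 : 996 / 1000 <= H.
Hypothesis H1 : H <= 1.
Hypothesis v_small : forall x, `|x| <= 945 / 1000 -> `|v x| <= 1 / 600.
Hypothesis v_lip : forall x y, `|x| <= 945 / 1000 -> `|y| <= 945 / 1000 -> `|v x - v y| <= 4 / 375 * `|x - y|.
Hypothesis C0 : 895 / 1000 <= cos d.
Hypothesis S0 : 0 <= sin d.
Hypothesis S1 : sin d <= 442 / 1000.
Hypothesis reach : a * (cos d + sin d) <= 945 / 1000.

Let M := pi / 2 * cos d * a.
Let N := pi / 2 * sin d * a.

Lemma Wf_odd (m n t : R) : Wf m n (- t) = - Wf m n t.
Proof. by rewrite /Wf opprK; ring. Qed.

Lemma Wf_profile (u : R) : ch (cos d * a - sin d * (a * u)) * ch (cos d * (a * u) + sin d * a)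
   - ch (cos d * a + sin d * (a * u)) * ch (cos d * (a * u) - sin d * a) = Wf M N u.
Proof.
rewrite /ch.
have -> : pi / 2 * (cos d * a - sin d * (a * u)) = M - N * u by rewrite /M /N; ring.
have -> : pi / 2 * (cos d * (a * u) + sin d * a) = M * u + N by rewrite /M /N; ring.
have -> : pi / 2 * (cos d * a + sin d * (a * u)) = M + N * u by rewrite /M /N; ring.
have -> : pi / 2 * (cos d * (a * u) - sin d * a) = M * u - N by rewrite /M /N; ring.
rewrite /Wf !mulrDr !mulr1 !mulrN; move: M N (M * u) (N * u) => m n p q.
by rewrite !cosB !cosD !sinB !sinD; ring.
Qed.

Let P := N * M.

Let PE : P = pi ^+ 2 / 8 * (cos d * sin d).
Proof.
have -> : P = pi ^+ 2 / 4 * (cos d * sin d) * a ^+ 2 by rewrite /P /M /N; field.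
by rewrite a2; field.
Qed.

Let M0 : 0 <= M.
Proof. by rewrite /M; apply: mulr_ge0 (ltW a0); apply: mulr_ge0; [exact: ltW (pi2_gt0 R)|have := C0; lra]. Qed.

Let N0 : 0 <= N.
Proof. by rewrite /N; apply: mulr_ge0 (ltW a0); apply: mulr_ge0; [exact: ltW (pi2_gt0 R)|exact: S0]. Qed.

Let M2E : M ^+ 2 = pi ^+ 2 / 8 * cos d ^+ 2.
Proof.
have -> : M ^+ 2 = pi ^+ 2 / 4 * cos d ^+ 2 * a ^+ 2 by rewrite /M; field.
by rewrite a2; field.
Qed.

Let N2E : N ^+ 2 = pi ^+ 2 / 8 * sin d ^+ 2.
Proof.
have -> : N ^+ 2 = pi ^+ 2 / 4 * sin d ^+ 2 * a ^+ 2 by rewrite /N; field.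
by rewrite a2; field.
Qed.

Let S2 : sin d ^+ 2 <= 442 / 1000 * (442 / 1000).
Proof. by rewrite expr2; apply: ler_pM; (exact: S0 || exact: S1). Qed.

Lemma Wf_bound (u : R) : `|u| <= 1 ->
  P * ((1 - u ^+ 2) * (259 / 1000 * u ^+ 2 - 2 / 1000)) <= u * Wf M N u.
Proof.
have p2 : pi ^+ 2 / 8 <= 128 / 100 :> R by have := pi2_le R; move: (pi ^+ 2 : R) => p; lra.
have p3 : 973 / 800 <= pi ^+ 2 / 8 :> R by have := pi2_ge R; move: (pi ^+ 2 : R) => p; lra.
have cs : cos d ^+ 2 = 1 - sin d ^+ 2 by rewrite -(cos2Dsin2 d) addrK.
have S20 : 0 <= sin d ^+ 2 by exact: sqr_ge0.
have hM : M ^+ 2 <= 128 / 100.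
  rewrite M2E cs; move: (pi ^+ 2 / 8) (sin d ^+ 2) p2 p3 S20 S2 => p S ? ? ? ?; nra.
have hN : N ^+ 2 <= 27 / 100.
  rewrite N2E; move: (pi ^+ 2 / 8) (sin d ^+ 2) p2 p3 S20 S2 => p S ? ? ? ?; nra.
(* The difference is [pi^2 / 8] times [1 - 2 sin^2 d]; with [sin d <= 442/1000] this stays just
   above [74/100]. *)
have hMN : 74 / 100 <= M ^+ 2 - N ^+ 2.
  rewrite M2E N2E cs; move: (pi ^+ 2 / 8) (sin d ^+ 2) p2 p3 S20 S2 => p S ? ? ? ?; nra.
move=> u1; have [u0|u0] := leP 0 u.
  by rewrite (ger0_norm u0) in u1; have := @Wf_lower _ M N u u0 u1 N0 M0 hM hN hMN.
rewrite (ltr0_norm u0) in u1.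
have := @Wf_lower _ M N (- u) (ltW (etrans (oppr_gt0 u) u0)) u1 N0 M0 hM hN hMN.
by rewrite sqrrN Wf_odd mulrNN.
Qed.

(** The error terms are telescoped so that each contains a difference of [ch] or [v] between points
    at distance [2 sin d |t|] or [2 sin d a]. Every term then carries the factor [sin d], which a
    plain size bound on [v] would not give. *)
Let Err t := (H * ((ch (cos d * a + sin d * t) - ch (cos d * a - sin d * t)) * v (cos d * t - sin d * a)
  + ch (cos d * a - sin d * t) * (v (cos d * t - sin d * a) - v (cos d * t + sin d * a))
  + (v (cos d * a + sin d * t) - v (cos d * a - sin d * t)) * ch (cos d * t - sin d * a)
  + v (cos d * a - sin d * t) * (ch (cos d * t - sin d * a) - ch (cos d * t + sin d * a)))
  + ((v (cos d * a + sin d * t) - v (cos d * a - sin d * t)) * v (cos d * t - sin d * a)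
  + v (cos d * a - sin d * t) * (v (cos d * t - sin d * a) - v (cos d * t + sin d * a)))).

Let qfE (u : R) : qf d (a * u) = - (H ^+ 2 * Wf M N u) + Err (a * u).
Proof.
rewrite -Wf_profile /qf /Err !kE.
set x1 := cos d * a + sin d * (a * u); set x2 := _ - _ * a; set y1 := _ - _ * (a * u); set y2 := _ + _ * a.
move: (ch x1) (ch x2) (ch y1) (ch y2) (v x1) (v x2) (v y1) (v y2) => *; ring.
Qed.

Let Err_le t : `|t| <= a -> `|Err t| <= 27 / 1000 * (sin d * (`|t| + a)).
Proof.
have Hn : `|H| <= 1 by rewrite ger0_norm; [exact: H1|have h := H0; lra].
have c0 := C0; move=> ta; have Cp : 0 <= cos d by lra.
have St : sin d * `|t| <= sin d * a by apply: ler_wpM2l.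
have Ct : cos d * `|t| <= cos d * a by apply: ler_wpM2l.
have nS : `|sin d * t| = sin d * `|t| by rewrite normrM (ger0_norm S0).
have nSa : `|sin d * a| = sin d * a by rewrite normrM (ger0_norm S0) gtr0_norm.
have nC : `|cos d * t| = cos d * `|t| by rewrite normrM (ger0_norm Cp).
have nCa : `|cos d * a| = cos d * a by rewrite normrM (ger0_norm Cp) gtr0_norm.
have r' : cos d * a + sin d * a <= 945 / 1000 by move: reach; rewrite mulrDr !(mulrC a).
have r1 : `|cos d * a + sin d * t| <= 945 / 1000.
  by apply: le_trans (ler_normD _ _) _; rewrite nS nCa; apply: le_trans r'; rewrite lerD2l.
have r2 : `|cos d * t - sin d * a| <= 945 / 1000.
  by apply: le_trans (ler_normB _ _) _; rewrite nC nSa; apply: le_trans r'; rewrite lerD2r.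
have r3 : `|cos d * a - sin d * t| <= 945 / 1000.
  by apply: le_trans (ler_normB _ _) _; rewrite nS nCa; apply: le_trans r'; rewrite lerD2l.
have r4 : `|cos d * t + sin d * a| <= 945 / 1000.
  by apply: le_trans (ler_normD _ _) _; rewrite nC nSa; apply: le_trans r'; rewrite lerD2r.
have N2 (y : R) : `|2 * y| = 2 * `|y| by rewrite normrM ger0_norm.
have d1 : `|cos d * a + sin d * t - (cos d * a - sin d * t)| = 2 * (sin d * `|t|).
  rewrite (_ : _ - _ = 2 * (sin d * t)); last by ring.
  by rewrite N2 nS.
have d2 : `|cos d * t - sin d * a - (cos d * t + sin d * a)| = 2 * (sin d * a).
  rewrite (_ : _ - _ = - (2 * (sin d * a))); last by ring.
  by rewrite normrN N2 nSa.
rewrite /Err; move: r1 r2 r3 r4 d1 d2.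
set x1 := cos d * a + sin d * t; set x2 := _ - _ * a; set y1 := _ - _ * t; set y2 := _ + _ * a.
move=> r1 r2 r3 r4 d1 d2.
have cl x y : `|ch x - ch y| <= 16 / 10 * `|x - y|.
  apply: le_trans (ch_lip x y) _; apply: ler_wpM2r; first exact: normr_ge0.
  exact: pihalf_le.
have PM (p q A B : R) : `|p| <= A -> `|q| <= B -> `|p * q| <= A * B.
  by move=> pA qB; rewrite normrM; apply: ler_pM; (exact: normr_ge0 || done).
have t1 := PM _ _ _ _ (le_trans (cl x1 y1) (lexx _)) (v_small r2).
have t2 := PM _ _ _ _ (ch_le1 y1) (v_lip r2 r4).
have t3 := PM _ _ _ _ (v_lip r1 r3) (ch_le1 x2).
have t4 := PM _ _ _ _ (v_small r3) (cl x2 y2).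
have t5 := PM _ _ _ _ (v_lip r1 r3) (v_small r2).
have t6 := PM _ _ _ _ (v_small r3) (v_lip r2 r4).
rewrite d1 in t1 t3 t5; rewrite d2 in t2 t4 t6.
apply: le_trans (ler_normD _ _) _; rewrite normrM.
have h1 : forall A B D E : R, `|A + B + D + E| <= `|A| + `|B| + `|D| + `|E|.
  move=> A B D E; apply: le_trans (ler_normD _ _) _; apply: lerD => //.
  apply: le_trans (ler_normD _ _) _; apply: lerD => //; exact: ler_normD.
set Q := _ + _ + _ + _.
have hQ : `|Q| <= (16 / 6000 + 4 / 375) * 2 * (sin d * `|t| + sin d * a).
  apply: le_trans (h1 _ _ _ _) _.
  exact: err_sum4.
have hH : `|H| * `|Q| <= 1 * ((16 / 6000 + 4 / 375) * 2 * (sin d * `|t| + sin d * a)).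
  by apply: ler_pM; (exact: normr_ge0 || done).
have h5 := ler_normD ((v x1 - v y1) * v x2) (v y1 * (v x2 - v y2)).
have s1 : 0 <= sin d * `|t| by apply: mulr_ge0.
have s2 : 0 <= sin d * a by apply: mulr_ge0 => //; exact: ltW.
by rewrite (mulrDr (sin d)); exact: (err_sum hH h5 t5 t6 s1 s2).
Qed.

Lemma flux_lower : sin d / 40 <= - flux k a d.
Proof.
have H2 : 992 / 1000 <= H ^+ 2.
  have h0 := H0; apply: (@le_trans _ _ (996 / 1000 * (996 / 1000))); first by lra.
  by rewrite expr2; apply: ler_pM; lra.
have p3 : 973 / 800 <= pi ^+ 2 / 8 :> R by have := pi2_ge R; move: (pi ^+ 2 : R) => p; lra.
have c0 := C0; have sp := S0; have ap := a0; have al' := al.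
(* [F'] is the cosine bound [A (1 - u^2) (a' u^2 - b)] at [u = t / a], minus the error
   [D (3/2 t^2 + a^2 / 2)]. The coefficients of its antiderivative use [a^2 = 1/2]. *)
pose A := 2 * a * (H ^+ 2 * P); pose D := 54 / 1000 * sin d.
pose a' : R := 259 / 1000; pose b : R := 2 / 1000.
pose q1 := - (A * b) - D / 4; pose q3 := A * (a' + b) * (2 / 3) - D / 2; pose q5 := - (A * (4 / 5) * a').
pose F := quintic q1 q3 q5; pose F' := quintic' q1 q3 q5.
have dF (x : R) : is_derive x 1 F (F' x).
  exact: quintic_derive.
have cF : continuous F'.
  exact: quintic_cont.
have e : (fun t => ind a t * - (2 * t * qf d t)) = (fun t => -1 * (ind a t * (2 * t * qf d t))).
  by apply/funext => t; ring.
have ih : (@leb R).-integrable setT (EFin \o (fun t => ind a t * - (2 * t * qf d t))).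
  by rewrite e; exact: (integrableZl measurableT _ (qf_int d)).
have HP : 0 <= H ^+ 2 * P by apply: mulr_ge0; [exact: sqr_ge0|exact: mulr_ge0].
have Fle t : `|t| <= a -> F' t <= - (2 * t * qf d t).
  move=> ta; pose u := t / a; have tE : t = a * u by rewrite /u mulrC divfK// gt_eqF.
  have u1 : `|u| <= 1 by rewrite /u normrM normfV (gtr0_norm a0) ler_pdivrMr// mul1r.
  clearbody u.
  have w1 := ler_wpM2l (mulr_ge0 (ltW a0) (sqr_ge0 H)) (Wf_bound u1).
  have h2 := Err_le ta.
  have h3 : `|t * Err t| <= `|t| * (27 / 1000 * (sin d * (`|t| + a))).
    by rewrite normrM; apply: ler_wpM2l.
  have h4 : t * Err t <= `|t| * (27 / 1000 * (sin d * (`|t| + a))).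
    by apply: le_trans h3; exact: ler_norm.
  (* Trades [|t| a] for squares, so that the minorant of the density becomes a polynomial. *)
  have h5 : `|t| * (`|t| + a) <= 3 / 2 * t ^+ 2 + a ^+ 2 / 2.
    have : 0 <= (`|t| - a) ^+ 2 by exact: sqr_ge0.
    have -> : (`|t| - a) ^+ 2 = t ^+ 2 + a ^+ 2 - 2 * (`|t| * a) by rewrite -(real_normK (num_real t)); ring.
    have -> : `|t| * (`|t| + a) = t ^+ 2 + `|t| * a by rewrite -(real_normK (num_real t)); ring.
    exact: amgm_arith.
  have h6 := ler_wpM2l S0 h5.
  have -> : - (2 * t * qf d t) = 2 * (a * H ^+ 2 * (u * Wf M N u)) - 2 * (t * Err t).
    by rewrite {1 2}tE qfE -tE {1 3}tE; ring.
  have -> : F' t = 2 * (a * H ^+ 2 * (P * ((1 - u ^+ 2) * (a' * u ^+ 2 - b)))) - D * (3 / 2 * t ^+ 2 + a ^+ 2 / 2).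
    have -> : u ^+ 2 = 2 * t ^+ 2 by rewrite tE exprMn a2; field.
    by rewrite a2 /F' /quintic' /q1 /q3 /q5 /A; field.
  rewrite /D; rewrite a2 in h6 *.
  have h7 : `|t| * (27 / 1000 * (sin d * (`|t| + a))) = 27 / 1000 * (sin d * (`|t| * (`|t| + a))) by ring.
  rewrite h7 in h4.
  have h8 : 54 / 1000 * sin d * (3 / 2 * t ^+ 2 + 1 / 2 / 2) = 54 / 1000 * (sin d * (3 / 2 * t ^+ 2 + 1 / 2 / 2)) by ring.
  rewrite h8; move: w1 h4 h6; rewrite -/a' -/b.
  exact: density_arith.
have := ind_int_ge a0 dF cF Fle ih.
rewrite fluxE e (RintegralZl _ measurableT (qf_int d)) mulN1r; apply: le_trans.
(* [664/10000] is the integral of [(1 - u^2) (a' u^2 - b)] over [-1, 1]; the prefactor [2 a^2]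
   equals 1. *)
have -> : F a - F (- a) = H ^+ 2 * P * (664 / 10000) - a * D.
  have FE x : F x = q1 * x + q3 * x ^+ 3 + q5 * x ^+ 5 by exact: quinticE.
  have a3 : a ^+ 3 = a / 2 by rewrite exprS a2; field.
  have a5 : a ^+ 5 = a / 4 by rewrite (exprD a 2 3) a3 a2; field.
  have aN3 : (- a) ^+ 3 = - (a / 2) by rewrite exprNn a3 -signr_odd/= expr1 mulN1r.
  have aN5 : (- a) ^+ 5 = - (a / 4) by rewrite exprNn a5 -signr_odd/= expr1 mulN1r.
  rewrite !FE a3 a5 aN3 aN5 /q1 /q3 /q5 /A /a' /b.
  have -> : H ^+ 2 * P * (664 / 10000) = 2 * a ^+ 2 * (H ^+ 2 * P * (664 / 10000)) by rewrite a2; field.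
  by field.
rewrite /D PE; clear Fle ih e cF dF F F' A D q1 q3 q5 a' b HP.
exact: flux_arith.
Qed.

End FluxEven.

Section MainFlux.
Variables (R : realType) (s : R).
Hypothesis s0 : 0 < s.
Hypothesis s2 : s ^+ 2 <= (10 ^+ 4)^-1.
Implicit Types (x y z t d : R).
Let a := (alpha R).
Let k := kk s (@e1 R).
Let H := mch s ^+ 2.

Lemma e1_bint : bint (@leb R) (@e1 R).
Proof. by apply: bintM; [exact: ind_bint|exact: ch_meas|exists 1 => x; exact: ch_le1]. Qed.

Lemma kk_deriv (u : R -> R) : bint (@leb R) u ->
  exists dk : R -> R, forall x : R, is_derive x 1 (kk s u) (dk x).
Proof. by move=> bu; have [dk [h _ _]] := sm1_C1 s0 (sm1_bint s0 bu); exists dk. Qed.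

Lemma kk_le (u : R -> R) (B : R) : bint (@leb R) u -> (forall x, `|u x| <= B) -> forall x, `|kk s u x| <= B.
Proof.
move=> bu uB x; have m1 := bint_mf (sm1_bint s0 bu).
rewrite /kk sm1_G1//; apply: (G1_le s0) => // y.
rewrite sm1_G1; [exact: (G1_le s0 _ (bint_mf bu) uB)|exact: (bint_mf bu)].
Qed.

Lemma k_even x : k (- x) = k x.
Proof.
have mt := @tail_meas R.
have te (y : R) : tail (- y) = tail y by rewrite /tail e1N chN.
have mG := G1_meas s0 (@tail_le1 R) (@tail_lip1 R).
have vN : vt s (- x) = vt s x.
  by rewrite /vt; apply: (G1_even s0) => // y; apply: (G1_even s0).
by rewrite /k (kk_e1 s0 (- x)) (kk_e1 s0 x) chN vN.
Qed.

Lemma k_lip x y : `|k x - k y| <= pi / 2 * `|x - y|.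
Proof.
rewrite /k /kk !sm1_G1; try exact: (bint_mf (sm1_bint s0 e1_bint)).
have -> : sm1 s (@e1 R) = G1 s (@e1 R) by apply/funext => z; rewrite sm1_G1//; exact: e1_meas.
apply: (G1_lip1 s0) => [z|z w].
  by apply: (G1_le s0); [exact: e1_meas|exact: e1_le1].
by apply: (G1_lip1 s0); [exact: e1_le1|exact: e1_lip].
Qed.

Lemma k_le1 x : `|k x| <= 1.
Proof. by apply: kk_le; [exact: e1_bint|exact: e1_le1]. Qed.

End MainFlux.

(** * Flux of the perturbed profile *)

Section RoughFlux.
Variables (R : realType) (s : R).
Hypothesis s0 : 0 < s.
Implicit Types (u f g : R -> R) (x d : R).

Lemma sm1D f g : bint (@leb R) f -> bint (@leb R) g -> sm1 s (fun x => f x + g x) = (fun x => sm1 s f x + sm1 s g x).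
Proof.
move=> bf bg; have [[_ [M fM]] [_ [N gN]]] := (bf, bg); apply/funext => x.
rewrite (sm1_G1 s x (bint_mf bf)) (sm1_G1 s x (bint_mf bg)) (sm1_G1 s x (bint_mf (bintD bf bg))).
apply: (G1D s0 x (bint_mf bf) (bint_mf bg) fM gN).
Qed.

Lemma sm1Z (c : R) f : bint (@leb R) f -> sm1 s (fun x => c * f x) = (fun x => c * sm1 s f x).
Proof.
move=> bf; have [_ [M fM]] := bf; apply/funext => x.
rewrite (sm1_G1 s x (bint_mf bf)) (sm1_G1 s x (bint_mf (bintZ c bf))).
exact: (G1Z s0 c x (bint_mf bf) fM).
Qed.

Lemma kkD f g x : bint (@leb R) f -> bint (@leb R) g -> kk s (fun x => f x + g x) x = kk s f x + kk s g x.
Proof. by move=> bf bg; rewrite /kk sm1D// sm1D//; exact: sm1_bint. Qed.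

Lemma kkZ (c : R) f x : bint (@leb R) f -> kk s (fun x => c * f x) x = c * kk s f x.
Proof. by move=> bf; rewrite /kk sm1Z// sm1Z//; exact: sm1_bint. Qed.

Lemma fluxZ (c C a d : R) (k dk : R -> R) : 0 < a -> (forall x : R, is_derive x 1 k (dk x)) ->
  (forall x, `|k x| <= C) -> flux (fun x => c * k x) a d = c ^+ 2 * flux k a d.
Proof.
move=> a0 dk1 kC; have i1 := flux_integrable a0 dk1 kC d.
rewrite /flux -(RintegralZl _ measurableT i1); congr Rintegral; apply/funext => t.
by rewrite /Mrot; ring.
Qed.

(** The flux is quadratic in the profile, hence [c ^+ 2], and [2 a^2 = 1] turns the bound of
    [flux_near] into [12 * tol]. This error does not vanish with the angle and fixes the accuracy
    that the descent can reach. *)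
Lemma flux_rough (c tol d : R) (rho : R -> R) : bint (@leb R) rho -> (forall x, `|rho x| <= tol) -> tol <= 1 ->
  `|flux (kk s (fun x => c * (e1 x + rho x))) (alpha R) d - c ^+ 2 * flux (kk s (@e1 R)) (alpha R) d|
    <= c ^+ 2 * (12 * tol).
Proof.
move=> br rt t1; have be := @e1_bint R; have bs := bintD be br.
have [dk1 h1] := kk_deriv s0 be; have [dk2 h2] := kk_deriv s0 bs.
have b1 : forall x, `|kk s (@e1 R) x| <= 1 := k_le1 s0.
have b2 x : `|kk s (fun x => e1 x + rho x) x| <= 2.
  apply: (kk_le s0 bs) => y; rewrite (le_trans (ler_normD _ _))//.
  by have := e1_le1 y; have := rt y; move: t1; move: (`|rho y|) (`|e1 y|) => A B; lra.
have -> : kk s (fun x => c * (e1 x + rho x)) = (fun x => c * kk s (fun x => e1 x + rho x) x).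
  by apply/funext => x; rewrite kkZ.
have a0 := alpha_gt0 R.
rewrite (fluxZ c d a0 h2 b2) -mulrBr normrM (ger0_norm (sqr_ge0 c)).
apply: ler_wpM2l; first exact: sqr_ge0.
have near x : `|kk s (fun x => e1 x + rho x) x - kk s (@e1 R) x| <= tol.
  by rewrite kkD// addrAC subrr add0r; exact: (kk_le s0 br rt).
apply: le_trans (flux_near d a0 h1 h2 b1 b2 near t1) _.
have -> : 2 * alpha R * (alpha R * (12 * tol)) = 2 * alpha R ^+ 2 * (12 * tol) by ring.
by rewrite alpha2; lra.
Qed.

Hypothesis s2 : s ^+ 2 <= (10 ^+ 4)^-1.

Lemma flux_e1_odd d : flux (kk s (@e1 R)) (alpha R) (- d) = - flux (kk s (@e1 R)) (alpha R) d.
Proof.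
have [dk1 h1] := kk_deriv s0 (@e1_bint R).
exact: (flux_odd d (alpha_gt0 R) h1 (k_le1 s0) (k_even s0)).
Qed.

Lemma flux_e1_bounds d : 0 <= d -> d <= pi / 7 ->
  sin d / 40 <= - flux (kk s (@e1 R)) (alpha R) d /\ - flux (kk s (@e1 R)) (alpha R) d <= 10 * sin d.
Proof.
move=> d0 d1; have [dk1 h1] := kk_deriv s0 (@e1_bint R).
have sd := sind_ge0 d0 d1.
split.
  apply: (@flux_lower R (kk s (@e1 R)) dk1 (alpha R) (alpha_gt0 R) (alpha_le R) (k_even s0) h1 (k_le1 s0) (vt s) (mch s ^+ 2) d).
  - exact: alpha2.
  - by move=> x; exact: kk_e1.
  - have := mch_ge s0 s2; move: (mch s) => m h; rewrite expr2.
    have : 998 / 1000 * (998 / 1000) <= m * m by apply: ler_pM; lra.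
    lra.
  - by rewrite -real_normK ?num_real// exprn_ile1// mch_le1.
  - exact: vt_small.
  - exact: vt_small_lip.
  - exact: cosd_ge.
  - exact: sd.
  - exact: sind_le.
  - exact: reach_le.
have := flux_upper (alpha_gt0 R) (alpha_le R) (k_even s0) h1 (k_le1 s0) (k_lip s0) sd.
by apply: le_trans; rewrite -normrN ler_norm.
Qed.

End RoughFlux.

(** * Inner products and compactly supported kernels *)

Section Inner.
Variable R : realType.
Implicit Types (f g h : R -> R) (a b c : R).
Local Notation bint := (bint (@leb R)).

Lemma innerC f g : inner f g = inner g f.
Proof. by congr Rintegral; apply/funext => x; rewrite mulrC. Qed.

Lemma innerDl f g h : bint f -> bint g -> bint h -> inner (fun x => f x + g x) h = inner f h + inner g h.
Proof.
move=> bf bg bh; rewrite /inner -(RintegralD measurableT (bint_int (bintMM bf bh)) (bint_int (bintMM bg bh))).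
by congr Rintegral; apply/funext => x; rewrite mulrDl.
Qed.

Lemma innerZl a f h : bint f -> bint h -> inner (fun x => a * f x) h = a * inner f h.
Proof.
move=> bf bh; rewrite /inner -(RintegralZl _ measurableT (bint_int (bintMM bf bh))).
by congr Rintegral; apply/funext => x; rewrite mulrA.
Qed.

Lemma innerDr f g h : bint f -> bint g -> bint h -> inner h (fun x => f x + g x) = inner h f + inner h g.
Proof. by move=> bf bg bh; rewrite innerC innerDl// !(innerC h). Qed.

Lemma innerZr a f h : bint f -> bint h -> inner h (fun x => a * f x) = a * inner h f.
Proof. by move=> bf bh; rewrite innerC innerZl// innerC. Qed.

Lemma inner_ge0 f : 0 <= inner f f.
Proof. by apply: Rintegral_ge0 => x _; rewrite -expr2 sqr_ge0. Qed.

Lemma discr_le (F G H : R) : 0 <= H -> (forall x : R, 0 <= F - 2 * x * G + x ^+ 2 * H) -> G ^+ 2 <= F * H.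
Proof.
move=> H0 q; have [H1|H1] := ltP 0 H.
  have := q (G / H); have -> : F - 2 * (G / H) * G + (G / H) ^+ 2 * H = F - G ^+ 2 / H.
    by field; rewrite gt_eqF.
  by rewrite subr_ge0 ler_pdivrMr.
have {}H0 : H = 0 by apply/le_anti; rewrite H0 H1.
have [->|G0] := eqVneq G 0; first by rewrite expr0n H0 mulr0.
(* Without a quadratic term the form is affine in [x]; at this point it would take the value -1. *)
have := q ((F + 1) / (2 * G)); rewrite H0 mulr0 addr0.
have -> : F - 2 * ((F + 1) / (2 * G)) * G = - 1 by field; rewrite G0.
by rewrite ler0N1.
Qed.

Lemma inner_CS f g : bint f -> bint g -> inner f g ^+ 2 <= inner f f * inner g g.
Proof.
move=> bf bg; apply: discr_le => [|x]; first exact: inner_ge0.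
have bg' := bintZ (- x) bg; have bD := bintD bf bg'.
have := inner_ge0 (fun t => f t + - x * g t).
rewrite innerDl// !innerDr// !innerZl// !innerZr// (innerC g f).
move: (inner f f) (inner f g) (inner g g) => F G H h; apply: le_trans h _.
by rewrite le_eqVlt; apply/orP; left; apply/eqP; ring.
Qed.

Lemma L2normE f : bint f -> L2norm f = Num.sqrt (inner f f).
Proof.
by move=> bf; rewrite /L2norm Lnorm2E//=; congr Num.sqrt; congr Rintegral; apply/funext => x; rewrite expr2.
Qed.

Lemma LnormE f : bint f -> Lnorm (@leb R) 2%:E (EFin \o f) = (Num.sqrt (inner f f))%:E.
Proof.
by move=> bf; rewrite Lnorm2E//=; congr (Num.sqrt _)%:E; congr Rintegral; apply/funext => x; rewrite expr2.
Qed.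

Lemma inner_parallel f g : bint f -> bint g -> 2 * `|inner f g| <= inner f f + inner g g.
Proof.
move=> bf bg.
have H (c : R) : c ^+ 2 = 1 -> 0 <= inner f f + 2 * c * inner f g + inner g g.
  move=> c1; have bg' := bintZ c bg; have bD := bintD bf bg'.
  have := inner_ge0 (fun t => f t + c * g t).
  rewrite innerDl// !innerDr// !innerZl// !innerZr// (innerC g f).
  have -> : inner f f + c * inner f g + (c * inner f g + c * (c * inner g g)) =
    inner f f + 2 * c * inner f g + c ^+ 2 * inner g g by ring.
  by rewrite c1 mul1r.
have := H 1 (expr1n _ _); have := H (-1) (etrans (sqrrN 1) (expr1n _ _)).
have [h|h] := leP 0 (inner f g).
  by rewrite (ger0_norm h); move: (inner _ _) (inner _ _) (inner _ _) => A B D; lra.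
by rewrite (ltr0_norm h); move: (inner _ _) (inner _ _) (inner _ _) => A B D; lra.
Qed.

End Inner.

(** * Integral operators with compactly supported kernels *)

Section CompactKernel.
Variables (R : realType) (K : R * R -> R).
Hypothesis mK : measurable_fun setT K.
Hypothesis KB : forall s t, `|K (s, t)| <= ind 2 s * ind 2 t.
Implicit Types (f g h : R -> R) (s t a : R).
Local Notation bint := (bint (@leb R)).
Local Notation op := (kop (@leb R) K).

Lemma ck_le1 s t : `|K (s, t)| <= 1.
Proof. by apply: le_trans (KB s t) _; rewrite -[leRHS]mul1r ler_pM ?ind_ge0 ?ind_le1. Qed.

Lemma ck_row s : measurable_fun setT (fun t => K (s, t)).
Proof. exact: (measurableT_comp mK). Qed.

Lemma ck_row_bint s : bint (fun t => K (s, t)).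
Proof.
apply: (@bint_le _ _ R (@leb R) (fun t => K (s, t)) (ind 2) (ck_row s) (ind_bint 2)) => t.
apply: le_trans (KB s t) _.
by rewrite ler_piMl ?ind_ge0 ?ind_le1.
Qed.

Lemma ck_int s f : bint f -> bint (fun t => K (s, t) * f t).
Proof. by move=> bf; exact: bintMM (ck_row_bint s) bf. Qed.

Lemma opE s f : op f s = inner (fun t => K (s, t)) f. Proof. by []. Qed.

Lemma op_joint f g : bint f -> bint g ->
  (@leb2 R).-integrable setT (EFin \o (fun z : R * R => K z * f z.2 * g z.1)).
Proof.
move=> bf bg; have bt := tens_bint bg bf; have [it _] := bint_norm bt.
apply: (dom_integrable _ it) => [|[s t]].
  apply: measurable_funM; first apply: measurable_funM => //.
    exact: (measurableT_comp (bint_mf bf)).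
  exact: (measurableT_comp (bint_mf bg)).
rewrite normr_id /tens/= -mulrA normrM (mulrC (g s)) ler_piMl// ck_le1//.
Qed.

Lemma op_le f s : bint f -> `|op f s| <= Rintegral (@leb R) setT (fun t => `|f t|).
Proof.
move=> bf; have bK := ck_int s bf.
apply: (le_trans (le_normr_Rintegral measurableT (bint_int bK))).
apply: le_Rintegral => //; [exact: bint_int (bint_norm bK)|exact: bint_int (bint_norm bf)|].
by move=> t _; rewrite normrM ler_piMl// ck_le1.
Qed.

Lemma op_out f s : ind 2 s = 0 -> op f s = 0.
Proof.
move=> s0; rewrite /kop (_ : (fun t => _) = (fun=> 0)); first by rewrite /Rintegral integral0.
apply/funext => t; have := KB s t; rewrite s0 mul0r normr_le0 => /eqP ->.
by rewrite mul0r.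
Qed.

Lemma op_fubini f g : bint f -> bint g ->
  fubini_F (@leb R) (EFin \o (fun z : R * R => K z * f z.2 * g z.1)) = (fun s : measurableTypeR R => (op f s * g s)%:E).
Proof.
move=> bf bg; apply/funext => s; rewrite /fubini_F/= mulrC EFinM.
have iK := bint_int (ck_int s bf).
rewrite /kop /Rintegral fineK; last exact: (integrable_fin_num measurableT iK).
by rewrite -(integralZl measurableT iK); apply: eq_integral => t _; rewrite -EFinM mulrC.
Qed.

Lemma op_bint f : bint f -> bint (op f).
Proof.
move=> bf; split; last by exists (Rintegral (@leb R) setT (fun t => `|f t|)) => s; exact: op_le.
(* The cutoff [ind 2] is 1 wherever [op f] can be nonzero. Inserting it makes the double integral
   converge, and Fubini then yields integrability. *)
have e : EFin \o op f = fubini_F (@leb R) (EFin \o (fun z : R * R => K z * f z.2 * ind 2 z.1)).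
  rewrite op_fubini//; last exact: ind_bint.
  apply/funext => s /=.
  have [s1|s1] := eqVneq (ind 2 s) 0; first by rewrite op_out// mul0r.
  by move: s1; rewrite /ind; case: ifP => _; rewrite ?eqxx// mulr1.
have := integrable_fubini_F (op_joint bf (ind_bint 2)).
by rewrite e.
Qed.

Lemma op_CS f s : bint f -> op f s ^+ 2 <= inner (fun t => K (s, t)) (fun t => K (s, t)) * inner f f.
Proof. by move=> bf; rewrite opE; apply: inner_CS => //; exact: ck_row_bint. Qed.

(** A Hilbert-Schmidt bound in which an integrable majorant [G] stands for the squared norms of the
    rows, so those need not be integrated themselves. *)
Lemma op_sq_le f (G : R -> R) : bint f -> bint G ->
  (forall s, inner (fun t => K (s, t)) (fun t => K (s, t)) <= G s) ->
  inner (op f) (op f) <= Rintegral (@leb R) setT G * inner f f.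
Proof.
move=> bf bG KG; rewrite mulrC -(RintegralZl _ measurableT (bint_int bG)).
have bo := op_bint bf.
apply: le_Rintegral => //; [exact: bint_int (bintMM bo bo)|exact: bint_int (bintZ _ bG)|].
move=> s _; rewrite -expr2 mulrC; apply: le_trans (op_CS s bf) _.
by apply: ler_wpM2r (KG s); exact: inner_ge0.
Qed.

End CompactKernel.

Lemma op_adj (R : realType) (K : R * R -> R) (f g : R -> R) :
  measurable_fun setT K -> (forall s t, `|K (s, t)| <= ind 2 s * ind 2 t) ->
  bint (@leb R) f -> bint (@leb R) g ->
  inner (kop (@leb R) K f) g = inner f (kop (@leb R) (fun z => K (z.2, z.1)) g).
Proof.
move=> mK KB bf bg.
pose Kt (z : R * R) := K (z.2, z.1).
have mKt : measurable_fun setT Kt by apply: (measurableT_comp mK); exact: measurable_swap.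
have KtB s t : `|Kt (s, t)| <= ind 2 s * ind 2 t by rewrite mulrC; exact: KB.
have jint := op_joint mK KB bf bg.
congr fine; have E := Fubini jint.
transitivity (\int[@leb R]_x \int[@leb R]_y (K (x, y) * f y * g x)%:E)%E.
  apply: eq_integral => s _.
  by have := op_fubini mK KB bf bg => /(congr1 (fun F => F s)) /=; rewrite /fubini_F/= => ->.
rewrite E; apply: eq_integral => t _ /=.
have := op_fubini mKt KtB bg bf => /(congr1 (fun F => F t)) /=; rewrite /fubini_F/= mulrC => <-.
by apply: eq_integral => s _; rewrite /Kt /=; congr (_%:E); ring.
Qed.

(** * The power method *)

Section Template.
Variable R : realType.
Implicit Types (nu s t a : R) (w f g : R -> R).
Local Notation bint := (bint (@leb R)).

(** The kernel of half of [Aop]. Normalization cancels the factor 2 in a power step, and the final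
    scaling becomes the square root of [<w, B w>]. *)
Definition Bk nu (z : R * R) : R := (Xrot nu z + Xrot nu (z.2, z.1)) / 2.
Definition Bop nu w : R -> R := kop (@leb R) (Bk nu) w.

Lemma XrotE nu s t : Xrot nu (s, t) =
  ind (alpha R) (cos (nu - nu_nat R) * s - sin (nu - nu_nat R) * t) *
  ind (alpha R) (sin (nu - nu_nat R) * s + cos (nu - nu_nat R) * t).
Proof. by []. Qed.

Lemma ind_idem a s : ind a s = 0 \/ ind a s = 1 :> R.
Proof. by rewrite /ind; case: ifP; [right|left]. Qed.

Lemma indP a s : reflect (`|s| <= a) (ind a s == 1 :> R).
Proof.
rewrite /ind -ler_norml; case: leP => h; first by rewrite eqxx; constructor.
by rewrite eq_sym oner_eq0; constructor.
Qed.

Lemma ind1 a s : `|s| <= a -> ind a s = 1 :> R. Proof. by move/indP/eqP. Qed.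
Lemma ind0 a s : a < `|s| -> ind a s = 0 :> R.
Proof. by rewrite /ind -ler_norml => /lt_geF ->. Qed.

Lemma ind_mono a b s : a <= b -> ind a s <= ind b s :> R.
Proof.
move=> ab; have [h|h] := leP `|s| a; last by rewrite (ind0 h) ind_ge0.
by rewrite !ind1// (le_trans h).
Qed.

Lemma alpha_le1 : alpha R <= 1.
Proof. by apply: le_trans (alpha_le R) _; lra. Qed.

(* Undoing the rotation bounds both coordinates of a point of the rotated square. *)
Lemma Xrot_reach nu s t (c := cos (nu - nu_nat R)) (d := sin (nu - nu_nat R)) :
  Xrot nu (s, t) != 0 -> `|s| <= alpha R * (`|c| + `|d|) /\ `|t| <= alpha R * (`|c| + `|d|).
Proof.
rewrite XrotE -/c -/d => h.
have [p1|p1] := leP `|c * s - d * t| (alpha R); last by rewrite (ind0 p1) mul0r eqxx in h.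
have [q1|q1] := leP `|d * s + c * t| (alpha R); last by rewrite (ind0 q1) mulr0 eqxx in h.
have cd : c ^+ 2 + d ^+ 2 = 1 by exact: cos2Dsin2.
have se : s = c * (c * s - d * t) + d * (d * s + c * t).
  by rewrite -[LHS]mul1r -cd; ring.
have te : t = c * (d * s + c * t) - d * (c * s - d * t).
  by rewrite -[LHS]mul1r -cd; ring.
have a0 := ltW (alpha_gt0 R); rewrite mulrDr; split.
  by rewrite {1}se (le_trans (ler_normD _ _))// !normrM lerD// mulrC ler_wpM2r.
by rewrite {1}te (le_trans (ler_normB _ _))// !normrM lerD// mulrC ler_wpM2r.
Qed.

Lemma Xrot_01 nu z : 0 <= Xrot nu z <= 1.
Proof. by case: z => s t; rewrite XrotE mulr_ge0 ?ind_ge0//= -[leRHS]mul1r ler_pM ?ind_ge0 ?ind_le1. Qed.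

Lemma Xrot_le nu s t : Xrot nu (s, t) <= ind 2 s * ind 2 t.
Proof.
have [->|/Xrot_reach[s1 t1]] := eqVneq (Xrot nu (s, t)) 0; first by rewrite mulr_ge0// ind_ge0.
have r2 : alpha R * (`|cos (nu - nu_nat R)| + `|sin (nu - nu_nat R)|) <= 2.
  rewrite -[leRHS]mul1r; apply: ler_pM; [exact: ltW (alpha_gt0 R)|exact: addr_ge0|exact: alpha_le1|].
  have -> : (2 : R) = 1 + 1 by lra.
  by apply: lerD; rewrite ler_norml ?cos_geN1 ?cos_le1 ?sin_geN1 ?sin_le1.
rewrite !ind1; first by case/andP: (Xrot_01 nu (s, t)); rewrite mulr1.
  exact: le_trans t1 r2.
exact: le_trans s1 r2.
Qed.

Lemma Xrot_meas nu : measurable_fun setT (Xrot nu : R * R -> R).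
Proof. exact: bint_mf (Xrot_bint nu). Qed.

Lemma Xrot_swap_meas nu : measurable_fun setT (fun z : R * R => Xrot nu (z.2, z.1)).
Proof. by apply: (measurableT_comp (Xrot_meas nu)); exact: measurable_swap. Qed.

Lemma Xrot_ck nu s t : `|Xrot nu (s, t)| <= ind 2 s * ind 2 t.
Proof. by rewrite ger0_norm ?Xrot_le//; case/andP: (Xrot_01 nu (s, t)). Qed.

Lemma Bk_meas nu : measurable_fun setT (Bk nu).
Proof.
by apply: measurable_funM => //; apply: measurable_funD; [exact: Xrot_meas|exact: Xrot_swap_meas].
Qed.

Lemma Bk_ge0 nu z : 0 <= Bk nu z.
Proof.
rewrite /Bk; have /andP[h1 _] := Xrot_01 nu z; have /andP[h2 _] := Xrot_01 nu (z.2, z.1).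
by move: (Xrot _ _) (Xrot _ _) h1 h2 => A B; lra.
Qed.

Lemma Bk_le nu s t : Bk nu (s, t) <= ind 2 s * ind 2 t.
Proof.
rewrite /Bk/=; have h1 := Xrot_le nu s t; have h2 := Xrot_le nu t s; rewrite mulrC in h2.
by move: (Xrot _ _) (Xrot _ _) (_ * _) h1 h2 => A B D; lra.
Qed.

Lemma Bk_ck nu s t : `|Bk nu (s, t)| <= ind 2 s * ind 2 t.
Proof. by rewrite ger0_norm ?Bk_le// Bk_ge0. Qed.

Lemma Bk_sym nu s t : Bk nu (s, t) = Bk nu (t, s).
Proof. by rewrite /Bk/= addrC. Qed.

Lemma Bop_bint nu w : bint w -> bint (Bop nu w).
Proof. by move=> bw; apply: op_bint => //; [exact: Bk_meas|exact: Bk_ck]. Qed.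

Lemma Bop_adj nu f g : bint f -> bint g -> inner (Bop nu f) g = inner f (Bop nu g).
Proof.
move=> bf bg; have e : (fun z => Bk nu (z.2, z.1)) = Bk nu.
  by apply/funext => -[s t]; exact: Bk_sym.
by have := op_adj (Bk_meas nu) (Bk_ck nu) bf bg; rewrite e.
Qed.

Lemma AopE nu w : bint w -> Aop nu w = (fun s => 2 * Bop nu w s).
Proof.
move=> bw; apply/funext => s; rewrite /Aop /Top /Top_adj /Bop /kop.
have b1 := ck_int (Xrot_meas nu) (Xrot_ck nu) s bw.
have b2 : bint (fun t => Xrot nu (t, s) * w t).
  apply: (ck_int (K := fun z => Xrot nu (z.2, z.1)) (Xrot_swap_meas nu) _ s bw) => x y.
  by rewrite mulrC; exact: Xrot_ck.
have bB := ck_int (Bk_meas nu) (Bk_ck nu) s bw.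
rewrite -(RintegralD measurableT (bint_int b1) (bint_int b2)) -(RintegralZl _ measurableT (bint_int bB)).
by congr Rintegral; apply/funext => t; rewrite /Bk/=; field.
Qed.

Definition nrm w : R := Num.sqrt (inner w w).

Lemma power_stepE nu w : bint w -> power_step nu w = (fun s => (nrm (Bop nu w))^-1 * Bop nu w s).
Proof.
move=> bw; apply/funext => s; have bB := Bop_bint nu bw.
rewrite /power_step AopE// L2normE; last exact: bintZ.
rewrite innerZl//; last exact: bintZ.
rewrite innerZr// mulrA -expr2 sqrtrM ?sqr_ge0// sqrtr_sqr ger0_norm// invfM -/(nrm _).
by rewrite mulrACA mulVf ?mul1r// pnatr_eq0.
Qed.

Lemma power_step_bint nu w : bint w -> bint (power_step nu w).
Proof. by move=> bw; rewrite power_stepE//; apply: bintZ; exact: Bop_bint. Qed.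

Lemma power_iter_bint nu w k : bint w -> bint (power_iter nu w k).
Proof. by move=> bw; elim: k => //= k IH; exact: power_step_bint. Qed.

Lemma PmE nu w k (v := power_iter nu w k) : bint w ->
  Pm k w nu = (fun s => Num.sqrt (inner v (Bop nu v)) * v s).
Proof.
move=> bw; have bv : bint v := power_iter_bint nu k bw.
apply/funext => s; rewrite /Pm -/v AopE// innerZr//; last exact: Bop_bint.
by rewrite mulKf// pnatr_eq0.
Qed.

Lemma Pm_bint nu w k : bint w -> bint (Pm k w nu).
Proof. by move=> bw; rewrite PmE//; apply: bintZ; exact: power_iter_bint. Qed.

Lemma Xrot_quarter nu : Xrot (nu + pi / 2) = Xrot nu :> (R * R -> R).
Proof.
apply/funext => -[s t]; rewrite !XrotE.
rewrite (_ : nu + pi / 2 - nu_nat R = (nu - nu_nat R) + pi / 2); last by ring.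
rewrite cosDpihalf sinDpihalf mulrC; congr (_ * _); first by rewrite mulNr.
rewrite (_ : - sin (nu - nu_nat R) * s - cos (nu - nu_nat R) * t = - (sin (nu - nu_nat R) * s + cos (nu - nu_nat R) * t)); last by ring.
by rewrite /ind lerNl opprK lerNl andbC.
Qed.

Lemma Xrot_period (n : int) nu : Xrot (nu + n%:~R * (pi / 2)) = Xrot nu :> (R * R -> R).
Proof.
have H (k : nat) x : Xrot (x + k%:R * (pi / 2)) = Xrot x :> (R * R -> R).
  elim: k x => [|k IH] x; first by rewrite mul0r addr0.
  by rewrite -natr1 mulrDl mul1r addrA Xrot_quarter IH.
case: n => k; first exact: H.
by rewrite -[LHS](H k.+1 (nu + (Negz k)%:~R * (pi / 2))) NegzE mulrNz mulNr subrK.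
Qed.

End Template.

(** * The rough estimate *)

Section StageOne.
Variable R : realType.
Implicit Types (nu s t a : R) (w f g : R -> R).
Local Notation bint := (bint (@leb R)).
Local Notation B0 := (Bop 0).

Lemma Rint_ind a : 0 <= a -> Rintegral (@leb R) setT (ind a) = 2 * a.
Proof.
move=> a0; rewrite indE /Rintegral integral_indic// setIT.
have h := @lebesgue_measure_itv R `[- a, a]; rewrite /= lte_fin in h.
transitivity (fine (lebesgue_measure (`[- a, a]%classic : set R))); first by [].
rewrite h; clear h.
case: ifP => h /=; first by rewrite opprK mulr_natl mulr2n.
have -> : a = 0 by move/negbT: h; rewrite -leNgt => h; lra.
by rewrite mulr0.
Qed.

Lemma inner_ind a b : a <= b -> 0 <= a -> inner (ind a) (ind b) = 2 * a :> R.
Proof.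
move=> ab a0; rewrite -(Rint_ind a0); congr Rintegral; apply/funext => t.
have [h|h] := leP `|t| a; last by rewrite (ind0 h) mul0r.
by rewrite !ind1 ?mul1r// (le_trans h).
Qed.

(** At [nu = 0] the relative rotation is [- pi / 4], whose cosine is [alpha] itself: the conditions
    read [|s + t| <= 1] and [|t - s| <= 1]. *)
Lemma Xrot0E s t : Xrot 0 (s, t) = ind (1 - `|s|) t.
Proof.
rewrite XrotE sub0r cosN sinN /nu_nat cos_pi4 sin_pi4.
have a0 := alpha_gt0 R.
have e1 : alpha R * s - - alpha R * t = alpha R * (s + t) by ring.
have e2 : - alpha R * s + alpha R * t = alpha R * (t - s) by ring.
rewrite e1 e2.
have I x : ind (alpha R) (alpha R * x) = ind 1 x.
  have [h|h] := leP `|x| 1.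
    by rewrite !ind1// normrM gtr0_norm// ler_piMr// ltW.
  by rewrite !ind0// normrM gtr0_norm// ltr_pMr.
rewrite !I; have [h|h] := leP `|t| (1 - `|s|).
  have h1 : `|s + t| <= 1 by rewrite (le_trans (ler_normD _ _))// -lerBrDl.
  have h2 : `|t - s| <= 1 by rewrite (le_trans (ler_normB _ _))// -lerBrDr.
  by rewrite !ind1// mulr1.
rewrite (ind0 h); have [p|p] := leP `|s + t| 1; last by rewrite (ind0 p) mul0r.
have [q|q] := leP `|t - s| 1; last by rewrite (ind0 q) mulr0.
exfalso; move: h p q; rewrite !ler_norml; have [s0|s0] := leP 0 s; have [t0|t0] := leP 0 t;
  rewrite ?(ger0_norm s0) ?(ltr0_norm s0) ?(ger0_norm t0) ?(ltr0_norm t0) => h /andP[p1 p2] /andP[q1 q2]; lra.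
Qed.

Lemma Bk0E s t : Bk 0 (s, t) = ind (1 - `|s|) t.
Proof.
rewrite /Bk/= !Xrot0E.
have -> : ind (1 - `|t|) s = ind (1 - `|s|) t.
  by rewrite /ind -!ler_norml; congr (if _ then _ else _); rewrite lerBrDl lerBrDr addrC.
by field.
Qed.

Lemma B0E w s : B0 w s = inner (ind (1 - `|s|)) w.
Proof. by rewrite /Bop /kop /inner; congr Rintegral; apply/funext => t; rewrite Bk0E. Qed.

Let lam : R := 4 / pi.

Lemma inner_ind_ch a : 0 < a -> inner (ind a) (@ch R) = 4 / pi * sin (pi / 2 * a).
Proof.
move=> a0; have pi0 := pi_gt0 R.
pose f : R -> R := (2 / pi) *: (sin \o (fun y => pi / 2 * y)).
have df (x : R) : is_derive x 1 f (ch x).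
  have e : ch x = (2 / pi) *: (cos (pi / 2 * x) * (pi / 2)).
    rewrite /GRing.scale/= /ch; move: (cos _) => u; move: (pi : R) pi0 => p p0.
    by field; rewrite gt_eqF.
  have h1 : is_derive x 1 (fun y : R => pi / 2 * y) (pi / 2).
    by have := is_deriveZ (pi / 2) (is_derive_id x 1); rewrite /GRing.scale/= mulr1.
  have h2 := is_derive1_comp (is_derive_sin (pi / 2 * x)) h1.
  rewrite e; exact: (is_deriveZ (2 / pi) h2).
have cc : continuous (@ch R).
  by move=> x; apply: continuous_comp; [apply: cvgM; [exact: cvg_cst|exact: cvg_id]|exact: continuous_cos].
have := FTC_ind a0 df cc; rewrite /inner /Rintegral => -> /=.
have fE (x : R) : f x = 2 / pi * sin (pi / 2 * x) by [].
rewrite (fE a) (fE (- a)) mulrN sinN; clear df f fE; move: (sin (pi / 2 * a)) => u.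
rewrite /lam; move: (pi : R) pi0 => p p0.
by field; rewrite gt_eqF.
Qed.

Lemma e1_ind a t : a <= 1 -> ind a t * e1 t = ind a t * ch t :> R.
Proof.
move=> a1; have [h|h] := leP `|t| a; last by rewrite (ind0 h) !mul0r.
by rewrite /e1 (@ind1 _ 1) ?mul1r// (le_trans h).
Qed.

Lemma inner_ind_e1 a : 0 <= a -> a <= 1 -> inner (ind a) (@e1 R) = lam * sin (pi / 2 * a).
Proof.
move=> a0 a1; have [a2|a2] := ltP 0 a.
  rewrite /lam -(inner_ind_ch a2); congr Rintegral; apply/funext => t; exact: e1_ind.
have -> : a = 0 by apply/le_anti; rewrite a0 a2.
have bi := @ind_bint R 0; have := inner_CS bi (@e1_bint R).
rewrite inner_ind// mulr0 mul0r mulr0 sin0 mulr0 => h.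
by apply/eqP; rewrite -sqrf_eq0; apply/eqP/le_anti; rewrite sqr_ge0 andbT.
Qed.

Lemma inner_e1 : inner (@e1 R) (@e1 R) = 1.
Proof.
have pi0 := pi_gt0 R.
pose f : R -> R := 2^-1 *: id + (2 * pi)^-1 *: (sin \o (fun y => pi * y)).
pose f' (x : R) : R := ch x * ch x.
have df (x : R) : is_derive x 1 f (f' x).
  have e : f' x = 2^-1 *: 1 + (2 * pi)^-1 *: (cos (pi * x) * pi).
    have -> : cos (pi * x) = cos (pi / 2 * x + pi / 2 * x) by congr cos; move: (pi : R) => p; field.
    rewrite /GRing.scale/= /f' /ch cosD -!expr2 sin2cos2.
    move: (cos _) => u; move: (pi : R) pi0 => p p0.
    by field; rewrite gt_eqF.
  have h1 : is_derive x 1 (fun y : R => pi * y) pi.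
    by have := is_deriveZ pi (is_derive_id x 1); rewrite /GRing.scale/= mulr1.
  have h2 := is_derive1_comp (is_derive_sin (pi * x)) h1.
  rewrite e; exact: (is_deriveD (is_deriveZ 2^-1 (is_derive_id x 1)) (is_deriveZ (2 * pi)^-1 h2)).
have cc : continuous (@ch R).
  by move=> x; apply: continuous_comp; [apply: cvgM; [exact: cvg_cst|exact: cvg_id]|exact: continuous_cos].
have cf : continuous f' by move=> x; apply: cvgM; exact: cc.
have := FTC_ind ltr01 df cf.
rewrite /inner (_ : (fun s => e1 s * e1 s) = (fun x => ind 1 x * f' x)).
  rewrite /Rintegral => -> /=.
  have fE (x : R) : f x = 2^-1 * x + (2 * pi)^-1 * sin (pi * x) by [].
  have s1 : sin (pi * 1 : R) = 0 by rewrite mulr1 sinpi.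
  have s2 : sin (pi * - 1 : R) = 0 by rewrite mulrN1 sinN sinpi oppr0.
  by rewrite (fE 1) (fE (- 1)) s1 s2 !mulr0 !addr0; field.
apply/funext => t; rewrite /e1 /f'; have [->|->] := ind_idem 1 t; ring.
Qed.

Lemma ind_neg a t : a < 0 -> ind a t = 0 :> R.
Proof. by move=> a0; rewrite ind0// (lt_le_trans a0). Qed.

(** Integrating the cosine over [|t| <= 1 - |s|] gives a multiple of [sin (pi / 2 (1 - |s|))], which
    is the cosine again. *)
Lemma B0_e1 s : B0 (@e1 R) s = lam * e1 s.
Proof.
rewrite B0E; have [h|h] := leP `|s| 1; last first.
  rewrite /e1 (ind0 h) mul0r mulr0 /inner (_ : (fun t => _) = (fun=> 0)) ?/Rintegral ?integral0//.
  by apply/funext => t; rewrite ind_neg ?mul0r// subr_lt0.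
have p0 : 0 <= 1 - `|s| by rewrite subr_ge0.
have p1 : 1 - `|s| <= 1 by rewrite lerBlDr lerDl.
rewrite inner_ind_e1//.
rewrite /e1 (ind1 h) mul1r /ch; congr (_ * _).
rewrite mulrBr mulr1 sinB sin_pihalf cos_pihalf mul1r mul0r subr0.
by have [s0|s0] := leP 0 s; rewrite ?(ger0_norm s0) ?(ltr0_norm s0) ?mulrN ?cosN.
Qed.

Lemma lam_gt0 : 0 < lam. Proof. by rewrite /lam divr_gt0// pi_gt0. Qed.

Lemma lam2_le : 16 / 10 * lam ^+ 2 >= 25 / 10.
Proof.
rewrite /lam expr_div_n; have := pi2_le R; have : 0 < (pi : R) ^+ 2 by rewrite exprn_gt0// pi_gt0.
move: (pi ^+ 2 : R) => p p0 p1; rewrite mulrA ler_pdivlMr//; lra.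
Qed.

Lemma lam_bounds : 125 / 100 <= lam <= 129 / 100.
Proof.
rewrite /lam; have := pi_lt R; have := pi_gt R; have := pi_gt0 R; move: (pi : R) => p p0 p1 p2.
by apply/andP; split; [rewrite ler_pdivlMr|rewrite ler_pdivrMr]; lra.
Qed.

Lemma inner_ind_e1_1 : inner (ind 1) (@e1 R) = lam.
Proof. by rewrite inner_ind_e1// mulr1 sin_pihalf mulr1. Qed.

(* Since 3 s^2 - s^4 <= 2 |s| on [-1, 1], a polynomial majorant of 1 - |s|. *)
Definition quartic_tri s : R := ind 1 s * (1 - (3 * s ^+ 2 - s ^+ 4) / 2).

Lemma quartic_tri_le s : ind 1 s * (1 - `|s|) <= quartic_tri s.
Proof.
rewrite /quartic_tri; have [h|h] := leP `|s| 1; last by rewrite (ind0 h) !mul0r.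
rewrite (ind1 h) !mul1r lerD2l lerN2.
have -> : s ^+ 2 = `|s| ^+ 2 by rewrite real_normK ?num_real.
have -> : s ^+ 4 = `|s| ^+ 4 by rewrite -[RHS]normrX ger0_norm// exprn_even_ge0.
have := normr_ge0 s; move: `|s| h => y y1 y0; rewrite ler_pdivrMr//.
rewrite -subr_ge0.
have -> : y * 2 - (3 * y ^+ 2 - y ^+ 4) = y * (1 - y) ^+ 2 * (2 + y) by ring.
by apply: mulr_ge0; [apply: mulr_ge0; [exact: y0|exact: sqr_ge0]|lra].
Qed.

Lemma quartic_tri_int : Rintegral (@leb R) setT quartic_tri = 12 / 10.
Proof.
pose f : R -> R := quintic 1 (- (1 / 2)) (1 / 10).
have := FTC_ind ltr01 (quintic_derive 1 (- (1 / 2)) (1 / 10)) (@quintic_cont R 1 (- (1 / 2)) (1 / 10)).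
rewrite /quartic_tri (_ : (fun s => _) = (fun s => ind 1 s * quintic' 1 (- (1 / 2)) (1 / 10) s)).
  by rewrite /Rintegral => -> /=; rewrite !quinticE; field.
by apply/funext => s; congr (_ * _); rewrite /quintic'; field.
Qed.

Lemma quartic_tri_bint : bint quartic_tri.
Proof.
apply: (@bint_le _ _ R (@leb R) _ (fun s => 3 * ind 1 s)).
- have mX n : measurable_fun setT (fun s : R => s ^+ n) by exact: exprn_measurable.
  apply: measurable_funM; first exact: bint_mf (ind_bint 1).
  by apply: measurable_funB => //; apply: measurable_funM => //; apply: measurable_funB => //; exact: measurable_funM.
- exact: bintZ (ind_bint 1).
move=> s; rewrite /quartic_tri; have [h|h] := leP `|s| 1; last by rewrite (ind0 h) mul0r mulr0 normr0.
rewrite (ind1 h) mul1r mulr1.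
have s2 : s ^+ 2 <= 1 by rewrite -real_normK ?num_real// exprn_ile1.
have s20 : 0 <= s ^+ 2 by exact: sqr_ge0.
have -> : s ^+ 4 = s ^+ 2 * s ^+ 2 by rewrite -exprD.
rewrite ler_norml; move: (s ^+ 2) s2 s20 => y y1 y0; apply/andP; split; nra.
Qed.

End StageOne.

Lemma one_plus_arith (R : realType) (x : R) : `|x| <= 14 / 100 -> 86 / 100 <= 1 + x /\ 1 + x <= 114 / 100.
Proof. by rewrite ler_norml => /andP[? ?]; split; lra. Qed.

Lemma rough_arith (R : realType) (d l x : R) : 86 / 100 <= d -> d <= 1 -> 125 / 100 <= l -> l <= 129 / 100 ->
  86 / 100 <= x -> x <= 114 / 100 ->
  [/\ 0 < d * l * x, 1 / 2 <= d * l * x * d & d * l * x * d <= 2].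
Proof.
move=> d1 d2 l1 l2 x1 x2.
have a1 : 86 / 100 * (125 / 100) <= d * l by apply: ler_pM; lra.
have a2 : d * l <= 1 * (129 / 100) by apply: ler_pM; lra.
have a3 : 86 / 100 * (125 / 100) * (86 / 100) <= d * l * x by apply: ler_pM; lra.
have a4 : d * l * x <= 1 * (129 / 100) * (114 / 100) by apply: ler_pM; lra.
clear a1 a2; move: (d * l * x) a3 a4 => q q1 q2; split; first by lra.
  have : 86 / 100 * (125 / 100) * (86 / 100) * (86 / 100) <= q * d by apply: ler_pM; lra.
  by move: (q * d) => y; lra.
have : q * d <= 1 * (129 / 100) * (114 / 100) * 1 by apply: ler_pM; lra.
by move: (q * d) => y; lra.
Qed.

(** * Contraction orthogonally to the leading eigenfunction *)

Section RoughTemplate.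
Variable R : realType.
Implicit Types (s t a c : R) (w f g rho : R -> R).
Local Notation bint := (bint (@leb R)).
Local Notation B0 := (Bop 0).
Let lam : R := 4 / pi.
Let be := @e1_bint R.
Local Notation ip := (@inner R).

Lemma ind_tri s : ip (ind (1 - `|s|)) (ind (1 - `|s|)) = 2 * (ind 1 s * (1 - `|s|)).
Proof.
have [h|h] := leP `|s| 1; first by rewrite (ind1 h) mul1r inner_ind// subr_ge0.
rewrite (ind0 h) mul0r mulr0 /inner (_ : (fun t => _) = (fun=> 0)) ?/Rintegral ?integral0//.
by apply/funext => t; rewrite ind_neg ?mul0r// subr_lt0.
Qed.

(** Against a function orthogonal to [e1] each row of the kernel may be replaced by its projection
    off [e1]. This lowers its squared norm by [lam^2 e1(s)^2] before Cauchy-Schwarz is applied. *)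
Lemma B0_sq_perp rho s : bint rho -> ip (@e1 R) rho = 0 ->
  B0 rho s ^+ 2 <= (2 * quartic_tri s - lam ^+ 2 * (e1 s * e1 s)) * ip rho rho.
Proof.
move=> br pr; have bi := ind_bint (1 - `|s|).
have bz := bintZ (- (lam * e1 s)) be.
have -> : B0 rho s = ip (fun t => ind (1 - `|s|) t + - (lam * e1 s) * e1 t) rho.
  by rewrite innerDl// innerZl// pr mulr0 addr0 B0E.
apply: le_trans (inner_CS (bintD bi bz) br) _; apply: ler_wpM2r; first exact: inner_ge0.
rewrite innerDl//; last exact: bintD.
have e1i : ip (ind (1 - `|s|)) (@e1 R) = lam * e1 s by rewrite -B0E B0_e1.
rewrite !innerDr// !innerZl// !innerZr// inner_e1 (innerC (@e1 R) (ind _)) !e1i ind_tri.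
rewrite -/lam; have := quartic_tri_le s; move: (_ * (1 - _)) (quartic_tri s) lam (e1 s) => A B l e AB.
rewrite (_ : _ + _ = 2 * A - l ^+ 2 * (e * e)); last by ring.
by rewrite lerD2r ler_pM2l.
Qed.

Lemma B0_perp rho : bint rho -> ip (@e1 R) rho = 0 -> ip (@e1 R) (B0 rho) = 0.
Proof.
move=> br pr; rewrite -Bop_adj// (_ : B0 (@e1 R) = (fun s => lam * e1 s)).
  by rewrite innerZl// pr mulr0.
by apply/funext => s; rewrite B0_e1.
Qed.

Definition next rho s := lam^-1 * B0 rho s.

Let l0 : 0 < lam := lam_gt0 R.

Let lam2 : 25 / 16 <= lam ^+ 2.
Proof. by have := lam2_le R; rewrite -/lam; move: (lam ^+ 2) => l h; lra. Qed.

Lemma next_bint rho : bint rho -> bint (next rho).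
Proof. by move=> br; apply: bintZ; exact: Bop_bint. Qed.

Lemma next_perp rho : bint rho -> ip (@e1 R) rho = 0 -> ip (@e1 R) (next rho) = 0.
Proof. by move=> br pr; rewrite innerZr ?B0_perp ?mulr0//; exact: Bop_bint. Qed.

(** After removal of the leading eigenvalue the squared Hilbert-Schmidt norm is at most
    [2 * 12/10 - lam^2]. Divided by [lam^2 >= 25/16], this is below [54/100]. *)
Lemma next_contract rho : bint rho -> ip (@e1 R) rho = 0 -> ip (next rho) (next rho) <= 54 / 100 * ip rho rho.
Proof.
move=> br pr; have bB := Bop_bint 0 br; have bn := next_bint br.
rewrite /next innerZl// innerZr// mulrA -expr2 exprVn ler_pdivrMl; last by rewrite exprn_gt0.
have bq := bintZ 2 (@quartic_tri_bint R).
have b2 := bintZ (- lam ^+ 2) (bintMM be be).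
have bG := bintD bq b2; have n0 := inner_ge0 rho.
apply: (@le_trans _ _ (Rintegral (@leb R) setT (fun s => ip rho rho * (2 * quartic_tri s + - lam ^+ 2 * (e1 s * e1 s))))).
  apply: le_Rintegral => //; [exact: (bint_int (bintMM bB bB))|exact: (bint_int (bintZ _ bG))|].
  by move=> s _; rewrite -expr2 mulNr [leRHS]mulrC; exact: B0_sq_perp.
rewrite (RintegralZl _ measurableT (bint_int bG)) (RintegralD measurableT (bint_int bq) (bint_int b2)).
rewrite (RintegralZl _ measurableT (bint_int (@quartic_tri_bint R))) quartic_tri_int.
rewrite (RintegralZl _ measurableT (bint_int (bintMM be be))) -[Rintegral _ _ _]/(ip (@e1 R) (@e1 R)) inner_e1.
rewrite [leRHS]mulrCA [leRHS]mulrA [leRHS]mulrC; apply: ler_wpM2l => //.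
by move: (lam ^+ 2) lam2 => l hl; lra.
Qed.

(** One application of the kernel turns L2 control into sup control, the form in which [flux_rough]
    needs the remainder. *)
Lemma next_sup rho s : bint rho -> next rho s ^+ 2 <= 128 / 100 * ip rho rho.
Proof.
move=> br; rewrite /next exprMn exprVn ler_pdivrMl; last by rewrite exprn_gt0.
apply: (@le_trans _ _ (2 * ip rho rho)).
  rewrite B0E; apply: le_trans (inner_CS (ind_bint _) br) _; apply: ler_wpM2r; first exact: inner_ge0.
  rewrite ind_tri; have [h|h] := leP `|s| 1; last by rewrite (ind0 h) mul0r mulr0.
  by rewrite (ind1 h) mul1r; have := normr_ge0 s; move: `|s| => y y0; lra.
have := inner_ge0 rho; move: (ip rho rho) (lam ^+ 2) lam2 => n l hl n0; nra.
Qed.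

Lemma B0_profile c rho : bint rho ->
  B0 (fun s => c * (e1 s + rho s)) = (fun s => c * lam * (e1 s + next rho s)).
Proof.
move=> br; apply/funext => s; have bs := bintD be br.
rewrite B0E innerZr//; last exact: ind_bint.
rewrite innerDr//; last exact: ind_bint.
rewrite -!B0E B0_e1 /next -/lam; move: (B0 rho s) lam l0 => b l hl; field.
by rewrite gt_eqF.
Qed.

Lemma inner_profile rho rho' : bint rho -> bint rho' -> ip (@e1 R) rho = 0 -> ip (@e1 R) rho' = 0 ->
  ip (fun s => e1 s + rho s) (fun s => e1 s + rho' s) = 1 + ip rho rho'.
Proof.
move=> br br' pr pr'; have b1 := bintD be br'.
by rewrite innerDl// !innerDr// inner_e1 pr' (innerC rho) pr addr0 add0r.
Qed.

Lemma rough_step c rho : 0 < c -> bint rho -> ip (@e1 R) rho = 0 ->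
  power_step 0 (fun s => c * (e1 s + rho s)) =
  (fun s => (Num.sqrt (1 + ip (next rho) (next rho)))^-1 * (e1 s + next rho s)).
Proof.
move=> c0 br pr; have bn := next_bint br; have bs := bintD be br; have bs' := bintD be bn.
rewrite power_stepE; last exact: bintZ.
rewrite B0_profile// /nrm innerZl//; last exact: bintZ.
rewrite innerZr// (inner_profile bn bn (next_perp br pr) (next_perp br pr)).
have cl : 0 < c * lam by rewrite mulr_gt0.
rewrite mulrA -expr2 sqrtrM ?sqr_ge0// sqrtr_sqr (gtr0_norm cl).
apply/funext => s; rewrite invfM mulrA; congr (_ * _).
by rewrite mulrAC mulVf ?mul1r// gt_eqF.
Qed.

(** The inner product of [ind 1] with the unit vector [e1] happens to equal [lam], so this is the
    part of the start orthogonal to [e1], measured relative to its component along [e1]. *)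
Definition rho0 s : R := lam^-1 * ind 1 s + -1 * e1 s.

Lemma rho0_facts : [/\ bint rho0, ip (@e1 R) rho0 = 0, ip rho0 rho0 <= 28 / 100 &
  ind 1 = (fun s => lam * (e1 s + rho0 s))].
Proof.
have b1 := bintZ lam^-1 (@ind_bint R 1); have b2 := bintZ (-1) be.
have b0 : bint rho0 by exact: bintD.
have bi := @ind_bint R 1; have lz : lam != 0 by rewrite gt_eqF.
have pr : ip (@e1 R) rho0 = 0.
  by rewrite innerDr// !innerZr// inner_e1 innerC inner_ind_e1_1 mulVf// mulr1 subrr.
split => //.
  rewrite {1}/rho0 innerDl// !innerZl// pr mulr0 addr0 innerDr// !innerZr//.
  rewrite inner_ind_e1_1 inner_ind// -/lam.
  have -> : lam^-1 * (lam^-1 * (2 * 1) + -1 * lam) = 2 / lam ^+ 2 - 1 by move: lam lz => l lz; field.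
  rewrite lerBlDr ler_pdivrMr ?exprn_gt0//.
  by move: (lam ^+ 2) lam2 => l hl; lra.
by apply/funext => s; rewrite /rho0 mulrDr mulrDr mulVKf//; ring.
Qed.

(** The normalization and the sup bound are guarded by [0 < k]: they result from a power step,
    whereas the start is neither normalized nor controlled here beyond L2. *)
Lemma rough_iter k : exists c rho, [/\ 0 < c, bint rho, ip (@e1 R) rho = 0,
  ip rho rho <= (54 / 100) ^+ k * (28 / 100) &
  power_iter 0 (ind 1) k = (fun s => c * (e1 s + rho s)) /\
  ((0 < k)%N -> c ^+ 2 * (1 + ip rho rho) = 1 /\ forall s, rho s ^+ 2 <= (54 / 100) ^+ k)].
Proof.
elim: k => [|k [c [rho [c0 br pr nr [wE _]]]]].
  have [b0 p0 n0 e0] := rho0_facts.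
  by exists lam, rho0; split => //; rewrite expr0 mul1r.
have n0 := inner_ge0 (next rho).
have n1 : 0 < 1 + ip (next rho) (next rho) by rewrite ltr_pwDl.
have p0 : 0 <= (54 / 100) ^+ k :> R by apply: exprn_ge0; lra.
exists (Num.sqrt (1 + ip (next rho) (next rho)))^-1, (next rho); split.
- by rewrite invr_gt0 sqrtr_gt0.
- exact: next_bint.
- exact: next_perp.
- apply: le_trans (next_contract br pr) _; rewrite exprS -[leRHS]mulrA.
  by apply: ler_wpM2l nr; lra.
split; first by rewrite /= -/(power_iter 0 (ind 1) k) wE rough_step.
move=> _; split; first by rewrite exprVn sqr_sqrtr ?ltW// mulVf// gt_eqF.
move=> s; apply: le_trans (next_sup s br) _; rewrite exprS.
move: (_ ^+ k) (ip rho rho) p0 nr => p n p0 nr; lra.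
Qed.

(** Turns the rate [54/100] of the squared remainder into [exp (- k / 2)], so [rho] itself is below
    [exp (- k / 4)]. *)
Lemma expR_half : 54 / 100 <= expR (- (1 / 2)) :> R.
Proof.
have e : expR (- (1 / 2)) = expR (- (1 / 4)) * expR (- (1 / 4)) :> R by rewrite -expRD; congr expR; field.
have h : 3 / 4 <= expR (- (1 / 4)) :> R by apply: le_trans (expR_ge1Dx _); lra.
rewrite e; apply: (@le_trans _ _ (3 / 4 * (3 / 4))); first by lra.
by apply: ler_pM; lra.
Qed.

Lemma rough_profile k : (0 < k)%N -> exists c rho, [/\ 0 < c, 1 / 2 <= c ^+ 2 <= 2, bint rho,
  ip (@e1 R) rho = 0 /\ ip rho rho <= 16 / 100 &
  (forall s, `|rho s| <= expR (- (k%:R / 4))) /\ @u_rough R k = (fun s => c * (e1 s + rho s))].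
Proof.
move=> k0; have [c [rho [c0 br pr nr [wE H]]]] := rough_iter k.
have [cE rs] := H k0; have bn := next_bint br.
have pk : (54 / 100) ^+ k <= 54 / 100 :> R.
  rewrite -[leRHS]expr1; apply: ler_wiXn2l => //; lra.
have n0 := inner_ge0 rho; have nr' : ip rho rho <= 16 / 100.
  by move: (_ ^+ k) (ip rho rho) pk nr => p n *; lra.
have nn := next_contract br pr; have nn0 := inner_ge0 (next rho).
have par := inner_parallel br bn.
have bs := bintD be br; have bs' := bintD be bn.
pose q := c ^+ 2 * lam * (1 + ip rho (next rho)).
have qE : ip (power_iter 0 (ind 1) k) (B0 (power_iter 0 (ind 1) k)) = q.
  rewrite wE B0_profile// innerZl//; last exact: bintZ.
  by rewrite innerZr// inner_profile//; [rewrite /q; ring|exact: next_perp].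
have /andP[l1 l2] := lam_bounds R; rewrite -/lam in l1 l2.
have c1 : 86 / 100 <= c ^+ 2.
  by move: (c ^+ 2) (ip rho rho) cE n0 nr' => d n cE n0 n1; nra.
have c2 : c ^+ 2 <= 1.
  by move: (c ^+ 2) (ip rho rho) (sqr_ge0 c) cE n0 nr' => d n d0 cE n0 n1; nra.
have r1 : `|ip rho (next rho)| <= 14 / 100.
  by move: (`|_|) (ip rho rho) (ip (next rho) (next rho)) par nn nr' => x n n' *; lra.
have [r2 r3] : 86 / 100 <= 1 + ip rho (next rho) /\ 1 + ip rho (next rho) <= 114 / 100.
  exact: one_plus_arith.
have [q0 qc1 qc2] := rough_arith c1 c2 l1 l2 r2 r3.
exists (Num.sqrt q * c), rho; split => //.
- by rewrite mulr_gt0// sqrtr_gt0.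
- by rewrite exprMn (sqr_sqrtr (ltW q0)) qc1 qc2.
split => [s|].
  rewrite -(@ler_pXn2r _ 2)// ?nnegrE ?expR_ge0// real_normK ?num_real//.
  apply: le_trans (rs s) _; rewrite expr2 -expRD.
  have -> : - (k%:R / 4) + - (k%:R / 4) = k%:R * - (1 / 2) :> R by field.
  by rewrite expRM_natl; apply: lerXn2r; rewrite ?nnegrE; (exact: expR_half || exact: expR_ge0 || lra).
by rewrite /u_rough PmE ?qE ?wE; [apply/funext => s; rewrite mulrA|exact: ind_bint].
Qed.

End RoughTemplate.

(** * Refinement near the true angle *)

Section PowerArith.
Variable R : realType.
Implicit Types A B L x p F W N k m r z : R.

Lemma error_arith A B z k : 0 <= k -> A * (133 / 100) <= k -> B <= 153 / 100 * z -> z <= k * (142 / 100) -> A + B <= 3 * k.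
Proof. by move=> *; lra. Qed.

(* [x] and [p] are the components of the iterate and of its image under the
   perturbation along the template, [F] the squared norm of that image. *)
Lemma step_arith L x p F W k : 0 < L -> L ^+ 2 = 2 -> 0 < x -> L * W <= 2 * x ^+ 2 -> 0 < W ->
  k <= 36 / 1000 -> p ^+ 2 <= L * F -> F <= k * W -> 0 <= F ->
  let y := L * x + p in let N := x ^+ 2 * L + 2 * x * p + F in
  [/\ 0 < y, 0 < N & L - y ^+ 2 / N <= 153 / 100 * k * L].
Proof.
move=> L0 L2 x0 LW W0 k1 pF FW F0 y N.
have aux (n w : R) : 656 / 1000 * w <= n -> 0 < w -> w <= 153 / 100 * n by move=> *; lra.
have Lx0 : 0 < L * x by rewrite mulr_gt0.
have Lx2 : (L * x) ^+ 2 = 2 * x ^+ 2 by rewrite exprMn L2.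
have k0 : 0 <= k by rewrite -(pmulr_lge0 _ W0); exact: le_trans F0 FW.
have p2 : p ^+ 2 <= k * (L * x) ^+ 2.
  apply: le_trans pF _; apply: le_trans (ler_wpM2l (ltW L0) FW) _.
  by rewrite mulrCA Lx2; apply: ler_wpM2l.
(* [(19/100)^2 = 0.0361] covers [k <= 36/1000]. Below, [656/1000] is [(81/100)^2] rounded down and
   [153/100] its inverse rounded up. *)
have p3 : p ^+ 2 <= (19 / 100 * (L * x)) ^+ 2.
  apply: le_trans p2 _; rewrite [leRHS]exprMn; apply: ler_wpM2r; first exact: sqr_ge0.
  by rewrite expr2; lra.
have p4 : `|p| <= 19 / 100 * (L * x).
  have q0 : 0 <= 19 / 100 * (L * x) by apply: mulr_ge0; [lra|exact: ltW].
  by rewrite -(@ler_pXn2r _ 2)// ?nnegrE// real_normK ?num_real.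
have y1 : 81 / 100 * (L * x) <= y.
  by move: p4; rewrite ler_norml /y => /andP[]; move: (L * x) => z *; lra.
have y0 : 0 < y by apply: lt_le_trans y1; apply: mulr_gt0; [lra|exact: Lx0].
have y2 : 656 / 1000 * (L * W) <= y ^+ 2.
  have h1 : 81 / 100 * (L * x) * (81 / 100 * (L * x)) <= y ^+ 2.
    have z0 : 0 <= 81 / 100 * (L * x) by apply: mulr_ge0; [lra|exact: ltW].
    by rewrite expr2; exact: (ler_pM z0 z0 y1 y1).
  have h2 : 81 / 100 * (L * x) * (81 / 100 * (L * x)) = 81 / 100 * (81 / 100) * (L * x) ^+ 2 by ring.
  rewrite h2 Lx2 in h1; have := mulr_gt0 L0 W0.
  by move: (y ^+ 2) (x ^+ 2) (L * W) LW h1 => Y X V *; lra.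
(* Up to the factor [L], the left side is the squared norm of the image orthogonal to the template.
   The rank one part cancels, and with it the misalignment of the previous iterate. *)
have NL : N * L - y ^+ 2 = L * F - p ^+ 2.
  rewrite /N /y; have -> : (x ^+ 2 * L + 2 * x * p + F) * L = L ^+ 2 * x ^+ 2 + 2 * x * p * L + F * L by ring.
  by rewrite L2 sqrrD exprMn L2; ring.
have NLge : y ^+ 2 <= N * L by rewrite -subr_ge0 NL subr_ge0.
have N1 : 656 / 1000 * W <= N.
  rewrite -(ler_pM2r L0); apply: le_trans NLge; by rewrite -[leLHS]mulrA (mulrC W L).
have N0 : 0 < N by apply: lt_le_trans N1; apply: mulr_gt0; [lra|exact: W0].
split => //.
have -> : L - y ^+ 2 / N = (N * L - y ^+ 2) / N by field; rewrite gt_eqF.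
rewrite ler_pdivrMr// NL.
apply: (@le_trans _ _ (L * (k * W))).
  by rewrite lerBlDr; apply: le_trans (ler_wpM2l (ltW L0) FW) _; rewrite lerDl sqr_ge0.
have -> : 153 / 100 * k * L * N = L * (k * (153 / 100 * N)) by ring.
apply: ler_wpM2l; first exact: ltW.
apply: ler_wpM2l => //.
exact: aux.
Qed.

(** The squared error splits into the scaling error [(m - x)^2] and the misalignment [L - x^2]. The
    former is small because [(m - x) (m + x) = r] while [x^2] is bounded below. *)
Lemma final_arith L x r k : 0 < L -> L ^+ 2 = 2 -> 0 < x -> L - x ^+ 2 <= 153 / 100 * k * L -> 0 <= k -> k <= 36 / 1000 ->
  r ^+ 2 <= k -> forall m, m = Num.sqrt (x ^+ 2 + r) -> m ^+ 2 - 2 * m * x + L <= 3 * k.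
Proof.
move=> L0 L2 x0 xL k0 k1 rk m mE.
have L1 : L <= 142 / 100.
  have [//|h] := leP L (142 / 100).
  have : 142 / 100 * (142 / 100) <= L ^+ 2 by rewrite expr2; apply: ler_pM; lra.
  by rewrite L2; lra.
have L3 : 141 / 100 <= L.
  have [//|h] := leP (141 / 100) L.
  have : L ^+ 2 <= 141 / 100 * (141 / 100) by rewrite expr2; apply: ler_pM; lra.
  by rewrite L2; lra.
have kL : k * L <= k * (142 / 100) by apply: ler_wpM2l.
have x2 : 133 / 100 <= x ^+ 2.
  by move: (x ^+ 2) xL kL => X; rewrite -mulrA; move: (k * L) => z *; lra.
have r1 : `|r| <= 19 / 100.
  have q0 : 0 <= 19 / 100 :> R by lra.
  rewrite -(@ler_pXn2r _ 2)// ?nnegrE// real_normK ?num_real//; apply: le_trans rk _.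
  by rewrite expr2; lra.
have mu0 : 0 <= x ^+ 2 + r.
  by move: r1; rewrite ler_norml => /andP[]; move: (x ^+ 2) x2 => X *; lra.
have m0 : 0 <= m by rewrite mE sqrtr_ge0.
have m2 : m ^+ 2 = x ^+ 2 + r by rewrite mE sqr_sqrtr.
have mx : (m - x) ^+ 2 * (m + x) ^+ 2 = r ^+ 2.
  by rewrite -exprMn -subr_sqr m2 addrAC subrr add0r.
have mx2 : (m - x) ^+ 2 * (133 / 100) <= k.
  apply: le_trans rk; rewrite -mx; apply: ler_wpM2l; first exact: sqr_ge0.
  apply: le_trans x2 _; rewrite lerXn2r ?nnegrE//; [exact: ltW|exact: addr_ge0 m0 (ltW x0)|by rewrite lerDr].
have -> : m ^+ 2 - 2 * m * x + L = (m - x) ^+ 2 + (L - x ^+ 2) by ring.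
rewrite -mulrA in xL; exact: (error_arith k0 mx2 xL kL).
Qed.

End PowerArith.

(** * The rotated kernel as a perturbation of rank one *)

Section Perturbed.
Variable R : realType.
Variables (nu eta : R).
Let d := `|sin (nu - nu_nat R)|.
Hypothesis c0 : 0 <= cos (nu - nu_nat R).
Hypothesis d1 : d <= eta.
Hypothesis eta1 : eta <= 1 / 256.
Implicit Types (s t : R) (w f : R -> R).
Local Notation bint := (bint (@leb R)).
Local Notation ip := (@inner R).
Local Notation u := (ind (alpha R)).
Let a := alpha R.
Let a0 : 0 < a := alpha_gt0 R.
Let d0 : 0 <= d. Proof. exact: normr_ge0. Qed.

Let A := a * (1 + d).
Let B := a * (1 - d).
Let h s : R := ind A s.
Let g s : R := ind A s + -1 * ind B s.

Let BA : B <= A. Proof. by apply: ler_wpM2l; [exact: ltW a0|have := d0; lra]. Qed.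
Let aA : a <= A. Proof. by rewrite /A ler_peMr ?(ltW a0)// lerDl; exact: d0. Qed.
Let Ba : B <= a. Proof. by rewrite /B ler_piMr ?(ltW a0)// lerBlDr lerDl; exact: d0. Qed.
Let B0' : 0 <= B. Proof. by apply: mulr_ge0; [exact: ltW a0|have := d1; have := eta1; lra]. Qed.

Let g_ge0 s : 0 <= g s.
Proof. by rewrite /g mulN1r subr_ge0 ind_mono. Qed.

Let g1 s : B < `|s| -> `|s| <= A -> g s = 1.
Proof. by move=> h1 h2; rewrite /g (ind0 h1) (ind1 h2) mulr0 addr0. Qed.

Let G s t := g s * h t + h s * g t.
Let G_ge0 s t : 0 <= G s t.
Proof. by rewrite addr_ge0// mulr_ge0 ?g_ge0 ?ind_ge0. Qed.

Let cle : `|cos (nu - nu_nat R)| <= 1.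
Proof. by rewrite ler_norml cos_geN1 cos_le1. Qed.

(** The rotated square reaches at most [A = a (1 + d)] in each coordinate, and a point of the
    template outside it has a coordinate beyond [B = a (1 - d)]. The two squares differ only where
    one coordinate lies in the strip selected by [g] and the other is at most [A]. *)
Lemma Xrot_near s t : `|Xrot nu (s, t) - u s * u t| <= G s t.
Proof.
have [sa|sa] := leP `|s| a; have [ta|ta] := leP `|t| a.
- rewrite (ind1 sa) (ind1 ta) mulr1 XrotE.
  have hs : h s = 1 by rewrite /h ind1// (le_trans sa).
  have ht : h t = 1 by rewrite /h ind1// (le_trans ta).
  have [p|p] := leP `|cos (nu - nu_nat R) * s - sin (nu - nu_nat R) * t| a.
    have [q|q] := leP `|sin (nu - nu_nat R) * s + cos (nu - nu_nat R) * t| a.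
      by rewrite (ind1 p) (ind1 q) mulr1 subrr normr0 G_ge0.
    have gt : g t = 1.
      apply: g1; last exact: le_trans ta aA.
      rewrite /B mulrBr mulr1 ltrBlDr; apply: lt_le_trans q _.
      apply: le_trans (ler_normD _ _) _; rewrite !normrM addrC -/d; apply: lerD.
        by rewrite ler_piMl.
      by rewrite mulrC; apply: ler_wpM2r => //; exact: d0.
    by rewrite (ind0 q) mulr0 sub0r normrN1 /G hs gt mulr1 lerDr mulr_ge0// ?g_ge0// ind_ge0.
  have gs : g s = 1.
    apply: g1; last exact: le_trans sa aA.
    rewrite /B mulrBr mulr1 ltrBlDr; apply: lt_le_trans p _.
    apply: le_trans (ler_normB _ _) _; rewrite !normrM -/d; apply: lerD.
      by rewrite ler_piMl.
    by rewrite mulrC; apply: ler_wpM2r => //; exact: d0.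
  by rewrite (ind0 p) mul0r sub0r normrN1 /G ht gs mulr1 lerDl mulr_ge0// ?g_ge0// ind_ge0.
all: rewrite ?(ind0 sa) ?(ind0 ta) ?mul0r ?mulr0 subr0.
all: have [->|X0] := eqVneq (Xrot nu (s, t)) 0; first by rewrite normr0 G_ge0.
all: have [s1 t1] := Xrot_reach X0; rewrite -/d -/a in s1 t1.
all: have rA : a * (`|cos (nu - nu_nat R)| + d) <= A by rewrite /A ler_wpM2l ?(ltW a0)// lerD2r.
all: have {}s1 := le_trans s1 rA; have {}t1 := le_trans t1 rA.
all: have X1 : `|Xrot nu (s, t)| <= 1 by have /andP[x0 x1] := Xrot_01 nu (s, t); rewrite ger0_norm.
all: apply: le_trans X1 _.
- by rewrite /G (g1 (le_lt_trans Ba ta) t1) /h (ind1 s1) mulr1 lerDr mulr_ge0// ?g_ge0// ind_ge0.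
- by rewrite /G (g1 (le_lt_trans Ba sa) s1) /h (ind1 t1) mulr1 lerDl mulr_ge0// ?g_ge0// ind_ge0.
- by rewrite /G (g1 (le_lt_trans Ba sa) s1) /h (ind1 t1) mulr1 lerDl mulr_ge0// ?g_ge0// ind_ge0.
Qed.

Definition ek (z : R * R) : R := Bk nu z + -1 * tens u u z.

Lemma ek_near s t : `|ek (s, t)| <= G s t.
Proof.
have h1 := Xrot_near s t; have h2 := Xrot_near t s; rewrite (mulrC (u t)) in h2.
have G2 : G t s = G s t by rewrite /G addrC (mulrC (h t)) (mulrC (g t)).
rewrite G2 in h2; rewrite /ek /Bk /tens/=; move: h1 h2; rewrite !ler_norml.
move: (Xrot _ _) (Xrot _ _) (u s * u t) (G s t) => X Y U V /andP[? ?] /andP[? ?].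
by apply/andP; split; lra.
Qed.

Let uu_le s t : 0 <= u s * u t <= ind 2 s * ind 2 t.
Proof.
have a2 : a <= 2 by apply: le_trans (alpha_le1 R) _; lra.
by rewrite mulr_ge0 ?ind_ge0//= ler_pM ?ind_ge0 ?ind_mono.
Qed.

Lemma ek_ck s t : `|ek (s, t)| <= ind 2 s * ind 2 t.
Proof.
have := uu_le s t; have := Bk_le nu s t; have := Bk_ge0 nu (s, t); rewrite /ek /tens/= ler_norml.
by move: (Bk _ _) (u s * u t) (_ * ind 2 t) => X Y Z ? ? /andP[? ?]; apply/andP; split; lra.
Qed.

Lemma ek_meas : measurable_fun setT ek.
Proof.
have mu : measurable_fun setT u by exact: bint_mf (ind_bint a).
apply: measurable_funD; first exact: Bk_meas.
by apply: measurable_funM => //; exact: tens_m.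
Qed.

Definition Eop w : R -> R := kop (@leb R) ek w.

Lemma Eop_bint w : bint w -> bint (Eop w).
Proof. by move=> bw; apply: op_bint => //; [exact: ek_meas|exact: ek_ck]. Qed.

Lemma Bop_split w : bint w -> Bop nu w = (fun s => ip u w * u s + Eop w s).
Proof.
move=> bw; apply/funext => s; have bu := ind_bint a.
have br := ck_row_bint ek_meas ek_ck s.
rewrite /Bop /Eop !opE (mulrC (ip u w)) -innerZl//.
rewrite -innerDl//; last exact: bintZ.
congr Rintegral; apply/funext => t; rewrite /ek /tens/=; ring.
Qed.

Let bh : bint h. Proof. exact: ind_bint. Qed.
Let bg : bint g. Proof. by apply: bintD; [exact: ind_bint|apply: bintZ; exact: ind_bint]. Qed.

Let Ih : Rintegral (@leb R) setT h = 2 * A.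
Proof. by rewrite Rint_ind// (le_trans B0'). Qed.

Let Ig : Rintegral (@leb R) setT g = 4 * (a * d).
Proof.
have b1 := ind_bint A; have b2 := bintZ (-1) (ind_bint B).
rewrite /g (RintegralD measurableT (bint_int b1) (bint_int b2)) (RintegralZl _ measurableT (bint_int (ind_bint B))).
rewrite !Rint_ind//; last exact: le_trans B0' BA.
by rewrite /A /B; ring.
Qed.

(** The kernel of the perturbation is at most 1 in absolute value and lives on strips of width
    proportional to [d], so its squared Hilbert-Schmidt norm is linear in [d]: at most
    [8 d (1 + d)]. This linearity is the source of the square root of [eps] in the final error. *)
Lemma Eop_sq w : bint w -> ip (Eop w) (Eop w) <= 9 * eta * ip w w.
Proof.
move=> bw; have b1 := bintZ (2 * A) bg; have b2 := bintZ (4 * (a * d)) bh.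
have bG := bintD b1 b2.
have row s : ip (fun t => ek (s, t)) (fun t => ek (s, t)) <= 2 * A * g s + 4 * (a * d) * h s.
  have br := ck_row_bint ek_meas ek_ck s.
  have bg' := bintZ (h s) bg; have bh' := bintZ (g s) bh.
  rewrite [leRHS]addrC.
  have -> : 4 * (a * d) * h s + 2 * A * g s = Rintegral (@leb R) setT (fun t => h s * g t + g s * h t).
    rewrite (RintegralD measurableT (bint_int bg') (bint_int bh')).
    rewrite (RintegralZl _ measurableT (bint_int bg)) (RintegralZl _ measurableT (bint_int bh)) Ih Ig.
    by rewrite mulrC (mulrC (g s)).
  apply: le_Rintegral => //; [exact: (bint_int (bintMM br br))|exact: (bint_int (bintD bg' bh'))|].
  move=> t _; rewrite addrC; apply: le_trans (ek_near s t).
  rewrite -expr2 -real_normK ?num_real// expr2 ler_piMr//.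
  exact: ck_le1 ek_ck s t.
apply: le_trans (op_sq_le ek_meas ek_ck bw bG row) _.
apply: ler_wpM2r; first exact: inner_ge0.
rewrite (RintegralD measurableT (bint_int b1) (bint_int b2)).
rewrite (RintegralZl _ measurableT (bint_int bg)) (RintegralZl _ measurableT (bint_int bh)) Ih Ig.
have -> : 2 * A * (4 * (a * d)) + 4 * (a * d) * (2 * A) = 16 * a ^+ 2 * (d * (1 + d)) by rewrite /A; ring.
rewrite alpha2; have := d0; have := d1; have := eta1; move: d => y e1 e2 e3.
have : y * (1 + y) <= eta * (1 + 1 / 256) by apply: ler_pM; lra.
move: (y * _) => z hz; lra.
Qed.

Let L := ip u u.
Let LE : L = 2 * a. Proof. by rewrite /L inner_ind// ltW. Qed.
Let L0 : 0 < L. Proof. by rewrite LE mulr_gt0. Qed.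
Let L2 : L ^+ 2 = 2. Proof. by rewrite LE exprMn alpha2; field. Qed.
Let k := 9 * eta.
Let k0 : 0 <= k. Proof. by rewrite /k; apply: mulr_ge0; [lra|exact: le_trans d0 d1]. Qed.
Let k1 : k <= 36 / 1000. Proof. by have := eta1; rewrite /k; move: eta => e; lra. Qed.
Let bu : bint u. Proof. exact: ind_bint. Qed.

Definition aligned w := [/\ bint w, ip w w = 1, 0 < ip u w & L - ip u w ^+ 2 <= 153 / 100 * k * L].

Lemma power_step_aligned w : bint w -> 0 < ip u w -> 0 < ip w w -> L * ip w w <= 2 * ip u w ^+ 2 ->
  aligned (power_step nu w).
Proof.
move=> bw x0 W0 LW; have bE := Eop_bint bw; have bux := bintZ (ip u w) bu.
have bB := Bop_bint nu bw.
have pF := inner_CS bu bE.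
have [y0 N0 LN] := step_arith L0 L2 x0 LW W0 k1 pF (Eop_sq bw) (inner_ge0 _).
have yE : ip u (Bop nu w) = L * ip u w + ip u (Eop w).
  by rewrite Bop_split// innerDr// innerZr// mulrC.
have NE : ip (Bop nu w) (Bop nu w) = ip u w ^+ 2 * L + 2 * ip u w * ip u (Eop w) + ip (Eop w) (Eop w).
  rewrite Bop_split// innerDl//; last exact: bintD.
  by rewrite !innerDr// !innerZl// !innerZr// (innerC (Eop w)) /L; ring.
rewrite -yE in y0 LN; rewrite -NE in N0 LN.
have sN : 0 < Num.sqrt (ip (Bop nu w) (Bop nu w)) by rewrite sqrtr_gt0.
have nE : nrm (Bop nu w) ^+ 2 = ip (Bop nu w) (Bop nu w) by rewrite sqr_sqrtr// ltW.
rewrite /aligned power_stepE//; split.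
- exact: bintZ.
- rewrite (innerZl _ bB (bintZ _ bB)) (innerZr _ bB bB) mulrA -expr2 exprVn nE mulVf//.
  by rewrite gt_eqF.
- by rewrite (innerZr _ bB bu) mulr_gt0// invr_gt0.
by rewrite (innerZr _ bB bu) exprMn exprVn nE mulrC.
Qed.

(** Since [153/100 * 36/1000 < 1/2], an aligned unit vector again meets the entry condition of
    [power_step_aligned]. *)
Lemma aligned_next w : aligned w -> aligned (power_step nu w).
Proof.
move=> [bw w1 x0 xL]; apply: power_step_aligned => //; rewrite ?w1 ?ltr01//.
rewrite mulr1; have := k1; have := L0; move: xL; move: (ip u w ^+ 2) L k => X l q h1 h2 h3.
have : q * l <= 36 / 1000 * l by apply: ler_wpM2r => //; exact: ltW.
move: h1; rewrite -mulrA; move: (q * l) => z *; lra.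
Qed.

Lemma power_iter_aligned w j : bint w -> 0 < ip u w -> 0 < ip w w -> L * ip w w <= 2 * ip u w ^+ 2 ->
  aligned (power_iter nu w j.+1).
Proof.
move=> bw x0 W0 LW; elim: j => [|j IH]; first exact: power_step_aligned.
by rewrite /power_iter iterS; exact: aligned_next IH.
Qed.

Lemma Pm_error w j : bint w -> 0 < ip u w -> 0 < ip w w -> L * ip w w <= 2 * ip u w ^+ 2 -> (0 < j)%N ->
  ip (fun s => Pm j w nu s - u s) (fun s => Pm j w nu s - u s) <= 27 * eta.
Proof.
case: j => // j bw x0 W0 LW _.
have [bv v1 y0 yL] := power_iter_aligned j bw x0 W0 LW.
rewrite PmE//; move: (power_iter nu w j.+1) bv v1 y0 yL => v bv v1 y0 yL.
have bE := Eop_bint bv; have bux := bintZ (ip u v) bu.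
have r2 : ip v (Eop v) ^+ 2 <= k.
  apply: le_trans (inner_CS bv bE) _; rewrite v1 mul1r.
  by have := Eop_sq bv; rewrite v1 mulr1.
have muE : ip v (Bop nu v) = ip u v ^+ 2 + ip v (Eop v).
  by rewrite Bop_split// innerDr// innerZr// (innerC v u) expr2.
rewrite muE; set m := Num.sqrt _.
have fin := final_arith L0 L2 y0 yL k0 k1 r2 (erefl m).
have bm := bintZ m bv; have bu' := bintZ (-1) bu.
have -> : (fun s => m * v s - u s) = (fun s => m * v s + -1 * u s).
  by apply/funext => s; rewrite mulN1r.
rewrite innerDl//; last exact: bintD.
rewrite !innerDr// !innerZl// !innerZr// v1 (innerC v u) -/L.
have -> : m * (m * 1) + m * (-1 * ip u v) + (-1 * (m * ip u v) + -1 * (-1 * L)) = m ^+ 2 - 2 * m * ip u v + L by ring.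
by apply: le_trans fin _; rewrite /k mulrA -natrM.
Qed.

End Perturbed.

(** * Gradient descent *)

Section Angle.
Variable R : realType.
Implicit Types (x y p nu : R).

(** The folded remainder is the distance from [x] to the lattice of multiples of [p]. An integer
    witness can be carried along under translations by the period. *)
Lemma rmod_min_le p x y : 0 < p ->
  Num.min (rmod `|x| p) (p - rmod `|x| p) <= y <-> exists n : int, `|x - n%:~R * p| <= y.
Proof.
move=> p0; rewrite /rmod; set n0 := Num.floor (`|x| / p).
have /andP[f1 f2] := floor_itv (`|x| / p); rewrite -/n0 in f1 f2.
have m0 : 0 <= `|x| - p * n0%:~R by rewrite subr_ge0 mulrC -ler_pdivlMr.
have m1 : `|x| - p * n0%:~R < p.
  by move: f2; rewrite ltr_pdivrMr// intrD mulrDl mul1r ltrBlDl mulrC addrC (mulrC p).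
have flip (n : int) : `| `|x| - n%:~R * p| <= y -> exists n : int, `|x - n%:~R * p| <= y.
  have [x0|x0] := leP 0 x; first by move=> h; exists n; move: h; rewrite (ger0_norm x0).
  move=> h; exists (- n); move: h; rewrite (ltr0_norm x0) -normrN.
  by rewrite opprD !opprK mulrNz mulNr opprK.
have flip' (n : int) : `|x - n%:~R * p| <= y -> exists n : int, `| `|x| - n%:~R * p| <= y.
  have [x0|x0] := leP 0 x; first by move=> h; exists n; rewrite (ger0_norm x0).
  move=> h; exists (- n); move: h; rewrite (ltr0_norm x0) -normrN.
  by rewrite opprD !opprK mulrNz mulNr opprK.
split=> [|[n /flip'[{}n h]]].
  rewrite ge_min => /orP[h|h].
    by apply: (flip n0); rewrite mulrC ger0_norm.
  apply: (flip (n0 + 1)); rewrite distrC intrD mulrDl mul1r.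
  have -> : n0%:~R * p + p - `|x| = p - (`|x| - p * n0%:~R) by ring.
  by rewrite ger0_norm// subr_ge0 ltW.
rewrite ge_min; move: h; rewrite ler_norml => /andP[h1 h2].
have [nn|nn] := leP n n0; apply/orP; [left|right].
  apply: le_trans h2; rewrite lerD2l lerN2 mulrC; apply: ler_wpM2l; first exact: ltW.
  by rewrite ler_int.
rewrite lerNl in h1; apply: le_trans h1.
have : (n0 + 1)%:~R <= n%:~R :> R by rewrite ler_int lezD1.
rewrite -(ler_pM2r p0) intrD mulrDl mul1r opprB; move: (n%:~R * p) (mulrC p n0%:~R) => X ->.
by move: (n0%:~R * p) `|x| => Y Z h; lra.
Qed.

Lemma angle_errP nu y : angle_err nu <= y <-> exists n : int, `|nu - nu_nat R - n%:~R * (pi / 2)| <= y.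
Proof. exact: (rmod_min_le _ _ (pi2_gt0 R)). Qed.

End Angle.

Section Periodicity.
Variable R : realType.
Implicit Types (nu s beta : R) (u : R -> R) (n : int).

Lemma grad_loss_period s nu u n : grad_loss s (nu + n%:~R * (pi / 2)) u = grad_loss s nu u.
Proof.
have derive1_period (f : R -> R) (p x : R) : (forall v, f (v + p) = f v) -> derive1 f (x + p) = derive1 f x.
  move=> fp; rewrite /derive1.
  have -> : (fun h : R => h^-1 *: (f (h + (x + p)) - f (x + p))) = (fun h : R => h^-1 *: (f (h + x) - f x)).
    by apply/funext => h; rewrite addrA !fp.
  by [].
by apply: derive1_period => v; rewrite /loss Xrot_period.
Qed.

Lemma gd_period s beta u nu n k : gd s beta u (nu + n%:~R * (pi / 2)) k = gd s beta u nu k + n%:~R * (pi / 2).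
Proof. by elim: k => //= k ->; rewrite grad_loss_period addrAC. Qed.

Lemma Pm_period k u nu n : Pm k u (nu + n%:~R * (pi / 2)) = Pm k u nu.
Proof.
have H : Aop (nu + n%:~R * (pi / 2)) = Aop nu by rewrite /Aop Xrot_period.
by rewrite /Pm /power_iter /power_step H.
Qed.

End Periodicity.

(** * Contraction of the angular error *)

Section Descent.
Variable R : realType.
Variables (s beta c tol : R) (rho : R -> R).
Hypothesis s0 : 0 < s.
Hypothesis s2 : s ^+ 2 <= (10 ^+ 4)^-1.
Hypothesis b0 : 0 < beta.
Hypothesis b1 : beta <= 1 / 20.
Hypothesis c1 : 1 / 2 <= c ^+ 2.
Hypothesis c2 : c ^+ 2 <= 2.
Hypothesis br : bint (@leb R) rho.
Hypothesis rt : forall x, `|rho x| <= tol.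
Hypothesis t1 : tol <= 1 / 2000.
Implicit Types (d nu : R).
Let u x := c * (e1 x + rho x).
Let Phi d := flux (kk s (@e1 R)) (alpha R) d.
Let q := c ^+ 2.
(** The contraction rate: [1/50] is the flux constant [1/40] times the lower bound [4/5] for
    [sin d / d] on the window, and [q] enters because the flux is quadratic in the profile. *)
Let r := beta * q / 50.
Let D : R := pi / 7.

Let r0 : 0 < r.
Proof. by rewrite /r divr_gt0// mulr_gt0// /q; have := c1; lra. Qed.

Let bq : beta * q <= 1 / 10.
Proof.
have : beta * q <= 1 / 20 * 2.
  by apply: ler_pM; [exact: ltW b0|exact: sqr_ge0|exact: b1|exact: c2].
by move: (beta * q) => z; lra.
Qed.

Let r1 : r <= 1.
Proof. by have := bq; rewrite /r; move: (beta * q) => z; lra. Qed.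

Let bq0 : 0 <= beta * q. Proof. by apply: mulr_ge0; [exact: ltW b0|exact: sqr_ge0]. Qed.

Let D1 : D <= 16 / 35.
Proof. by rewrite /D; have := pi_lt R; move: (pi : R) => p; lra. Qed.

Let sin_lower d : 0 <= d -> d <= D -> 4 / 5 * d <= sin d.
Proof.
move=> d0 dD; apply: le_trans (sin_ge3 d0).
have h : d <= 16 / 35 by apply: le_trans dD D1.
have d2 : d ^+ 2 <= 16 / 35 * (16 / 35) by rewrite expr2; apply: ler_pM.
have -> : d - d ^+ 3 / 6 = (1 - d ^+ 2 / 6) * d by field.
by apply: ler_wpM2r => //; move: (d ^+ 2) d2 => z; lra.
Qed.

(** From [beta <= 1/20] and [q <= 2], the upper flux bound [10 sin d] limits the step to at most
    [d]. The iterate cannot change sign, and the lower flux bound gives the contraction. *)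
Let step_pos d : 0 <= d -> d <= D -> `|d + beta * (q * Phi d)| <= (1 - r) * d.
Proof.
move=> d0 dD; have [h1 h2] := flux_e1_bounds s0 s2 d0 dD.
have sl := sin_lower d0 dD; have su := sin_le_id d0.
rewrite -/(Phi d) in h1 h2; rewrite mulrA.
have e1 : beta * q * (- Phi d) <= 1 / 10 * (10 * d).
  apply: le_trans (ler_wpM2l bq0 h2) _; apply: ler_pM; [exact: bq0| |exact: bq|].
    by apply: mulr_ge0; [lra|apply: le_trans sl; lra].
  by apply: ler_wpM2l su; lra.
have e2 : beta * q * (d / 50) <= beta * q * (- Phi d).
  apply: ler_wpM2l; first exact: bq0.
  by apply: le_trans h1; move: (sin d) sl => z hz; lra.
rewrite ger0_norm; last by move: e1; rewrite mulrN; move: (beta * q * _) => z hz; lra.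
have -> : (1 - r) * d = d - beta * q * (d / 50) by rewrite /r; field.
by move: e2; rewrite mulrN; move: (beta * q * _) (beta * q * _) => z w hz; lra.
Qed.

Let PhiN d : Phi (- d) = - Phi d. Proof. exact: flux_e1_odd. Qed.

Let step_odd d : `|d| <= D -> `|d + beta * (q * Phi d)| <= (1 - r) * `|d|.
Proof.
have [d0|d0] := leP 0 d; first by rewrite (ger0_norm d0); exact: step_pos.
rewrite (ltr0_norm d0) => h; have := @step_pos (- d) _ h.
rewrite oppr_ge0 (ltW d0) => /(_ isT); rewrite PhiN !mulrN -opprD normrN.
exact.
Qed.

(** The gradient error [12 q tol], measured in units of the rate [r = beta q / 50], becomes
    [600 * tol]. *)
Let step_noisy nu : `|nu - nu_nat R| <= D ->
  `|nu - beta * grad_loss s nu u - nu_nat R| <= (1 - r) * `|nu - nu_nat R| + r * (600 * tol).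
Proof.
move=> nD; have bu : bint (@leb R) u by apply: bintZ; apply: bintD br; exact: e1_bint.
rewrite grad_lossE// mulrN opprK.
set d := nu - nu_nat R; set f := flux _ _ _.
have t1' : tol <= 1 by apply: le_trans t1 _; lra.
have near : `|f - q * Phi d| <= q * (12 * tol) := flux_rough s0 c d br rt t1'.
have -> : nu + beta * f - nu_nat R = (d + beta * (q * Phi d)) + beta * (f - q * Phi d) by rewrite /d; ring.
apply: le_trans (ler_normD _ _) _; apply: lerD; first exact: step_odd.
rewrite normrM (gtr0_norm b0); apply: le_trans (ler_wpM2l (ltW b0) near) _.
by rewrite le_eqVlt; apply/orP; left; apply/eqP; rewrite /r; field.
Qed.

Let tol0 : 0 <= tol. Proof. exact: le_trans (rt 0). Qed.

Lemma gd_bound nu k : `|nu - nu_nat R| <= D ->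
  `|gd s beta u nu k - nu_nat R| <= (1 - r) ^+ k * D + 600 * tol.
Proof.
move=> nD; have p6 : 0 <= 600 * tol by apply: mulr_ge0; [lra|exact: tol0].
have q6 : 600 * tol <= D.
  by have := pi_gt R; have := t1; rewrite /D; move: (pi : R) => p *; lra.
have rr : 0 <= 1 - r by rewrite subr_ge0; exact: r1.
(* The induction also carries the invariance of the window, outside of which no flux bound is known;
   it holds because the noise floor [600 * tol] is below [D]. *)
suff [] : `|gd s beta u nu k - nu_nat R| <= D /\
   `|gd s beta u nu k - nu_nat R| <= (1 - r) ^+ k * D + 600 * tol by [].
elim: k => [|k [IH1 IH2]]; first by split=> //=; rewrite expr0 mul1r (le_trans nD)// lerDl.
rewrite /gd iterS -/(gd s beta u nu k).
have st := step_noisy IH1; split; apply: le_trans st _.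
  have -> : D = (1 - r) * D + r * D by ring.
  by apply: lerD; apply: ler_wpM2l => //; exact: ltW r0.
rewrite exprS; have -> : (1 - r) * (1 - r) ^+ k * D + 600 * tol =
  (1 - r) * ((1 - r) ^+ k * D + 600 * tol) + r * (600 * tol) by ring.
by rewrite lerD2r; apply: ler_wpM2l.
Qed.

(** As [q >= 1/2], the rate is at least [beta / 100], which explains the factor 100. The transient
    is then at most [3 eps * 16/35], and the noise floor adds [3/10 eps]. *)
Lemma gd_converges (eps : R) nu k : 0 < eps -> eps <= 768^-1 -> tol <= eps / 2000 ->
  - (100 * ln (3 * eps)) / beta <= k%:R -> `|nu - nu_nat R| <= D ->
  `|gd s beta u nu k - nu_nat R| <= 3 * eps.
Proof.
move=> e0 e1 te kb nD; apply: le_trans (gd_bound k nD) _.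
have e3 : 0 < 3 * eps by apply: mulr_gt0 => //; lra.
have rr : 0 <= 1 - r by rewrite subr_ge0; exact: r1.
have h1 : (1 - r) ^+ k <= expR (- r) ^+ k.
  by apply: lerXn2r; rewrite ?nnegrE// ?expR_ge0// expR_ge1Dx.
have h2 : k%:R * - r <= ln (3 * eps).
  rewrite mulrN lerNl; move: kb; rewrite ler_pdivrMr// -mulrN => kb.
  have : 100 * - ln (3 * eps) / 100 <= k%:R * beta / 100 by apply: ler_wpM2r kb; lra.
  rewrite mulrC mulrA mulVf ?mul1r => [kb'|]; last by rewrite pnatr_eq0.
  apply: le_trans kb' _.
  have -> : k%:R * r = k%:R * beta / 100 * (2 * q) by rewrite /r; field.
  apply: ler_peMr; last by have := c1; rewrite -/q; move: q => z; lra.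
  by apply: mulr_ge0; [apply: mulr_ge0; [exact: ler0n|exact: ltW]|lra].
have h3 : (1 - r) ^+ k <= 3 * eps.
  apply: le_trans h1 _; rewrite -expRM_natl -[leRHS]lnK ?posrE//.
  by rewrite ler_expR.
have h4 : (1 - r) ^+ k * D <= 3 * eps * (16 / 35).
  apply: ler_pM => //; first exact: exprn_ge0.
  by rewrite /D divr_ge0// ltW// pi_gt0.
by move: (_ * D) h4 te => z *; lra.
Qed.

End Descent.

(** * The set of good initial values *)

Section Alignment.
Variables (R : realType) (c : R) (rho : R -> R).
Hypothesis c0 : 0 < c.
Hypothesis br : bint (@leb R) rho.
Hypothesis pr : inner (@e1 R) rho = 0.
Hypothesis nr : inner rho rho <= 16 / 100.
Hypothesis rt : forall x, `|rho x| <= 1 / 100.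
Let w x := c * (e1 x + rho x).
Local Notation ip := (@inner R).
Local Notation u := (ind (alpha R)).

Lemma alpha_ge : 7 / 10 <= alpha R.
Proof.
have := alpha2 R; have := alpha_gt0 R; move: (alpha R) => b b0 b2.
have [//|h] := leP (7 / 10) b.
have : b ^+ 2 <= 7 / 10 * (7 / 10) by rewrite expr2; apply: ler_pM; lra.
by rewrite b2; lra.
Qed.

Lemma inner_u_e1 : 1 <= ip u (@e1 R).
Proof.
rewrite inner_ind_e1 ?alpha_le1 ?(ltW (alpha_gt0 R))//.
have /andP[l1 _] := lam_bounds R.
have y0 : 109 / 100 <= pi / 2 * alpha R.
  apply: (@le_trans _ _ (156 / 100 * (7 / 10))); first by lra.
  have p := pi_gt R; have al := alpha_ge; apply: ler_pM; [lra|lra| |exact: al].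
  by move: (pi : R) p => z hz; lra.
have y1 : pi / 2 * alpha R <= 114 / 100.
  apply: (@le_trans _ _ (16 / 10 * (708 / 1000))); last by lra.
  have p := pi_lt R; have al := alpha_le R; have p0 := pi2_gt0 R.
  apply: ler_pM; [exact: ltW p0|exact: ltW (alpha_gt0 R)| |exact: al].
  by move: (pi : R) p => z hz; lra.
move: (pi / 2 * alpha R) y0 y1 => y y0 y1.
have yp : 0 <= y by lra.
have ys := sin_ge3 yp.
have y2 : y ^+ 2 <= 114 / 100 * (114 / 100) by rewrite expr2; apply: ler_pM; lra.
have sy : 8 / 10 <= sin y.
  apply: le_trans ys; have -> : y - y ^+ 3 / 6 = y * (1 - y ^+ 2 / 6) by field.
  apply: (@le_trans _ _ (109 / 100 * (78 / 100))); first by lra.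
  by apply: ler_pM; [lra|lra|exact: y0|move: (y ^+ 2) y2 => z hz; lra].
apply: (@le_trans _ _ (125 / 100 * (8 / 10))); first by lra.
by apply: ler_pM; [lra|lra|exact: l1|exact: sy].
Qed.

(** The entry condition of the refinement: the squared cosine of the angle between the rough
    estimate and the template is at least one half. *)
Lemma rough_alignment : [/\ bint (@leb R) w, 0 < ip u w, 0 < ip w w & ip u u * ip w w <= 2 * ip u w ^+ 2].
Proof.
have be := @e1_bint R; have bs := bintD be br; have bu := @ind_bint R (alpha R).
have al := alpha_le R; have a0 := alpha_gt0 R.
have LE : ip u u = 2 * alpha R by rewrite inner_ind// ltW.
have ur : `|ip u rho| <= 15 / 1000.
  have bur := bintMM bu br; have buz := bintZ (1 / 100) bu.
  apply: le_trans (le_normr_Rintegral measurableT (bint_int bur)) _.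
  apply: (@le_trans _ _ (Rintegral (@leb R) setT (fun x => 1 / 100 * u x))).
    apply: le_Rintegral => //; [exact: (bint_int (bint_norm bur))|exact: (bint_int buz)|].
    by move=> x _; rewrite normrM (ger0_norm (ind_ge0 _ _)) mulrC; apply: ler_wpM2r; [exact: ind_ge0|exact: rt].
  rewrite (RintegralZl _ measurableT (bint_int bu)) (Rint_ind (ltW a0)).
  by move: (alpha R) al => a ha; lra.
have uw : ip u w = c * (ip u (@e1 R) + ip u rho) by rewrite /w innerZr// innerDr.
have ww : ip w w = c ^+ 2 * (1 + ip rho rho).
  rewrite /w innerZl//; last exact: bintZ.
  by rewrite innerZr// (inner_profile br br pr pr) mulrA expr2.
have x1 : 98 / 100 <= ip u (@e1 R) + ip u rho.
  have := inner_u_e1; move: ur; rewrite ler_norml => /andP[]; move: (ip u _) (ip u _) => X Y *; lra.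
have n0 := inner_ge0 rho.
split.
- exact: bintZ.
- by rewrite uw; apply: mulr_gt0 => //; apply: lt_le_trans x1; lra.
- rewrite ww; apply: mulr_gt0; first by rewrite exprn_gt0.
  by apply: lt_le_trans (_ : 0 < 1) _ => //; rewrite lerDl.
rewrite uw ww LE exprMn [leLHS]mulrCA [leRHS]mulrCA; apply: ler_wpM2l; first exact: sqr_ge0.
have x2 : 98 / 100 * (98 / 100) <= (ip u (@e1 R) + ip u rho) ^+ 2 by rewrite expr2; apply: ler_pM; [lra|lra|exact: x1|exact: x1].
have h : 2 * alpha R * (1 + ip rho rho) <= 2 * (708 / 1000) * (116 / 100).
  apply: ler_pM; [apply: mulr_ge0; [lra|exact: ltW]|exact: addr_ge0| |].
    by apply: ler_wpM2l => //.
  by move: (ip rho rho) nr => n hn; lra.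
by apply: le_trans h _; move: (_ ^+ 2) x2 => X hX; lra.
Qed.

End Alignment.

Section Success.
Variable R : realType.
Variables (sigma beta eps : R) (Tr Tnu Tu : nat).
Hypothesis s0 : 0 < sigma.
Hypothesis b0 : 0 < beta.
Hypothesis Tr1 : (0 < Tr)%N.
Hypothesis Tu1 : (0 < Tu)%N.
Hypothesis s2 : sigma ^+ 2 <= (10 ^+ 4)^-1.
Hypothesis b1 : beta <= 1 / 20.
Hypothesis e0 : 0 < eps.
Hypothesis e1' : eps <= 768^-1.
Hypothesis hTr : - 4 * ln (sigma ^+ 2 * eps) <= Tr%:R.
Hypothesis hTnu : - (100 * ln (3 * eps)) / beta <= Tnu%:R.
Implicit Types nu x : R.

Let S := success sigma beta eps Tr Tnu Tu.
Let NH := nu_hat sigma beta Tr Tnu.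

(** The factor [sigma^2] inside the logarithm is at most [1/10000] and thereby supplies the constant
    [1/2000]. *)
Lemma tol_small : expR (- (Tr%:R / 4)) <= eps / 2000 :> R.
Proof.
have se : 0 < sigma ^+ 2 * eps by rewrite mulr_gt0// exprn_gt0.
have : expR (- (Tr%:R / 4)) <= sigma ^+ 2 * eps.
  rewrite -[leRHS]lnK ?posrE// ler_expR.
  by have := hTr; move: (ln _) => z hz; lra.
move/le_trans; apply; rewrite mulrC; apply: ler_wpM2l; first exact: ltW.
apply: le_trans s2 _; have -> : (10 ^+ 4 : R)^-1 = 1 / 100 * (1 / 100) by rewrite !exprS expr0; field.
lra.
Qed.

Lemma u_rough_bint : bint (@leb R) (@u_rough R Tr).
Proof. exact: Pm_bint (ind_bint 1). Qed.

Lemma nu_hat_near nu (n : int) : `|nu - nu_nat R - n%:~R * (pi / 2)| <= pi / 7 ->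
  angle_err (NH nu) <= 3 * eps.
Proof.
have [c [rho [c0 /andP[c1 c2] br _ [rt uE]]]] := @rough_profile R Tr Tr1.
have t1 : expR (- (Tr%:R / 4)) <= 1 / 2000 :> R.
  by apply: le_trans tol_small _; have := e1'; move: eps => e he; lra.
move=> h; apply/angle_errP; exists n.
have := @gd_converges R sigma beta c (expR (- (Tr%:R / 4))) rho s0 s2 b0 b1 c1 c2 br rt t1 eps
  (nu - n%:~R * (pi / 2)) Tnu e0 e1' tol_small hTnu.
rewrite -uE (addrAC nu) => /(_ h).
have := gd_period sigma beta (@u_rough R Tr) (nu - n%:~R * (pi / 2)) n Tnu; rewrite subrK.
by rewrite /NH /nu_hat => ->; rewrite addrAC addrK.
Qed.

Lemma u_hat_near nu : angle_err (NH nu) <= 3 * eps ->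
  (Lnorm (@leb R) 2%:E (EFin \o (fun s => (u_hat sigma beta Tr Tnu Tu nu s - u_nat s)%R)) <= (31 * Num.sqrt eps)%:E)%E.
Proof.
have [c [rho [c0 _ br [pr nr] [rt uE]]]] := @rough_profile R Tr Tr1.
have rt' x : `|rho x| <= 1 / 100.
  apply: le_trans (rt x) _; apply: le_trans tol_small _.
  by have := e1'; move: eps => e he; lra.
have [bw x0 W0 LW] := rough_alignment c0 br pr nr rt'; rewrite -uE in bw x0 W0 LW.
move=> /angle_errP[n hn].
pose nu' := NH nu - n%:~R * (pi / 2).
have d1 : `|sin (nu' - nu_nat R)| <= 3 * eps.
  by apply: le_trans (sin_norm_le _) _; rewrite /nu' addrAC.
(* The refinement runs with [eta = 3 * eps], so [eps <= 1/768] is its threshold [1/256]; the squared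
   error is then at most [27 * 3 * eps]. *)
have d2 : 3 * eps <= 1 / 256 by have := e1'; move: eps => e he; lra.
have uh : u_hat sigma beta Tr Tnu Tu nu = Pm Tu (@u_rough R Tr) nu'.
  by rewrite /u_hat -(Pm_period Tu _ nu' n) /nu' subrK.
have bu := @ind_bint R (alpha R).
have bD : bint (@leb R) (fun s => u_hat sigma beta Tr Tnu Tu nu s - u_nat s).
  by apply: bintB => //; rewrite uh; apply: Pm_bint.
rewrite LnormE// lee_fin uh.
have := Pm_error d1 d2 bw x0 W0 LW Tu1; rewrite -/(@u_nat R) => err.
have -> : 31 * Num.sqrt eps = Num.sqrt (31 ^+ 2 * eps).
  by rewrite sqrtrM ?sqr_ge0// sqrtr_sqr ger0_norm.
apply: ler_wsqrtr; apply: le_trans err _; rewrite mulrA expr2.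
by apply: ler_wpM2r; [exact: ltW|lra].
Qed.

(** By [u_hat_near] the angular bound implies the bound on the recovered function. The event reduces
    to the preimage of a countable union of intervals under the descent map. *)
Lemma successE : S = `[0, 2 * pi]%classic `&`
  NH @^-1` (\bigcup_(n : int) `[nu_nat R + n%:~R * (pi / 2) - 3 * eps, nu_nat R + n%:~R * (pi / 2) + 3 * eps]%classic).
Proof.
have I (n : int) x : `[nu_nat R + n%:~R * (pi / 2) - 3 * eps, nu_nat R + n%:~R * (pi / 2) + 3 * eps]%classic x <->
    `|x - nu_nat R - n%:~R * (pi / 2)| <= 3 * eps.
  rewrite /= in_itv/= ler_norml; move: (nu_nat R) (n%:~R * (pi / 2)) => a b.
  by split=> /andP[h1 h2]; apply/andP; split; lra.
apply/seteqP; split => [nu [h1 [h2 _]]|nu [h1 [n _ h2]]].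
  split; first by rewrite /= in_itv.
  by have [n hn] := (angle_errP _ _).1 h2; exists n => //; exact/I.
have h3 : angle_err (NH nu) <= 3 * eps by apply/angle_errP; exists n; exact/I.
by split; [move: h1; rewrite /= in_itv|split => //; exact: u_hat_near].
Qed.

Lemma NH_continuous : continuous NH.
Proof.
rewrite /NH /nu_hat; have bu := u_rough_bint; elim: Tnu => [|k IH]; first by move=> x; exact: cvg_id.
have step (F : R -> R) : continuous F -> continuous (fun x => F x - beta * grad_loss sigma (F x) (@u_rough R Tr)).
  move=> cF x; apply: cvgB; first exact: cF.
  apply: cvgM; first exact: cvg_cst.
  have cg : continuous (fun nu => grad_loss sigma nu (@u_rough R Tr)) by exact: grad_loss_continuous.
  by apply: continuous_comp; [exact: cF|exact: cg].
exact: step IH.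
Qed.

Lemma success_measurable : measurable S.
Proof.
rewrite successE; apply: measurableI; first exact: measurable_itv.
rewrite -[X in measurable X]setTI; apply: (continuous_measurable_fun NH_continuous) => //.
apply: countable_bigcupT_measurable; first exact: countableP.
by move=> n; exact: measurable_itv.
Qed.

(* Four disjoint intervals of total length 8 pi / 7, that is 4 / 7 of 2 pi. *)
Let J (k : nat) : set R := `[pi / 4 + k%:R * (pi / 2) - pi / 7, pi / 4 + k%:R * (pi / 2) + pi / 7]%classic.

Lemma J_success k : (k < 4)%N -> J k `<=` S.
Proof.
move=> k4 nu; rewrite /J /= in_itv/= => /andP[h1 h2].
have k3 : (k%:R : R) <= 3 by rewrite (ler_nat R k 3) -ltnS.
have k0 : 0 <= (k%:R : R) by rewrite ler0n.
have p0 := pi_gt0 R.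
have kp : k%:R * (pi / 2) <= 3 * (pi / 2) :> R by apply: ler_wpM2r => //; exact: ltW (pi2_gt0 R).
have kp0 : 0 <= k%:R * (pi / 2) :> R by apply: mulr_ge0 => //; exact: ltW (pi2_gt0 R).
have err : angle_err (NH nu) <= 3 * eps.
  apply: (@nu_hat_near nu k); rewrite /nu_nat ler_norml.
  move: h1 h2; rewrite -[(Posz k)%:~R]/(k%:R); move: (k%:R * (pi / 2)) => z h1 h2.
  by apply/andP; split; lra.
split; last by split => //; exact: u_hat_near.
(* Since [pi / 7 < pi / 4], the first and the last interval stay inside [[0, 2 pi]]. *)
by move: h1 h2 kp kp0; move: (k%:R * (pi / 2) : R) (pi : R) p0 => z p *; apply/andP; split; lra.
Qed.

Lemma leb_J k : @leb R (J k) = (2 * pi / 7)%:E.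
Proof.
have h := @lebesgue_measure_itv R `[pi / 4 + k%:R * (pi / 2) - pi / 7, pi / 4 + k%:R * (pi / 2) + pi / 7].
transitivity (lebesgue_measure (J k)); first by [].
rewrite /J h /= lte_fin; have p0 := pi_gt0 R; move: (k%:R * (pi / 2) : R) (pi : R) p0 => z p p0.
rewrite ifT; last by lra.
by rewrite EFinN -EFinB; congr EFin; field.
Qed.

Lemma J_disj i k x : (i < k)%N -> J i x -> J k x -> False.
Proof.
move=> ik; rewrite /J /= !in_itv/= => /andP[_ h1] /andP[h2 _].
have : i%:R + 1 <= k%:R :> R by rewrite natr1 ler_nat.
move/(ler_wpM2r (ltW (pi2_gt0 R))); rewrite mulrDl mul1r => h3.
have p0 := pi_gt0 R; move: h1 h2 h3; move: (i%:R * (pi / 2) : R) (k%:R * (pi / 2) : R) (pi : R) p0 => z y p *; lra.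
Qed.

Lemma success_measure : ((4 / 7)%:E <= ((2 * pi)^-1)%:E * @leb R S)%E.
Proof.
have mJ k : measurable (J k) by exact: measurable_itv.
have dj A k : (forall x, A x -> exists2 i, (i < k)%N & J i x) -> A `&` J k = set0.
  by move=> H; apply/seteqP; split => // x [/H[i ik Ji] Jk]; exact: J_disj ik Ji Jk.
have m01 : measurable (J 0%N `|` J 1%N) by exact: measurableU.
have m02 : measurable (J 0%N `|` J 1%N `|` J 2%N) by exact: measurableU.
have m03 : measurable (J 0%N `|` J 1%N `|` J 2%N `|` J 3%N) by exact: measurableU.
have mS := success_measurable.
have U1 : @leb R (J 0%N `|` J 1%N) = (@leb R (J 0%N) + @leb R (J 1%N))%E.
  by apply: measureU; [exact: mJ|exact: mJ|]; apply: (dj (J 0%N) 1%N) => x h; exists 0%N.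
have U2 : @leb R (J 0%N `|` J 1%N `|` J 2%N) = (@leb R (J 0%N `|` J 1%N) + @leb R (J 2%N))%E.
  by apply: measureU; [exact: m01|exact: mJ|]; apply: (dj (J 0%N `|` J 1%N) 2%N) => x [h|h]; [exists 0%N|exists 1%N].
have U3 : @leb R (J 0%N `|` J 1%N `|` J 2%N `|` J 3%N) = (@leb R (J 0%N `|` J 1%N `|` J 2%N) + @leb R (J 3%N))%E.
  by apply: measureU; [exact: m02|exact: mJ|]; apply: (dj (J 0%N `|` J 1%N `|` J 2%N) 3%N) => x [[h|h]|h]; [exists 0%N|exists 1%N|exists 2%N].
have le : (@leb R (J 0%N `|` J 1%N `|` J 2%N `|` J 3%N) <= @leb R S)%E.
  apply: le_measure; [by rewrite inE; exact: m03|by rewrite inE; exact: mS|].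
  by move=> x [[[h|h]|h]|h]; apply: (J_success _ h).
rewrite U3 U2 U1 !leb_J -!EFinD in le.
have p0 := pi_gt0 R.
have e : 4 / 7 = (2 * pi)^-1 * (2 * pi / 7 + 2 * pi / 7 + 2 * pi / 7 + 2 * pi / 7) :> R.
  by move: (pi : R) p0 => p p0; field; rewrite gt_eqF.
rewrite e EFinM; apply: lee_wpmul2l => //.
by rewrite lee_fin invr_ge0 mulr_ge0// ltW.
Qed.

End Success.

Theorem mainTheorem2 (R : realType) :
  exists c1 C1 C2 : R, 0 < c1 /\ 0 < C1 /\ 0 < C2 /\
  forall (sigma beta eps : R) (Tr Tnu Tu : nat),
    0 < sigma -> 0 < beta -> (1 <= Tr)%N -> (1 <= Tnu)%N -> (1 <= Tu)%N ->
    sigma ^+ 2 <= (10 ^+ 4)^-1 -> beta <= c1 ->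
    0 < eps -> eps <= 768^-1 ->
    - C1 * ln (sigma ^+ 2 * eps) <= Tr%:R ->
    - (C2 * ln (3 * eps)) / beta <= Tnu%:R ->
    (16 <= Tu)%N ->
    measurable (success sigma beta eps Tr Tnu Tu) /\
    ((4 / 7)%:E <= ((2 * pi)^-1)%:E * @leb R (success sigma beta eps Tr Tnu Tu))%E.
Proof.
(* [1/20] prevents overshooting, [4] inverts the decay [exp (- Tr / 4)] of the rough remainder, and
   [100] inverts the contraction rate [beta / 100]. *)
exists (1 / 20), 4, 100; do 3?[split; first by lra].
move=> sigma beta eps Tr Tnu Tu s0 b0 Tr1 _ Tu1 s2 b1 e0 e1 hTr hTnu _.
by split; [exact: success_measurable|exact: success_measure].
Qed.
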